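(* Let $H\in C(\mathbb{R}^d)$ be convex with $H(p)>H(0)=0$ for all $p\in\mathbb{R}^d\setminus\{0\}$. For almost every Brownian path $\zeta$ the following holds: if $u\in\mathrm{BUC}(\mathbb{R}^d\times[0,\infty))$ is a space-periodic pathwise (stochastic) viscosity solution of $du=H(Du)\cdot d\zeta$ in $\mathbb{R}^d\times(0,\infty)$, then there exists a constant $u_\infty=u_\infty(\zeta,u(\cdot,0))$ such that, as $t\to\infty$ and uniformly in $\mathbb{R}^d$, $u(\cdot,t)\to u_\infty$. Moreover, the random variable $u_\infty$ is, in general, not constant: there exist $d$, a convex Hamiltonian $H\in C(\mathbb{R}^d)$ with $H(p)>H(0)=0$ for all $p\in\mathbb{R}^d\setminus\{0\}$, and a periodic initial datum $u_0\in \mathrm{BUC}(\mathbb{R}^d)$ such that the random variable $\zeta\mapsto u_\infty(\zeta,u_0)$ is not almost surely equal to a deterministic constant.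
   Context: $\mathrm{BUC}(X)$ is the set of bounded uniformly continuous real functions on $X$. Brownian motion is one-dimensional and starts at $0$; its paths lie in $C_0([0,\infty);\mathbb{R})$, the set of continuous $\zeta:[0,\infty)\to\mathbb{R}$ with $\zeta(0)=0$. $C^1_0([0,\infty))$ is the subset of $C^1$ paths. (Space-)periodic means periodic with respect to $\mathbb{Z}^d$ in the space variable, i.e. a function on the torus $\mathbb{T}^d$. Pathwise (stochastic) viscosity solutions are defined path by path: for convex $H$ the solution operator is the unique continuous extension, in the path, of the classical viscosity solution operator for smooth paths. That is, $u$ is the pathwise solution of $du=H(Du)\cdot d\zeta$ with initial datum $u_0\in\mathrm{BUC}(\mathbb{R}^d)$ if, whenever $\zeta_n\in C_0^1([0,\infty))$ converge to $\zeta$ locally uniformly on $[0,\infty)$ and $u_{0,n}\in \mathrm{BUC}(\mathbb{R}^d)$ converge to $u_0$ uniformly, the (Crandall-Lions) viscosity solutions $u_n$ of $u_{n,t}=H(Du_n)\dot\zeta_n$ with $u_n(\cdot,0)=u_{0,n}$ converge to $u$ uniformly on $\mathbb{R}^d\times[0,T]$ for every $T>0$. It is known that such a solution exists and is unique. *)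

(* Defs.v *)
From HB Require Import structures.
From mathcomp Require Import all_boot all_order all_algebra.
From mathcomp Require Import all_classical all_reals all_analysis.

Set Implicit Arguments.
Unset Strict Implicit.
Unset Printing Implicit Defensive.

Import Order.TTheory GRing.Theory Num.Theory.
Import numFieldNormedType.Exports.

Local Open Scope classical_set_scope.
Local Open Scope ring_scope.

(* Functions on a part of a space (R^d x [0,oo[, R^d x [0,T], [0,oo[) are
   represented by total functions whose values outside that part are never
   used.  A point of space-time is a pair (x, t) : 'rV[R]_d * R. *)

Definition BUC (R : realType) (X : pseudoMetricType R) (A : set X)
    (f : X -> R) : Prop :=
  [bounded f x | x in A] /\ unif_continuous (f : subspace A -> R).

Definition slab (R : realType) (d : nat) (I : set R) : set ('rV[R]_d * R) :=
  [set p | I p.2].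

Definition Zd_periodic (R : realType) (d : nat) (f : 'rV[R]_d -> R) : Prop :=
  forall (x : 'rV[R]_d) (k : 'rV[int]_d), f (x + map_mx intr k) = f x.

Definition positive_off_origin (R : realType) (d : nat) (H : 'rV[R]_d -> R) :
    Prop :=
  H 0 = 0 /\ forall p, p != 0 -> H 0 < H p.

Definition C0_path (R : realType) (z : R -> R) : Prop :=
  z 0 = 0 /\ {within `[0, +oo[, continuous z}.

(* C^1 up to the boundary point 0: on ]0,oo[ the derivative exists and is the
   restriction of a function g that is continuous on [0,oo[. *)
Definition C1_path (R : realType) (z : R -> R) : Prop :=
  C0_path z /\
  exists g : R -> R, {within `[0, +oo[, continuous g} /\
    forall t : R, 0 < t -> is_derive t (1 : R) z (g t).

Section viscosity.
Variables (R : realType) (d : nat).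
Implicit Types (H : 'rV[R]_d -> R) (z : R -> R) (u phi : 'rV[R]_d * R -> R).

Definition C1_on (A : set ('rV[R]_d * R)) phi : Prop :=
  forall p, A p -> differentiable phi p /\
    forall v : 'rV[R]_d * R, {for p, continuous ('D_v phi)}.

Definition space_grad phi (p : 'rV[R]_d * R) : 'rV[R]_d :=
  \row_i 'D_(delta_mx 0 i, 0) phi p.

Definition time_deriv phi (p : 'rV[R]_d * R) : R := 'D_(0, 1) phi p.

Definition local_max (f : 'rV[R]_d * R -> R) (p : 'rV[R]_d * R) : Prop :=
  \forall q \near p, f q <= f p.

Definition local_min (f : 'rV[R]_d * R -> R) (p : 'rV[R]_d * R) : Prop :=
  \forall q \near p, f p <= f q.

(* Crandall-Lions sub- and supersolutions of u_t = H(Du) z'(t) on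
   R^d x ]0,oo[. *)
Definition viscosity_subsolution H z u : Prop :=
  forall phi, C1_on (slab `]0, +oo[) phi ->
  forall p : 'rV[R]_d * R, 0 < p.2 -> local_max (u \- phi) p ->
    time_deriv phi p <= H (space_grad phi p) * (z^`())%classic p.2.

Definition viscosity_supersolution H z u : Prop :=
  forall phi, C1_on (slab `]0, +oo[) phi ->
  forall p : 'rV[R]_d * R, 0 < p.2 -> local_min (u \- phi) p ->
    H (space_grad phi p) * (z^`())%classic p.2 <= time_deriv phi p.

(* The growth class BUC(R^d x [0,T]), T > 0, is the one in which the
   initial-value problem is well posed; outside it uniqueness may fail. *)
Definition viscosity_solution H z (u0 : 'rV[R]_d -> R) u : Prop :=
  [/\ forall T : R, 0 < T -> BUC (slab `[0, T]) u,
      forall x, u (x, 0) = u0 x,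
      viscosity_subsolution H z u &
      viscosity_supersolution H z u].

Definition pathwise_solution H z (u0 : 'rV[R]_d -> R) u : Prop :=
  forall (z_ : nat -> R -> R) (u0_ : nat -> 'rV[R]_d -> R)
         (u_ : nat -> 'rV[R]_d * R -> R),
    (forall n, C1_path (z_ n)) ->
    (forall T : R, 0 < T -> {uniform `[0, T], z_ @ \oo --> z}) ->
    (forall n, BUC [set: 'rV[R]_d] (u0_ n)) ->
    {uniform, u0_ @ \oo --> u0} ->
    (forall n, viscosity_solution H (z_ n) (u0_ n) (u_ n)) ->
    forall T : R, 0 < T -> {uniform slab `[0, T], u_ @ \oo --> u}.

(* u is a space-periodic pathwise solution of du = H(Du) . dz, with initial
   datum u(., 0) = u0, in BUC(R^d x [0,oo[). *)
Definition periodic_pathwise_solution H z (u0 : 'rV[R]_d -> R) u : Prop :=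
  [/\ BUC (slab `[0, +oo[) u,
      forall t : R, 0 <= t -> Zd_periodic (fun x => u (x, t)),
      forall x, u (x, 0) = u0 x &
      pathwise_solution H z u0 u].

Definition converges_to_constant u (c : R) : Prop :=
  {uniform, (fun (t : R) (x : 'rV[R]_d) => u (x, t)) @ +oo --> cst c}.

End viscosity.

Definition increment (R : realType) (T : Type) (B : R -> T -> R) (s t : R)
    (w : T) : R :=
  B t w - B s w.

(* One-dimensional standard Brownian motion started at 0, with every path in
   C_0([0,oo[; R).  The second parameter of normal_prob is the standard
   deviation. *)
Definition brownian_motion (R : realType) (dT : measure_display)
    (T : measurableType dT) (P : probability T R) (B : R -> {RV P >-> R}) :
    Prop :=
  [/\ forall w, C0_path (fun t => B t w),
      forall s t : R, 0 <= s -> s < t -> forall A : set R, measurable A ->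
        P (increment B s t @^-1` A) = normal_prob 0 (Num.sqrt (t - s)) A &
      forall (n : nat) (t : nat -> R) (A : nat -> set R),
        0 <= t 0%N -> {homo t : i j / (i <= j)%N >-> i <= j} ->
        (forall i, measurable (A i)) ->
        P (\bigcap_(i in `I_n) (increment B (t i) (t i.+1) @^-1` A i)) =
        (\prod_(i < n) P (increment B (t i) (t i.+1) @^-1` A i))%E].

Arguments brownian_motion {R dT T} P B.

(* Main.v *)
Require Import Defs.
From mathcomp Require Import all_boot all_order all_algebra.
From mathcomp Require Import all_classical all_reals all_analysis.
From mathcomp Require Import measurable_realfun.
From mathcomp Require Import lra ring.

Set Implicit Arguments.
Unset Strict Implicit.
Unset Printing Implicit Defensive.

Import Order.TTheory GRing.Theory Num.Theory.
Import numFieldNormedType.Exports.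

Local Open Scope classical_set_scope.
Local Open Scope ring_scope.

(** Let [H^*] be the Legendre transform of [H].  While the path rises by [a],
    the solution of [u_t = H(Du) z'] is the sup-convolution
    [x |-> sup_q (v (x + a q) - a H^*(q))] of its earlier value [v]; while the
    path falls, it is the corresponding inf-convolution.  These operators
    ([hopf_lax]) preserve order and constants, commute with translations, form
    a semigroup along moves in one direction, and a rise followed by a fall of
    the same size is a closing, which lies above the identity
    ([supconv_closing]).

    Convergence.  Suppose that at time [t] the path is above its starting
    point.  After the time of its minimum it stays above the value it had there,
    so by the closing inequality the excursions after the minimum only increase
    the solution compared with a single rise ([dilated_from_step]): the solution
    at time [t] is above the sup-convolution, over a rise at least [z t], of the
    solution [v1] at the time of the minimum, and it is below [sup v1].
    A convex [H] that vanishes only at [0] grows at least linearly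
    away from it ([linear_growth]), hence [H^*(q) <= eps |q|] for small [q], and a periodic
    function comes close to its supremum within distance [1] of every point.  So
    for a large rise the sup-convolution is everywhere within a multiple of
    [eps] of [sup v1], and the oscillation of the solution is small
    ([dilated_oscillation]).  A path below its starting point is treated by
    changing the signs of the path and of the solution.  A Brownian path is
    almost surely unbounded ([brownian_unbounded]); hence the oscillation tends
    to [0] along some times, and since constants are solutions, bounds that
    hold at one time hold later ([unbounded_convergence]).

    To reach a pathwise solution it is enough to follow one sequence of smooth
    paths along which viscosity solutions are known.  A continuous path is the
    limit of [C^1] paths that are monotone between the points of a grid
    ([smooth_path_cvg]), and along these the composed Hopf-Lax operators give a
    viscosity solution ([evolution_solution]).  The viscosity inequalities at a
    time [t] are checked by looking backward from [t] only
    ([backward_viscosity]), so a change of direction at [t] does no harm.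

    The limit is random.  Take [d = 1], [H p = |p|] and the distance to the
    integers, [tent], as initial datum.  On a nondecreasing function of [tent]
    the Hopf-Lax operators act by composition with a translation stopped at the
    ends of [[0, 1/2]] ([hopf_lax_tent]), so the solution is an explicit flow
    reflected at [0] and [1/2].  For an arbitrary [C^1] path and a datum close
    to [tent], comparison with smooth barriers on short time steps
    ([comparison_up], [comparison_down]) squeezes every viscosity solution
    between two such flows, and these depend on the path in a Lipschitz way for
    the uniform norm ([viscosity_stability]).  This yields the pathwise solution
    as a uniform limit ([tent_solution_pathwise]).  It is constant in space once
    the path has moved by more than [1].  If the path reaches [1/2] before
    [- 1/8], the solution is at least [3/8] everywhere at that time, hence
    forever; if it reaches [- 1/2] before [1/8], the solution is at most [1/8].
    Both events have positive probability ([corridor]), so no constant is the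
    limit almost surely. *)

(** * Hamiltonians and their Legendre transform *)

Section hamiltonian.
Variables (R : realType) (d : nat).
Notation V := 'rV[R]_d.
Implicit Types (H : V -> R) (p q x y e : V).

Definition dot p q : R := \sum_i p 0 i * q 0 i.
Definition norm1 q : R := \sum_i `|q 0 i|.
Definition in_cube (r : R) q := forall i, `|q 0 i| <= r.

Lemma dotDl p p' q : dot (p + p') q = dot p q + dot p' q.
Proof. by rewrite /dot -big_split; apply: eq_bigr => i _; rewrite mxE mulrDl. Qed.

Lemma dotDr p q q' : dot p (q + q') = dot p q + dot p q'.
Proof. by rewrite /dot -big_split; apply: eq_bigr => i _; rewrite mxE mulrDr. Qed.

Lemma dotZr p (a : R) q : dot p (a *: q) = a * dot p q.
Proof.
by rewrite /dot mulr_sumr; apply: eq_bigr => i _; rewrite mxE mulrCA.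
Qed.

Lemma dotZl p (a : R) q : dot (a *: p) q = a * dot p q.
Proof.
by rewrite /dot mulr_sumr; apply: eq_bigr => i _; rewrite mxE mulrA.
Qed.

Lemma dotNr p q : dot p (- q) = - dot p q.
Proof. by rewrite -scaleN1r dotZr mulN1r. Qed.

Lemma dotNl p q : dot (- p) q = - dot p q.
Proof. by rewrite -scaleN1r dotZl mulN1r. Qed.

Lemma dot0l q : dot 0 q = 0.
Proof. by rewrite -(scale0r 0) dotZl mul0r. Qed.

Lemma dot0r q : dot q 0 = 0.
Proof. by rewrite -(scale0r 0) dotZr mul0r. Qed.

Lemma norm1_ge0 q : 0 <= norm1 q.
Proof. by apply: sumr_ge0. Qed.

Lemma norm1Z a q : norm1 (a *: q) = `|a| * norm1 q.
Proof. by rewrite /norm1 mulr_sumr; apply: eq_bigr => i _; rewrite mxE normrM. Qed.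

Lemma norm1N q : norm1 (- q) = norm1 q.
Proof. by rewrite -scaleN1r norm1Z normrN1 mul1r. Qed.

Lemma norm1_le (r : R) q : in_cube r q -> norm1 q <= r * d%:R.
Proof.
move=> qr; apply: (@le_trans _ _ (\sum_(i < d) r)); first exact: ler_sum.
by rewrite sumr_const card_ord mulr_natr.
Qed.

Lemma coord_le_norm1 q i : `|q 0 i| <= norm1 q.
Proof. by rewrite /norm1 (bigD1 i)//= lerDl sumr_ge0. Qed.

Lemma norm_le_norm1 q : `|q| <= norm1 q.
Proof.
rewrite -[`|q|]/(mx_norm q) mx_normrE; apply: bigmax_le; first exact: norm1_ge0.
by move=> [i j] _ /=; rewrite (ord1 i); exact: coord_le_norm1.
Qed.

Lemma coord_le_norm q i : `|q 0 i| <= `|q|.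
Proof.
rewrite -[`|q|]/(mx_norm q) mx_normrE.
by apply: (@le_bigmax _ _ _ 0 (fun ij : 'I_1 * 'I_d => `|q ij.1 ij.2|) (0, i)).
Qed.

Lemma norm_le_cube (r : R) q : 0 <= r -> in_cube r q -> `|q| <= r.
Proof.
move=> r0 qr; rewrite -[`|q|]/(mx_norm q) mx_normrE; apply: bigmax_le => //.
by move=> [i j] _ /=; rewrite (ord1 i); exact: qr.
Qed.

Lemma norm1_le_norm q : norm1 q <= `|q| * d%:R.
Proof. by apply: norm1_le => i; exact: coord_le_norm. Qed.

Lemma dot_le p q (r : R) : 0 <= r -> in_cube r p -> `|dot p q| <= r * norm1 q.
Proof.
move=> r0 pr; apply: (le_trans (ler_norm_sum _ _ _)).
rewrite /norm1 mulr_sumr; apply: ler_sum => i _.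
by rewrite normrM ler_wpM2r.
Qed.

(** The epigraph of the Legendre transform of [H]. *)
Definition legendre_epi H : set (V * R) :=
  [set ql | forall p, dot p ql.1 - H p <= ql.2].

Definition convexH H := forall (t : R) p q, 0 <= t <= 1 ->
  H (t *: p + (1 - t) *: q) <= t * H p + (1 - t) * H q.

Lemma convex_functionE H : convex_function [set: V] H -> convexH H.
Proof.
move=> cH t p q t01.
have := cH (Itv01 (andP t01).1 (andP t01).2) p q.
by rewrite !inE => /(_ I I); rewrite convRE.
Qed.

Section fixed.
Variable H : V -> R.
Hypotheses (H0 : H 0 = 0) (Hge0 : forall p, 0 <= H p) (Hcont : continuous H).

Lemma epi_ge0 ql : legendre_epi H ql -> 0 <= ql.2.
Proof. by move=> /(_ 0); rewrite dot0l H0 subr0. Qed.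

Lemma epi0 : legendre_epi H (0, 0).
Proof. by move=> p /=; rewrite dot0r sub0r oppr_le0. Qed.

(** Convexity of the epigraph, weighted by the lengths of two successive moves:
    together they cost no less than a single straight one. *)
Lemma epi_convex a b ql ql' : 0 <= a -> 0 <= b -> 0 < a + b ->
  legendre_epi H ql -> legendre_epi H ql' ->
  exists2 ql'', legendre_epi H ql'' &
    (a + b) *: ql''.1 = a *: ql.1 + b *: ql'.1 /\
    (a + b) * ql''.2 = a * ql.2 + b * ql'.2.
Proof.
move=> a0 b0 ab e e'.
exists ((a + b)^-1 *: (a *: ql.1 + b *: ql'.1), (a + b)^-1 * (a * ql.2 + b * ql'.2)).
  move=> p /=; rewrite dotZr dotDr !dotZr.
  rewrite -(ler_pM2l ab) mulrBr !mulrA mulfV ?gt_eqF// !mul1r.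
  have := ler_wpM2l a0 (e p); have := ler_wpM2l b0 (e' p).
  lra.
by rewrite /= scalerA mulrA mulfV ?gt_eqF// scale1r mul1r.
Qed.

(** Superlinearity of the Legendre transform: the conjugate of a finite function
    absorbs any linear growth, with a constant read off [H] on a cube. *)
Lemma epi_growth (K C : R) p ql : 0 <= K ->
  (forall e, in_cube K e -> H (p + e) <= C) -> legendre_epi H ql ->
  dot p ql.1 + K * norm1 ql.1 - ql.2 <= C.
Proof.
move=> K0 HC E.
pose e : V := \row_i (K * Num.sg (ql.1 0 i)).
have eK : in_cube K e.
  move=> i; rewrite mxE normrM ger0_norm// ler_piMr// normr_sg.
  by case: (_ != _); rewrite ?lexx.
have de : dot e ql.1 = K * norm1 ql.1.
  rewrite /dot /norm1 mulr_sumr; apply: eq_bigr => i _.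
  by rewrite mxE -mulrA -normrEsg.
have := E (p + e); have := HC _ eK; rewrite dotDl de; lra.
Qed.

(** Together with [epi_growth] this makes displacements of a given length too
    expensive over a short rise. *)
Lemma H_bounded_cube (K : R) : 0 <= K ->
  exists2 C, 0 <= C & forall e, in_cube K e -> H e <= C.
Proof.
move=> K0.
have cA : compact [set v : V | forall i, `[- K, K]%classic (v ord0 i)].
  by apply: (@rV_compact R d (fun=> `[- K, K]%classic)) => i; exact: segment_compact.
have [//||c _ cmax] := EVT_max_rV _ cA (f := H).
- by exists 0 => i /=; rewrite mxE in_itv /= oppr_le0 K0.
- by apply: continuous_subspaceT.
exists (H c) => // e eK; apply: cmax; rewrite inE => i /=.
by rewrite in_itv /= -ler_norml; exact: eK.
Qed.

Lemma H_near p (eps : R) : 0 < eps -> exists2 r, 0 < r &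
  forall e, in_cube r e -> H (p + e) <= H p + eps.
Proof.
move=> e0; have /cvgrPdist_le /(_ _ e0) := Hcont (x := p).
move=> /nbhs_normP[r /= r0 hr]; exists (r / 2); first by rewrite divr_gt0.
move=> e er; have := hr (p + e).
rewrite /= opprD addrA subrr sub0r normrN.
have er' : `|e| < r.
  apply: (@le_lt_trans _ _ (r / 2)); last lra.
  by apply: norm_le_cube => //; lra.
by move=> /(_ er'); rewrite ler_norml; lra.
Qed.

End fixed.
End hamiltonian.

Section subgradient.
Variables (R : realType) (d : nat).
Notation V := 'rV[R]_d.
Implicit Types (H : V -> R) (p q : V).

(** Hahn-Banach in finite dimension. A linear minorant on the span of the first
    [k] coordinates extends to the next coordinate: by convexity every
    difference quotient on the negative side is at most every difference
    quotient on the positive side, and any number in between is an admissible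
    slope. *)
Lemma supporting_hyperplane (P : V -> R) : convexH P -> P 0 = 0 ->
  exists q, forall v, dot v q <= P v.
Proof.
move=> cP P0.
suff main k : (k <= d)%N -> exists q, forall v : V,
    (forall i : 'I_d, (k <= i)%N -> v 0 i = 0) -> dot v q <= P v.
  have [q hq] := main d (leqnn d).
  by exists q => v; apply: hq => i; rewrite leqNgt ltn_ord.
elim: k => [|k IH] kd.
  exists 0 => v v0; rewrite dot0r (_ : v = 0) ?P0//.
  by apply/rowP => i; rewrite mxE v0.
have {IH}[q hq] := IH (ltnW kd).
pose k' := Ordinal kd; pose e : V := delta_mx 0 k'.
have dote v : dot v e = v 0 k'.
  rewrite /dot (bigD1 k')//= big1 ?addr0 ?mxE ?eqxx ?mulr1//.
  by move=> i ik; rewrite mxE (negbTE ik) andbF mulr0.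
pose supp (v : V) := forall i : 'I_d, (k <= i)%N -> v 0 i = 0.
pose A := [set r | exists2 sv : R * V, 0 < sv.1 /\ supp sv.2 &
  r = (dot sv.2 q - P (sv.2 - sv.1 *: e)) / sv.1].
have Aub w r : 0 < r -> supp w -> ubound A ((P (w + r *: e) - dot w q) / r).
  move=> r0 sw _ [[s v] /= [s0 sv] ->] /=.
  rewrite ler_pdivrMr// mulrAC ler_pdivlMr//.
  have rs : 0 < r + s by rewrite addr_gt0.
  have t01 : 0 <= r / (r + s) <= 1.
    by apply/andP; split; rewrite ?ler_pdivrMr ?mul1r ?lerDl ?divr_ge0// ltW.
  have := cP _ (v - s *: e) (w + r *: e) t01.
  have -> : 1 - r / (r + s) = s / (r + s) by field; rewrite gt_eqF.
  have -> : (r / (r + s)) *: (v - s *: e) + (s / (r + s)) *: (w + r *: e)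
      = (r + s)^-1 *: (r *: v + s *: w).
    apply/rowP => i; rewrite !mxE; field; by rewrite gt_eqF.
  have /hq : supp ((r + s)^-1 *: (r *: v + s *: w)).
    by move=> i ki; rewrite !mxE sv// sw// !mulr0 addr0 mulr0.
  rewrite dotZl dotDl !dotZl => h1 /(le_trans h1).
  rewrite ![_ / (r + s)]mulrC -!mulrA -mulrDr ler_pM2l ?invr_gt0//; lra.
have A0 : A !=set0 by eexists; exists (1, 0) => //=; split=> // i _; rewrite mxE.
have hA : has_ubound A.
  by exists ((P (0 + 1 *: e) - dot 0 q) / 1); apply: Aub => // i _; rewrite mxE.
(* the slopes on the negative side form [A]; the new coordinate of the minorant
   is their supremum *)
pose al := sup A.
exists (q + (al - q 0 k') *: e) => u su.
pose c := u 0 k'; pose v := u - c *: e.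
have sv : supp v.
  move=> i; rewrite leq_eqVlt => /orP[/eqP ki|ki].
    have -> : i = k' by apply: val_inj.
    by rewrite !mxE !eqxx mulr1 subrr.
  rewrite !mxE su// (_ : i == k' = false) ?andbF ?mulr0 ?subr0//.
  by apply/negP => /eqP ik; rewrite ik ltnn in ki.
have uv : u = v + c *: e by rewrite subrK.
have -> : dot u (q + (al - q 0 k') *: e) = dot v q + c * al.
  rewrite dotDr dotZr dote -/c {1}uv dotDl dotZl.
  suff -> : dot e q = q 0 k' by ring.
  by rewrite -dote /dot; apply: eq_bigr => i _; rewrite mulrC.
have [c0|c0|c0] := ltgtP 0 c; last first.
- by rewrite uv -c0 mul0r scale0r !addr0; exact: hq.
- have : (dot v q - P (v - (- c) *: e)) / (- c) <= al.
    by apply: ub_le_sup => //; exists (- c, v) => //=; rewrite oppr_gt0.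
  rewrite ler_pdivrMr ?oppr_gt0// scaleNr opprK -uv; lra.
- have : al <= (P (v + c *: e) - dot v q) / c by apply: ge_sup => //; exact: Aub.
  by rewrite -uv ler_pdivlMr// mulrC; lra.
Qed.

(** Fenchel duality at a point: a subgradient of [H] realizes the conjugate. *)
Lemma epi_subgradient H p : convexH H ->
  exists2 ql, legendre_epi H ql & H p = dot p ql.1 - ql.2.
Proof.
move=> cH.
have [|//|q hq] := @supporting_hyperplane (fun v => H (p + v) - H p).
- move=> t x y t01.
  have -> : p + (t *: x + (1 - t) *: y) = t *: (p + x) + (1 - t) *: (p + y).
    by apply/rowP => i; rewrite !mxE; ring.
  by have := cH _ (p + x) (p + y) t01; lra.
- by rewrite addr0 subrr.
exists (q, dot p q - H p); last by rewrite /=; ring.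
move=> p' /=; have := hq (p' - p); rewrite dotDl dotNl addrCA subrr addr0; lra.
Qed.

(** Away from the origin a convex [H] with a strict minimum at the origin grows
    at least linearly, so small velocities have an arbitrarily small cost per
    unit length. *)
Lemma epi_small_velocity H (eps m : R) : H 0 = 0 -> (forall p, 0 <= H p) ->
  0 < eps -> (forall p, ~ in_cube eps p -> forall i, m * `|p 0 i| <= H p) ->
  forall q, norm1 q <= m -> legendre_epi H (q, eps * norm1 q).
Proof.
move=> H0 Hge0 e0 hm q qm p /=.
have [pc|pc] := pselect (in_cube eps p).
  have := dot_le q (ltW e0) pc; rewrite ler_norml; have := Hge0 p; lra.
have q0 := norm1_ge0 q; have m0 := le_trans q0 qm.
have pm : in_cube `|p| p by move=> i; exact: coord_le_norm.
have := dot_le q (normr_ge0 p) pm.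
have : m * `|p| <= H p.
  have [->|/mx_norm_neq0[[i j] /=]] := eqVneq `|p| 0; first by rewrite mulr0.
  by rewrite (ord1 i) -[mx_norm p]/(`|p|) => ->; apply: hm.
have := ler_wpM2l (normr_ge0 p) qm.
rewrite ler_norml [`|p| * m]mulrC => h1 h2 /andP[_ h3].
have := mulr_ge0 (ltW e0) q0; lra.
Qed.

(** Compactness gives [H] a positive minimum on the boundary of a cube, and
    convexity with [H 0 = 0] makes [H] at least proportional to the distance to
    the origin outside the cube. *)
Lemma linear_growth H (eps : R) : convexH H -> continuous H -> H 0 = 0 ->
  (forall p, p != 0 -> 0 < H p) -> 0 < eps ->
  exists2 m, 0 < m & forall p, ~ in_cube eps p -> forall i, m * `|p 0 i| <= H p.
Proof.
move=> cH Hc H0 Hp e0.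
have Hge0 p : 0 <= H p by have [->|/Hp/ltW] := eqVneq p 0; rewrite ?H0.
(* [convexH] propagates outwards along rays the positive minimum that [H] has
   on the boundary of the cube of radius [eps], that is, on its faces *)
pose face (i : 'I_d) (s : bool) :=
  [set v : V | in_cube eps v /\ v 0 i = (-1) ^+ s * eps].
have cface i s : exists2 m, 0 < m & forall v, face i s v -> m <= H v.
  have cA : compact [set v : V | forall j,
      (if j == i then [set (-1) ^+ s * eps] else `[- eps, eps]%classic) (v ord0 j)].
    apply: (@rV_compact R d (fun j => if j == i then [set (-1) ^+ s * eps]
      else `[- eps, eps]%classic)) => j.
    by case: ifP => _; [exact: compact_set1|exact: segment_compact].
  have [||c cin cmin] := EVT_min_rV _ cA (f := H).
  - exists ((-1) ^+ s *: \row_(j < d) (if j == i then eps else 0)) => j /=.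
    rewrite !mxE; case: ifP => _ //=.
    by rewrite mulr0 /= ?in_itv /= oppr_le0 ltW.
  - by apply: continuous_subspaceT.
  exists (H c).
    apply: Hp; apply/eqP => c0; move: cin; rewrite inE => /(_ i) /=.
    by rewrite eqxx c0 mxE => /esym /eqP; rewrite mulf_eq0 signr_eq0 gt_eqF.
  move=> v [vc vi]; apply: cmin; rewrite inE => j /=.
  case: eqP => [-> //|_] /=; rewrite in_itv/= -ler_norml; exact: vc.
pose m_ i s := sval (cid2 (cface i s)).
have m_gt0 i s : 0 < m_ i s by rewrite /m_; case: cid2.
have m_le i s v : face i s v -> m_ i s <= H v by rewrite /m_; case: cid2 => /= ? _; apply.
pose m := \big[Num.min/1]_(i : 'I_d) Num.min (m_ i true) (m_ i false).
have m0 : 0 < m.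
  by rewrite /m; elim/big_ind: _ => // [x y x0 y0|i _]; by rewrite lt_min ?x0 ?y0 ?m_gt0.
exists (m / eps) => [|p pc]; first by rewrite divr_gt0.
have {pc}[j pj] : exists j, forall i, `|p 0 i| <= `|p 0 j| /\ eps < `|p 0 j|.
  have [j0 hj0] : exists j, eps < `|p 0 j|.
    by apply: contrapT => hn; apply: pc => i; rewrite leNgt; apply/negP => hi; apply: hn; exists i.
  have [j _ hj] := @arg_maxP _ _ _ j0 xpredT (fun j => `|p 0 j|) isT.
  by exists j => i; split; [apply: hj|apply: lt_le_trans hj0 (hj _ _)].
move=> i; have [pij epj] := pj i.
apply: (@le_trans _ _ (m / eps * `|p 0 j|)).
  by rewrite ler_wpM2l// divr_ge0// ltW.
pose s := p 0 j < 0; pose t := eps / `|p 0 j|.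
have pj0 : 0 < `|p 0 j| by apply: lt_trans epj.
have t01 : 0 <= t <= 1 by apply/andP; rewrite /t; split; rewrite ?ler_pdivrMr ?mul1r ?divr_ge0// ltW.
have fv : face j s (t *: p).
  split=> [k|].
    rewrite mxE normrM ger0_norm; last by case/andP: t01.
    have h := (pj k).1; rewrite /t.
    by rewrite mulrAC ler_pdivrMr// ler_pM2l.
  rewrite mxE /t {2}[p 0 j]numEsign /s; field; by rewrite gt_eqF.
have mH : m <= H (t *: p).
  apply: le_trans (m_le _ _ _ fv).
  rewrite /m (bigD1 j)//= ge_min; apply/orP; left.
  by rewrite ge_min; case: s {fv}; rewrite lexx ?orbT.
have := cH t p 0 t01; rewrite scaler0 addr0 H0 mulr0 addr0 => h.
have := le_trans mH h.
rewrite /t -(ler_pM2r pj0) => h'.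
rewrite mulrAC ler_pdivrMr// [H p * _]mulrC.
apply: (le_trans h'); rewrite le_eqVlt; apply/orP; left; apply/eqP; field; by rewrite gt_eqF.
Qed.

End subgradient.

(** * Hopf-Lax operators *)

Section supconv.
Variables (R : realType) (d : nat).
Notation V := 'rV[R]_d.
Implicit Types (H v w : V -> R) (p q x y k : V) (ql : V * R).

Definition bounded_by (M : R) v := forall x, `|v x| <= M.

(** A quantitative form of boundedness with uniform continuity that is
    preserved exactly, with the same gauge [K], by operators that commute with
    translations and with the addition of constants and preserve the order. *)
Definition almost_lipschitz (K : R -> R) v := forall eps, 0 < eps ->
  forall x y, v y <= v x + eps + K eps * norm1 (y - x).

Definition supconv H (a : R) v x : R :=
  sup [set r | exists2 ql, legendre_epi H ql & r = v (x + a *: ql.1) - a * ql.2].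

Definition mirror H p : R := H (- p).

(** The solution operator of [u_t = H(Du) z'] along a monotone piece of path of
    increment [a]: the Hopf-Lax formula, a sup-convolution when the path goes
    up, an inf-convolution when it goes down. *)
Definition hopf_lax H (a : R) v : V -> R :=
  if 0 <= a then supconv H a v
  else fun x => - supconv (mirror H) (- a) (fun y => - v y) x.

Section fixed.
Variable H : V -> R.
Hypotheses (H0 : H 0 = 0) (Hge0 : forall p, 0 <= H p).

Lemma bounded_by_ge0 M v : bounded_by M v -> 0 <= M.
Proof. by move=> /(_ 0); apply: le_trans. Qed.

Lemma supconv_has_sup M a v x : 0 <= a -> bounded_by M v ->
  has_sup [set r | exists2 ql, legendre_epi H ql & r = v (x + a *: ql.1) - a * ql.2].
Proof.
move=> a0 vM; split.
  by eexists; exists (0, 0) => //; exact: epi0.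
exists M => _ [ql Eql ->].
have := vM (x + a *: ql.1); rewrite ler_norml => /andP[_].
have := mulr_ge0 a0 (epi_ge0 H0 Eql); lra.
Qed.

Lemma supconv_ge M a v x ql : 0 <= a -> bounded_by M v -> legendre_epi H ql ->
  v (x + a *: ql.1) - a * ql.2 <= supconv H a v x.
Proof.
move=> a0 vM E; apply: ub_le_sup; last by exists ql.
by have [] := supconv_has_sup x a0 vM.
Qed.

Lemma supconv_le a v x c :
  (forall ql, legendre_epi H ql -> v (x + a *: ql.1) - a * ql.2 <= c) ->
  supconv H a v x <= c.
Proof.
move=> h; apply: ge_sup; first by eexists; exists (0, 0) => //; exact: epi0.
by move=> _ [ql E ->]; exact: h.
Qed.

Lemma supconv_approx M a v x eps : 0 <= a -> bounded_by M v -> 0 < eps ->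
  exists2 ql, legendre_epi H ql & supconv H a v x - eps < v (x + a *: ql.1) - a * ql.2.
Proof.
move=> a0 vM e0; have [_ [ql E ->] h] := sup_adherent e0 (supconv_has_sup x a0 vM).
by exists ql.
Qed.

Lemma supconv_ge_id M a v x : 0 <= a -> bounded_by M v -> v x <= supconv H a v x.
Proof.
move=> a0 vM; have := supconv_ge x a0 vM (epi0 Hge0).
by rewrite /= scaler0 mulr0 addr0 subr0.
Qed.

Lemma supconv_le_cst a v x c : 0 <= a -> (forall y, v y <= c) -> supconv H a v x <= c.
Proof.
move=> a0 vc; apply: supconv_le => ql E.
have := mulr_ge0 a0 (epi_ge0 H0 E); have := vc (x + a *: ql.1); lra.
Qed.

Lemma supconv_bounded M a v : 0 <= a -> bounded_by M v -> bounded_by M (supconv H a v).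
Proof.
move=> a0 vM x; rewrite ler_norml; apply/andP; split.
  apply: le_trans (supconv_ge_id x a0 vM).
  by have := vM x; rewrite ler_norml => /andP[].
apply: supconv_le_cst => // y.
by have := vM y; rewrite ler_norml => /andP[].
Qed.

Lemma supconv_mono M a v w c x : 0 <= a -> bounded_by M w ->
  (forall y, v y <= w y + c) -> supconv H a v x <= supconv H a w x + c.
Proof.
move=> a0 wM vw; apply: supconv_le => ql E.
have := supconv_ge x a0 wM E; have := vw (x + a *: ql.1); lra.
Qed.

Lemma supconv0 M v x : bounded_by M v -> supconv H 0 v x = v x.
Proof.
move=> vM; apply/eqP; rewrite eq_le (supconv_ge_id x _ vM)// andbT.
by apply: supconv_le => ql _; rewrite scale0r addr0 mul0r subr0.
Qed.

(** Two successive moves are no better than one straight move by convexity of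
    the epigraph, and a straight move can be cut in two. *)
Lemma supconv_semigroup M a b v x : 0 <= a -> 0 <= b -> bounded_by M v ->
  supconv H a (supconv H b v) x = supconv H (a + b) v x.
Proof.
move=> a0 b0 vM; have ab0 := addr_ge0 a0 b0; apply/eqP; rewrite eq_le.
apply/andP; split.
  apply: supconv_le => ql E; rewrite lerBlDr; apply: supconv_le => ql' E'.
  have [ab|ab] := ltP 0 (a + b); last first.
    have [-> ->] : a = 0 /\ b = 0 by lra.
    rewrite !scale0r !mul0r !addr0 subr0.
    exact: supconv_ge_id vM.
  have [ql'' E'' [h1 h2]] := epi_convex a0 b0 ab E E'.
  have := supconv_ge x ab0 vM E''; rewrite h1 h2 addrA; lra.
apply: supconv_le => ql E.
have := supconv_ge x a0 (supconv_bounded b0 vM) E.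
have := supconv_ge (x + a *: ql.1) b0 vM E.
rewrite -addrA -scalerDl; lra.
Qed.

Lemma supconv_shift a v k : (forall x, v (x + k) = v x) ->
  forall x, supconv H a v (x + k) = supconv H a v x.
Proof.
move=> vk x; congr sup; apply/seteqP; split=> _ [ql E ->]; exists ql => //.
  by rewrite addrAC vk.
by rewrite [x + k + _]addrAC vk.
Qed.

Lemma supconv_almost_lipschitz M K a v : 0 <= a -> bounded_by M v ->
  almost_lipschitz K v -> almost_lipschitz K (supconv H a v).
Proof.
move=> a0 vM vK eps e0 x y; apply: supconv_le => ql E.
have := supconv_ge x a0 vM E; have := vK eps e0 (x + a *: ql.1) (y + a *: ql.1).
by rewrite opprD addrACA subrr addr0; lra.
Qed.

(** Over a short rise a long displacement costs more than the modulus of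
    continuity of [v] can gain, by the superlinearity of the Legendre
    transform. *)
Lemma supconv_short_time K a v eps C x : 0 <= a -> almost_lipschitz K v ->
  0 < eps -> 0 <= K eps -> (forall e, in_cube (K eps) e -> H e <= C) ->
  supconv H a v x <= v x + eps + a * C.
Proof.
move=> a0 vK e0 K0 HC; apply: supconv_le => ql E.
have := vK eps e0 x (x + a *: ql.1).
rewrite [x + _ - x]addrAC subrr add0r norm1Z ger0_norm//.
have HC' e : in_cube (K eps) e -> H (0 + e) <= C by rewrite add0r; exact: HC.
have := ler_wpM2l a0 (epi_growth K0 HC' E); rewrite dot0l; lra.
Qed.

Lemma mirror_epi ql : legendre_epi (mirror H) ql <-> legendre_epi H (- ql.1, ql.2).
Proof.
split=> h p /=; first by have := h (- p); rewrite /mirror opprK dotNl dotNr.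
by have := h (- p); rewrite /= dotNl dotNr opprK.
Qed.

(** Dilation followed by erosion is a closing, hence lies above the identity. *)
Lemma supconv_closing M a v x : 0 <= a -> bounded_by M v ->
  v x <= - supconv (mirror H) a (fun y => - supconv H a v y) x.
Proof.
move=> a0 vM; rewrite lerNr.
apply: ge_sup.
  by eexists; exists (0, 0) => //; move=> p /=; rewrite dot0r sub0r oppr_le0 /mirror.
move=> _ [ql /mirror_epi E ->].
have := supconv_ge (x + a *: ql.1) a0 vM E.
rewrite /= scalerN addrK; lra.
Qed.

End fixed.
End supconv.

Section hopf_lax.
Variables (R : realType) (d : nat).
Notation V := 'rV[R]_d.
Implicit Types (H v w : V -> R) (p q x y k : V) (ql : V * R).

(** Stable under [mirror], so that each statement about rising paths gives one
    about falling paths. *)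
Definition hamiltonian H :=
  [/\ continuous H, convexH H, H 0 = 0 & forall p, 0 <= H p].

Lemma mirrorK H : mirror (mirror H) = H.
Proof. by apply/funext => p; rewrite /mirror opprK. Qed.

Lemma mirror_hamiltonian H : hamiltonian H -> hamiltonian (mirror H).
Proof.
move=> [Hc cH H0 Hge0]; split.
- by move=> p; apply: continuous_comp; [exact: opp_continuous|exact: Hc].
- move=> t p q t01; rewrite /mirror opprD -!scalerN; exact: cH.
- by rewrite /mirror oppr0.
- by move=> p; exact: Hge0.
Qed.

Lemma bounded_byN M v : bounded_by M v -> bounded_by M (fun x => - v x).
Proof. by move=> vM x; rewrite normrN. Qed.

Lemma almost_lipschitzN K v : almost_lipschitz K v -> almost_lipschitz K (fun x => - v x).
Proof.
move=> vK eps e0 x y; have := vK eps e0 y x.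
by rewrite -opprB norm1N; lra.
Qed.

Lemma hopf_laxN H M a v x : hamiltonian H -> bounded_by M v ->
  hopf_lax (mirror H) (- a) (fun y => - v y) x = - hopf_lax H a v x.
Proof.
move=> [_ _ H0 Hge0] vM; rewrite /hopf_lax oppr_ge0.
have vv : (fun y => - - v y) = v by apply/funext => y; rewrite opprK.
have [a0|a0|->] := ltgtP a 0; rewrite ?mirrorK ?vv ?opprK// oppr0.
have H0' : mirror H 0 = 0 by rewrite /mirror oppr0.
rewrite (supconv0 H0' _ x (bounded_byN vM)); last by move=> p; apply: Hge0.
by rewrite (supconv0 H0 Hge0 x vM).
Qed.

Section fixed.
Variable H : V -> R.
Hypothesis hH : hamiltonian H.

Let hH' := mirror_hamiltonian hH.

Lemma hopf_lax_pos a v : 0 <= a -> hopf_lax H a v = supconv H a v.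
Proof. by rewrite /hopf_lax => ->. Qed.

Lemma hopf_lax_bounded M a v : bounded_by M v -> bounded_by M (hopf_lax H a v).
Proof.
move=> vM; rewrite /hopf_lax; case: hH hH' => [_ _ H0 Hge0] [_ _ H0' Hge0'].
case: ifPn => a0; first exact: supconv_bounded.
apply: bounded_byN; apply: supconv_bounded => //; last exact: bounded_byN.
by rewrite oppr_ge0 ltW// ltNge.
Qed.

Lemma hopf_lax0 M v : bounded_by M v -> hopf_lax H 0 v = v.
Proof.
case: hH => _ _ H0 Hge0 vM; apply/funext => x.
by rewrite hopf_lax_pos// (supconv0 H0 Hge0 x vM).
Qed.

Lemma hopf_lax_mono M a v w c x : bounded_by M v -> bounded_by M w ->
  (forall y, v y <= w y + c) -> hopf_lax H a v x <= hopf_lax H a w x + c.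
Proof.
move=> vM wM vw; rewrite /hopf_lax; case: hH hH' => [_ _ H0 Hge0] [_ _ H0' Hge0'].
case: ifPn => a0; first exact: (supconv_mono H0 Hge0 x a0 wM).
rewrite -ltNge in a0; have na0 : 0 <= - a by lra.
have vw' y : - w y <= - v y + c by have := vw y; lra.
have := supconv_mono H0' Hge0' x na0 (bounded_byN vM) vw'; lra.
Qed.

Lemma hopf_lax_le_cst M a v c x : bounded_by M v -> (forall y, v y <= c) ->
  hopf_lax H a v x <= c.
Proof.
move=> vM vc; rewrite /hopf_lax; case: hH hH' => [_ _ H0 Hge0] [_ _ H0' Hge0'].
case: ifPn => a0; first exact: supconv_le_cst.
rewrite -ltNge in a0; have na0 : 0 <= - a by lra.
have := supconv_ge_id H0' Hge0' x na0 (bounded_byN vM).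
have := vc x; lra.
Qed.

Lemma hopf_lax_semigroup M a b v : 0 <= a * b -> bounded_by M v ->
  hopf_lax H a (hopf_lax H b v) = hopf_lax H (a + b) v.
Proof.
move=> ab vM; have [a0|a0] := eqVneq a 0.
  by rewrite a0 add0r (hopf_lax0 (hopf_lax_bounded b vM)).
have [b0|b0] := eqVneq b 0.
  by rewrite b0 addr0 (hopf_lax0 vM).
case: hH hH' => [_ _ H0 Hge0] [_ _ H0' Hge0']; apply/funext => x.
have [a_lt|a_gt] := ltP a 0.
  have b_lt : b < 0 by rewrite lt_neqAle b0/= leNgt; apply/negP => b1; nra.
  rewrite /hopf_lax !ifF; [|apply/negbTE; rewrite -ltNge; lra..].
  have na : 0 <= - a by lra.
  have nb : 0 <= - b by lra.
  congr (- _); under [in LHS]eq_fun do rewrite opprK.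
  rewrite -[LHS]/(supconv (mirror H) (- a) (supconv (mirror H) (- b) (fun y => - v y)) x).
  by rewrite (supconv_semigroup H0' Hge0' x na nb (bounded_byN vM)) opprD.
have b1 : 0 <= b.
  have a1 : 0 < a by rewrite lt_neqAle eq_sym a0.
  by rewrite leNgt; apply/negP => b1; nra.
by rewrite !hopf_lax_pos// ?addr_ge0// (supconv_semigroup H0 Hge0 x a_gt b1 vM).
Qed.

Lemma hopf_lax_shift a v k : (forall x, v (x + k) = v x) ->
  forall x, hopf_lax H a v (x + k) = hopf_lax H a v x.
Proof.
move=> vk x; rewrite /hopf_lax; case: ifP => _; first exact: supconv_shift.
by rewrite (@supconv_shift _ _ _ _ (fun y => - v y))// => y; rewrite vk.
Qed.

Lemma hopf_lax_almost_lipschitz M K a v : bounded_by M v ->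
  almost_lipschitz K v -> almost_lipschitz K (hopf_lax H a v).
Proof.
move=> vM vK; rewrite /hopf_lax; case: hH hH' => [_ _ H0 Hge0] [_ _ H0' Hge0'].
case: ifPn => a0; first exact: (supconv_almost_lipschitz H0 Hge0 a0 vM).
rewrite -ltNge in a0; have na0 : 0 <= - a by lra.
apply: almost_lipschitzN.
apply: (supconv_almost_lipschitz H0' Hge0' na0 (bounded_byN vM)).
exact: almost_lipschitzN.
Qed.

Lemma hopf_lax_short_time M K a v eps C x : bounded_by M v -> almost_lipschitz K v ->
  0 < eps -> 0 <= K eps -> (forall e, in_cube (K eps) e -> H e <= C) ->
  `|hopf_lax H a v x - v x| <= eps + `|a| * C.
Proof.
move=> vM vK e0 K0 HC; rewrite /hopf_lax; case: hH hH' => [_ _ H0 Hge0] [_ _ H0' Hge0'].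
have C0 : 0 <= C by rewrite -H0; apply: HC => i; rewrite mxE normr0.
case: ifPn => a0.
  have h1 := supconv_ge_id H0 Hge0 x a0 vM.
  have h2 := supconv_short_time Hge0 x a0 vK e0 K0 HC.
  have := mulr_ge0 a0 C0.
  by rewrite ler_norml ger0_norm// => h3; lra.
rewrite -ltNge in a0; have na0 : 0 <= - a by lra.
have h1 := supconv_ge_id H0' Hge0' x na0 (bounded_byN vM).
have HC' e : in_cube (K eps) e -> mirror H e <= C.
  by move=> eK; apply: HC => i; rewrite mxE normrN.
have h2 := supconv_short_time Hge0' x na0 (almost_lipschitzN vK) e0 K0 HC'.
have := mulr_ge0 na0 C0.
by rewrite ler_norml ltr0_norm// => h3; lra.
Qed.

End fixed.
End hopf_lax.

(** * Loss of oscillation along a rise *)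

Section oscillation.
Variables (R : realType) (d : nat).
Notation V := 'rV[R]_d.
Implicit Types (H v w W : V -> R) (x y k : V).

Lemma periodic_close v x z : Zd_periodic v ->
  exists2 z', v z' = v z & in_cube 1 (z' - x).
Proof.
move=> vper; pose k : 'rV[int]_d := \row_i Num.floor (x 0 i - z 0 i).
exists (z + map_mx intr k); first exact: vper.
move=> i; rewrite !mxE /= ler_norml.
have := floor_le_tmp (x 0 i - z 0 i); have := floorD1_gt (x 0 i - z 0 i).
by rewrite intrD; lra.
Qed.

Variable H : V -> R.
Hypothesis hH : hamiltonian H.

(** [W] lies above the sup-convolution, at a scale at least [s], of some [v1]
    whose upper bounds it inherits.  Along a path this holds with [s] the total
    increment: [v1] is the solution at the time of the minimum of the path, and
    the remaining path, which stays above its starting value, may be replaced by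
    a single upward move. *)
Definition dilated_from (M s : R) W := exists v1 b,
  [/\ bounded_by M v1 /\ Zd_periodic v1, 0 <= b, s <= b,
      forall x, supconv H b v1 x <= W x &
      forall c, (forall y, v1 y <= c) -> forall x, W x <= c].

Lemma dilated_from_refl M v : bounded_by M v -> Zd_periodic v -> dilated_from M 0 v.
Proof.
case: hH => _ _ H0 Hge0 vM vper; exists v, 0; split=> // x.
by rewrite (supconv0 H0 Hge0 x vM).
Qed.

Lemma hopf_lax_periodic a v : Zd_periodic v -> Zd_periodic (hopf_lax H a v).
Proof. by move=> vper x k; apply: hopf_lax_shift => y; exact: vper. Qed.

(** If the path stays above its minimum after the move [a], the rise [b] since
    the minimum becomes [b + a]: by the semigroup law when [a] is positive, by
    the closing inequality when it is negative. Otherwise the path is at a new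
    minimum, which restarts the count with the present solution in the role of
    [v1]. *)
Lemma dilated_from_step M s a W : bounded_by M W -> Zd_periodic W ->
  dilated_from M s W -> dilated_from M (s + a) (hopf_lax H a W).
Proof.
case: (hH) => _ _ H0 Hge0 WM Wper [v1 [b [[v1M v1per] b0 sb v1W Wv1]]].
have W'M := hopf_lax_bounded hH a WM.
have [ba|ba] := ltP (b + a) 0.
  exists (hopf_lax H a W), 0; split=> //; [|lra|].
    by split=> //; exact: hopf_lax_periodic.
  by move=> x; rewrite (supconv0 H0 Hge0 x W'M).
exists v1, (b + a); split=> //; first (by rewrite lerD2r); last first.
  by move=> c /Wv1 Wc x; apply: (hopf_lax_le_cst hH a x WM).
have sM := supconv_bounded H0 Hge0 b0 v1M.
move=> x; have v1W' y : supconv H b v1 y <= W y + 0 by rewrite addr0.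
apply: le_trans (_ : hopf_lax H a (supconv H b v1) x <= _); last first.
  by have := hopf_lax_mono hH a x sM WM v1W'; rewrite addr0.
have [a0|a0] := leP 0 a.
  by rewrite hopf_lax_pos// (supconv_semigroup H0 Hge0 x a0 b0 v1M) addrC.
have na : 0 <= - a by lra.
have -> : supconv H b v1 = supconv H (- a) (supconv H (b + a) v1).
  apply/funext => y; rewrite (supconv_semigroup H0 Hge0 y na ba v1M).
  by congr (supconv _ _ _ _); ring.
rewrite /hopf_lax ifF; last by apply/negbTE; rewrite -ltNge.
by apply: (supconv_closing H0 Hge0 x na (supconv_bounded H0 Hge0 ba v1M)).
Qed.

(** A periodic function nearly attains its supremum within distance [1] of
    every point, and over a long rise such a displacement needs a velocity so
    small that its cost is at most [eps] per unit length. *)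
Lemma supconv_spread M b v (eps m : R) x z : bounded_by M v -> Zd_periodic v ->
  0 < eps -> (forall p, ~ in_cube eps p -> forall i, m * `|p 0 i| <= H p) ->
  0 < b -> d%:R <= m * b -> v z - eps * d%:R <= supconv H b v x.
Proof.
case: hH => _ _ H0 Hge0 vM vper e0 hm b0 db.
have [z' <- z'x] := periodic_close x z vper.
have n1 := norm1_le z'x; rewrite mul1r in n1.
pose q := b^-1 *: (z' - x).
have bq : b * norm1 q = norm1 (z' - x).
  by rewrite norm1Z ger0_norm ?invr_ge0 ?ltW// mulrA mulfV ?mul1r// gt_eqF.
have qm : norm1 q <= m by rewrite -(ler_pM2l b0) bq (le_trans n1)// mulrC.
have := supconv_ge H0 Hge0 x (ltW b0) vM (epi_small_velocity H0 Hge0 e0 hm qm).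
rewrite /= scalerA mulfV ?gt_eqF// scale1r [x + _]addrC subrK mulrCA bq.
have := ler_wpM2l (ltW e0) n1; lra.
Qed.

Lemma dilated_oscillation M s W (eps m : R) :
  dilated_from M s W -> 0 < eps ->
  (forall p, ~ in_cube eps p -> forall i, m * `|p 0 i| <= H p) ->
  0 < s -> 0 <= m -> d%:R <= m * s -> forall x y, W y <= W x + eps * d%:R.
Proof.
move=> [v1 [b [[v1M v1per] b0 sb v1W Wv1]]] e0 hm s0 m0 ds x.
apply: Wv1 => z.
have bs : 0 < b by lra.
have db : d%:R <= m * b by apply: (le_trans ds); rewrite ler_wpM2l.
by have := supconv_spread x z v1M v1per e0 hm bs db; have := v1W x; lra.
Qed.

End oscillation.

(** * Viscosity inequalities from the Hopf-Lax formula *)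

Section first_order.
Variables (R : realType) (d : nat).
Notation V := 'rV[R]_d.
Implicit Types (x y : V) (t s : R) (phi U : V * R -> R) (z : R -> R).

Lemma pair_shift x y t s : (x + y, t + s) = (x, t) + (y, s) :> V * R.
Proof. by []. Qed.

Lemma pair_norm_le y s r : norm1 y <= r -> `|s| <= r -> `|(y, s) : V * R| <= r.
Proof.
move=> yr sr; rewrite -[leLHS]/(Num.max `|y| `|s|) ge_max sr andbT.
exact: le_trans (norm_le_norm1 _) yr.
Qed.

(** Neighborhoods are described by [norm1] because the Legendre transform
    controls displacements in that norm. *)
Lemma near_pair x t (P : V * R -> Prop) : (\forall q \near ((x, t) : V * R), P q) ->
  exists2 r, 0 < r & forall y s, norm1 y <= r -> `|s| <= r -> P (x + y, t + s).
Proof.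
move=> /nbhs_normP[r /= r0 hr]; exists (r / 2); first by rewrite divr_gt0.
move=> y s yr sr; apply: hr => /=; rewrite pair_shift opprD addrA subrr sub0r normrN.
apply: (@le_lt_trans _ _ (r / 2)); last lra.
exact: pair_norm_le.
Qed.

Lemma diff_gradE phi x t y s : differentiable phi (x, t) ->
  'd phi (x, t) (y, s) = dot (space_grad phi (x, t)) y + s * time_deriv phi (x, t).
Proof.
move=> dphi.
have -> : (y, s) = \sum_i y 0 i *: (delta_mx 0 i : V, 0 : R) + s *: (0 : V, 1 : R).
  have s1 (F : 'I_d -> V * R) : (\sum_i F i).1 = \sum_i (F i).1.
    exact: (big_morph fst).
  have s2 (F : 'I_d -> V * R) : (\sum_i F i).2 = \sum_i (F i).2.
    exact: (big_morph snd).
  rewrite [RHS]surjective_pairing /= s1 s2 /=; congr pair.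
    by rewrite scaler0 addr0 {1}[y]row_sum_delta.
  by rewrite big1 ?add0r ?[_ *: _]mulr1// => i _; rewrite scaler0.
rewrite linearD linear_sum linearZ /= /time_deriv deriveE//; congr (_ + _).
by apply: eq_bigr => i _; rewrite linearZ mxE deriveE// mulrC.
Qed.

Lemma diff_expansion phi x t (eps : R) : differentiable phi (x, t) -> 0 < eps ->
  exists2 r, 0 < r & forall y s, norm1 y <= r -> `|s| <= r ->
    `|phi (x + y, t + s) - phi (x, t)
      - (dot (space_grad phi (x, t)) y + s * time_deriv phi (x, t))|
    <= eps * (norm1 y + `|s|).
Proof.
move=> dphi e0.
have /eqaddoP /(_ eps e0) := diff_locally dphi.
move=> /nbhs_normP[r /= r0 hr]; exists (r / 2); first by rewrite divr_gt0.
move=> y s yr sr; have := hr (y, s); rewrite /= sub0r normrN.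
have nr : `|(y, s) : V * R| < r.
  by apply: (@le_lt_trans _ _ (r / 2)); [exact: pair_norm_le|lra].
move=> /(_ nr); rewrite !fctE /= diff_gradE// => h.
apply: le_trans (_ : eps * `|(y, s) : V * R| <= _); last first.
  by rewrite ler_pM2l//; apply: pair_norm_le; rewrite ?lerDl ?lerDr ?norm1_ge0.
by move: h; rewrite [(y, s) + (x, t)]addrC -pair_shift opprD addrA.
Qed.

Lemma derive_expansion z t D (eps : R) : is_derive t (1 : R) z D -> 0 < eps ->
  exists2 r, 0 < r & forall h, `|h| <= r -> `|z (t + h) - z t - h * D| <= eps * `|h|.
Proof.
move=> [dz zD] e0; have /eqaddoP /(_ eps e0) := derivable_nbhs dz.
move=> /nbhs_normP[r /= r0 hr]; exists (r / 2); first by rewrite divr_gt0.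
move=> h hr'; have := hr h; rewrite /= sub0r normrN.
have nr : `|h| < r by lra.
move=> /(_ nr); rewrite !fctE /= zD [h *: 1]mulr1 [h + t]addrC.
by rewrite -addrA -opprD.
Qed.

Lemma space_gradN phi p : differentiable phi p ->
  space_grad (fun q => - phi q) p = - space_grad phi p.
Proof.
by move=> dphi; apply/rowP => i; rewrite !mxE deriveN//; exact: diff_derivable.
Qed.

Lemma time_derivN phi p : differentiable phi p ->
  time_deriv (fun q => - phi q) p = - time_deriv phi p.
Proof. by move=> dphi; rewrite /time_deriv deriveN//; exact: diff_derivable. Qed.

End first_order.

Section backward.
Variables (R : realType) (d : nat).
Notation V := 'rV[R]_d.
Implicit Types (x y : V) (t s : R) (phi U : V * R -> R) (z : R -> R).

Lemma le_of_small_errors (a b c : R) : 0 < c ->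
  (forall eps, 0 < eps -> eps < 1 -> a <= b + eps * c) -> a <= b.
Proof.
move=> c0 h; apply/ler_addgt0Pr => e e0; pose eps := Num.min (1 / 2) (e / c).
have eps0 : 0 < eps by rewrite lt_min [X in _ && X]divr_gt0// andbT; lra.
have eps1 : eps <= 1 / 2 by rewrite ge_min lexx.
apply: le_trans (h eps eps0 _) _; first lra.
by rewrite lerD2l -ler_pdivlMr// ge_min lexx orbT.
Qed.

Section increasing.
Variables (H : V -> R) (z : R -> R) (U phi : V * R -> R) (x : V) (t D h0 M : R).
Hypotheses (hH : hamiltonian H) (h0_gt0 : 0 < h0)
  (zt : forall s, t - h0 <= s <= t -> z s <= z t)
  (Ut : forall s, t - h0 <= s <= t ->
     U (x, t) = supconv H (z t - z s) (fun y => U (y, s)) x)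
  (UM : forall s, t - h0 <= s <= t -> bounded_by M (fun y => U (y, s)))
  (dz : is_derive t (1 : R) z D) (dphi : differentiable phi (x, t)).

Let D_ge0 : 0 <= D.
Proof.
rewrite leNgt; apply/negP => D0; have h00 := h0_gt0.
have [|r r0 hr] := derive_expansion dz (eps := - D / 2); first lra.
pose h := Num.min h0 r.
have h_gt0 : 0 < h by rewrite lt_min h0_gt0.
have hh0 : h <= h0 by rewrite ge_min lexx.
have hhr : h <= r by rewrite ge_min lexx orbT.
have : z (t - h) <= z t by apply: zt; lra.
have := hr (- h); rewrite normrN gtr0_norm// => /(_ hhr).
rewrite ler_norml => /andP[h1 _] h2.
have : D * h < 0 by rewrite pmulr_llt0.
by lra.
Qed.

Lemma backward_expansion eps (Q : V * R -> Prop) : 0 < eps ->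
  (\forall q \near ((x, t) : V * R), Q q) ->
  exists2 r, 0 < r & forall h, 0 < h -> h <= r ->
    `|z t - z (t - h) - h * D| <= eps * h /\
    forall y, norm1 y <= r -> Q (x + y, t - h) /\
      `|phi (x + y, t - h) - phi (x, t)
        - (dot (space_grad phi (x, t)) y - h * time_deriv phi (x, t))|
      <= eps * (norm1 y + h).
Proof.
move=> e0 hQ; have [r1 r10 hphi] := diff_expansion dphi e0.
have [r2 r20 {}hQ] := near_pair hQ; have [r3 r30 hz] := derive_expansion dz e0.
exists (Num.min r1 (Num.min r2 r3)) => [|h h_gt0]; first by rewrite !lt_min r10 r20.
have nh : `|- h| = h by rewrite normrN gtr0_norm.
rewrite !le_min => /and3P[h1 h2 h3]; split.
  have -> : z t - z (t - h) - h * D = - (z (t + - h) - z t - - h * D) by ring.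
  by rewrite normrN -[X in eps * X]nh; apply: hz; rewrite nh.
move=> y; rewrite !le_min => /and3P[y1 y2 y3]; split; first by apply: hQ; rewrite ?nh.
by have := hphi y (- h); rewrite nh mulNr => /(_ y1 h1).
Qed.

(** A nearly optimal displacement in the Hopf-Lax formula over [t - h, t] is
    inserted in the maximality of [U - phi]; the Legendre inequality turns its
    gain into [H (space_grad phi)] times the increment of the path. *)
Lemma backward_subsolution : local_max (U \- phi) (x, t) ->
  time_deriv phi (x, t) <= H (space_grad phi (x, t)) * D.
Proof.
case: (hH) => Hc _ H0 Hge0 lmax; have D0 := D_ge0; have h00 := h0_gt0.
set p := space_grad phi (x, t); set dt := time_deriv phi (x, t).
have Hp0 := Hge0 p.
suff main eps : 0 < eps -> eps < 1 -> dt <= (D + eps) * (H p + eps) + 2 * eps.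
  apply: (@le_of_small_errors _ _ (H p + D + 3)) => [|eps e0 e1]; first lra.
  apply: (le_trans (main eps e0 e1)).
  have : eps * eps <= eps by rewrite ler_piMr// ltW.
  lra.
move=> e0 e1.
have [r1 r10 Hp] := H_near Hc p e0.
pose eta := Num.min eps r1.
have eta0 : 0 < eta by rewrite lt_min e0.
have etae : eta <= eps by rewrite ge_min lexx.
have Heta e : in_cube eta e -> H (p + e) <= H p + eps.
  by move=> ee; apply: Hp => i; rewrite (le_trans (ee i))// ge_min lexx orbT.
have [r r0 exp] := backward_expansion eta0 lmax.
have tt : t - h0 <= t <= t by rewrite lexx andbT; lra.
have M0 : 0 <= M by exact: bounded_by_ge0 (UM tt).
(* with this slope a displacement beyond distance [r] costs more than the
   oscillation of [U], so nearly optimal displacements stay where [phi] is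
   controlled *)
pose K := (2 * M + 2) / r.
have K0 : 0 < K by rewrite divr_gt0//; lra.
have [C C0 HC] := H_bounded_cube Hge0 Hc (ltW K0).
pose c := (D + 1) * C + 1.
have c0 : 0 < c by rewrite ltr_wpDl// mulr_ge0//; lra.
pose h := Num.min (Num.min h0 r) (Num.min 1 c^-1).
have h_gt0 : 0 < h by rewrite !lt_min h0_gt0 r0 ltr01 invr_gt0 c0.
have [hh0 hr h1 hc] : [/\ h <= h0, h <= r, h <= 1 & h <= c^-1].
  by split; rewrite /h !ge_min lexx ?orbT.
have [hz {}exp] := exp h h_gt0 hr.
have eh : eta * h <= eps * h by rewrite ler_wpM2r// ltW.
have ths : t - h0 <= t - h <= t by apply/andP; split; lra.
pose del := z t - z (t - h).
have del0 : 0 <= del by rewrite subr_ge0; exact: zt.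
have delD : del <= (D + eps) * h.
  by move: hz; rewrite ler_norml => /andP[_ ?]; rewrite /del; lra.
have delC : del * C <= 1.
  apply: le_trans (_ : (D + 1) * h * C <= _).
    by rewrite ler_wpM2r//; apply: (le_trans delD); rewrite ler_pM2r//; lra.
  apply: le_trans (_ : h * c <= _); first by rewrite /c; lra.
  by rewrite -ler_pdivlMr// div1r.
have eh0 : 0 < eps * h by rewrite mulr_gt0.
have [[q l] E] := supconv_approx H0 Hge0 x del0 (UM ths) eh0.
rewrite -Ut//= => hU.
have hl : K * norm1 q - l <= C.
  have HC' e : in_cube K e -> H (0 + e) <= C by rewrite add0r; exact: HC.
  by have := epi_growth (ltW K0) HC' E; rewrite /= dot0l add0r.
have hn0 := norm1_ge0 q.
have ndq : norm1 (del *: q) = del * norm1 q by rewrite norm1Z ger0_norm.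
have nr : del * norm1 q <= r.
  have Ut1 := UM ths (x + del *: q).
  have Ut2 : `|U (x, t)| <= M by exact: (UM tt).
  have {}hl := ler_wpM2l del0 hl.
  have eh1 : eps * h <= 1 by rewrite mulr_ile1// ltW.
  move: Ut1 Ut2; rewrite !ler_norml => /andP[? ?] /andP[? ?].
  have : K * (del * norm1 q) <= 2 * M + 2 by lra.
  by rewrite /K mulrAC ler_pdivrMr// ler_pM2l//; lra.
have {exp} := exp (del *: q); rewrite ndq dotZr -/p -/dt ler_norml.
move=> /(_ nr)[/= hmax /andP[_ hphi]].
have := ler_wpM2l del0 (epi_growth (ltW eta0) Heta E).
rewrite /= => hg.
have : del * (H p + eps) <= (D + eps) * h * (H p + eps) by rewrite ler_wpM2r//; lra.
move=> g1; rewrite -(ler_pM2r h_gt0).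
lra.
Qed.

(** Here one displacement suffices: the velocity dual to the gradient of [phi],
    which attains the Legendre inequality. *)
Lemma backward_supersolution : local_min (U \- phi) (x, t) ->
  H (space_grad phi (x, t)) * D <= time_deriv phi (x, t).
Proof.
case: (hH) => Hc cH H0 Hge0 lmin; have D0 := D_ge0; have h00 := h0_gt0.
set p := space_grad phi (x, t); set dt := time_deriv phi (x, t).
have [[q l] E Hp] := epi_subgradient p cH; rewrite /= in Hp.
have hn0 := norm1_ge0 q.
have Hp0 := Hge0 p.
suff main eps : 0 < eps -> eps < 1 ->
    (D - eps) * H p - eps * ((D + 1) * norm1 q + 1) <= dt.
  apply: (@le_of_small_errors _ _ (H p + (D + 1) * norm1 q + 1)) => [|eps e0 e1].
    by rewrite ltr_wpDl// addr_ge0// mulr_ge0//; lra.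
  by have := main eps e0 e1; lra.
move=> e0 e1.
have [r r0 exp] := backward_expansion e0 lmin.
pose c := (D + 1) * norm1 q + 1.
have c0 : 0 < c by rewrite ltr_wpDl// mulr_ge0//; lra.
pose h := Num.min (Num.min h0 r) (r / c).
have h_gt0 : 0 < h by rewrite !lt_min h0_gt0 r0 divr_gt0.
have [hh0 hr hc] : [/\ h <= h0, h <= r & h <= r / c].
  by split; rewrite /h !ge_min lexx ?orbT.
have [hz {}exp] := exp h h_gt0 hr.
have ths : t - h0 <= t - h <= t by apply/andP; split; lra.
pose del := z t - z (t - h).
have del0 : 0 <= del by rewrite subr_ge0; exact: zt.
have [delD Ddel] : del <= (D + eps) * h /\ (D - eps) * h <= del.
  by move: hz; rewrite ler_norml => /andP[? ?]; rewrite /del; split; lra.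
have delD1 : del <= (D + 1) * h.
  by apply: (le_trans delD); rewrite ler_pM2r//; lra.
have delq : del * norm1 q <= (D + 1) * norm1 q * h.
  by rewrite mulrAC ler_wpM2r.
have nr : del * norm1 q <= r.
  apply: (le_trans delq); apply: le_trans (_ : h * c <= _); first by rewrite /c; lra.
  by rewrite -ler_pdivlMr.
have ndq : norm1 (del *: q) = del * norm1 q by rewrite norm1Z ger0_norm.
have {exp} := exp (del *: q); rewrite ndq dotZr -/p -/dt ler_norml.
move=> /(_ nr)[/= hmin /andP[hphi _]].
have := supconv_ge H0 Hge0 x del0 (UM ths) E; rewrite -Ut//= => hU.
have delH : (D - eps) * h * H p <= del * H p by rewrite ler_wpM2r.
have edelq : eps * (del * norm1 q) <= eps * ((D + 1) * norm1 q * h).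
  by rewrite ler_wpM2l// ltW.
have delHp : del * H p = del * dot p q - del * l by rewrite Hp; ring.
rewrite -(ler_pM2r h_gt0).
lra.
Qed.

End increasing.

(** The viscosity inequalities at time [t] follow from the Hopf-Lax formula on a
    short interval before [t] alone, whatever happens after [t]; this is what
    allows changes of monotonicity of the path at [t]. *)
Lemma backward_viscosity H z U phi x t D h0 M :
  hamiltonian H -> 0 < h0 ->
  (forall s, t - h0 <= s <= t -> z s <= z t) \/
  (forall s, t - h0 <= s <= t -> z t <= z s) ->
  (forall s, t - h0 <= s <= t ->
     U (x, t) = hopf_lax H (z t - z s) (fun y => U (y, s)) x) ->
  (forall s, t - h0 <= s <= t -> bounded_by M (fun y => U (y, s))) ->
  is_derive t (1 : R) z D -> differentiable phi (x, t) ->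
  (local_max (U \- phi) (x, t) ->
     time_deriv phi (x, t) <= H (space_grad phi (x, t)) * D) /\
  (local_min (U \- phi) (x, t) ->
     H (space_grad phi (x, t)) * D <= time_deriv phi (x, t)).
Proof.
move=> hH h00 [zt|zt] Ut UM dz dphi.
  have Ut' s : t - h0 <= s <= t ->
      U (x, t) = supconv H (z t - z s) (fun y => U (y, s)) x.
    by move=> st; rewrite (Ut s st) hopf_lax_pos// subr_ge0 zt.
  split; first exact: (backward_subsolution hH h00 zt Ut' UM dz dphi).
  exact: (backward_supersolution hH h00 zt Ut' UM dz dphi).
have hH' := mirror_hamiltonian hH.
pose U' (p : V * R) := - U p; pose z' s := - z s.
have zt' s : t - h0 <= s <= t -> z' s <= z' t by move=> /zt; rewrite /z'; lra.
have Ut' s : t - h0 <= s <= t ->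
    U' (x, t) = supconv (mirror H) (z' t - z' s) (fun y => U' (y, s)) x.
  move=> st; have st' := zt' s st.
  rewrite -hopf_lax_pos ?subr_ge0// (_ : z' t - z' s = - (z t - z s)); last first.
    by rewrite /z'; ring.
  by rewrite (hopf_laxN _ x hH (UM s st)) /U' -(Ut s st).
have UM' s : t - h0 <= s <= t -> bounded_by M (fun y => U' (y, s)).
  by move=> /UM; exact: bounded_byN.
have dz' : is_derive t (1 : R) z' (- D) by exact: is_deriveN.
pose phi' (p : V * R) := - phi p.
have dphi' : differentiable phi' (x, t) by exact: differentiableN.
have E1 := backward_subsolution hH' h00 zt' Ut' UM' dz' dphi'.
have E2 := backward_supersolution hH' h00 zt' Ut' UM' dz' dphi'.
rewrite /phi' space_gradN// time_derivN// /mirror opprK in E1 E2.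
split=> [lm|lm]; [have := E2 _ | have := E1 _].
  rewrite mulrN lerN2; apply; apply: filterS lm => q /=.
  by rewrite /U' /phi'; lra.
rewrite mulrN lerN2; apply; apply: filterS lm => q /=.
by rewrite /U' /phi'; lra.
Qed.

End backward.

(** * Bounded uniformly continuous functions and uniform convergence *)

Section epsilon_delta.
Variable R : realType.

Lemma BUC_of (X : pseudoMetricType R) (A : set X) (f : X -> R) (M : R) :
  (forall x, A x -> `|f x| <= M) ->
  (forall eps : R, 0 < eps -> exists2 r : R, 0 < r &
    forall x y, A x -> A y -> ball x r y -> `|f x - f y| < eps) -> BUC A f.
Proof.
move=> fM uf; split.
  by exists M; split; [exact: num_real|move=> N MN x Ax; apply: le_trans (fM x Ax) (ltW MN)].
apply/unif_continuousP => e e0; have [r r0 hr] := uf e e0; exists r => //.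
move=> [x y] /=; rewrite {1}/ball /= /subspace_ball; case: ifPn.
  by rewrite inE => Ax [Ay xy]; exact: hr.
by move=> _ /= ->; exact: ballxx.
Qed.

Lemma BUC_bounded (X : pseudoMetricType R) (A : set X) (f : X -> R) : BUC A f ->
  exists M : R, forall x, A x -> `|f x| <= M.
Proof.
move=> [[M [_ hM]] _]; exists (M + 1) => x Ax; apply: (hM (M + 1)) => //.
by rewrite ltrDl.
Qed.

Lemma BUC_unif (X : pseudoMetricType R) (A : set X) (f : X -> R) : BUC A f ->
  forall eps : R, 0 < eps -> exists2 r : R, 0 < r &
    forall x y, A x -> A y -> ball x r y -> `|f x - f y| < eps.
Proof.
move=> [_ /unif_continuousP uf] e e0; have [r r0 hr] := uf e e0; exists r => //.
move=> x y Ax Ay xy; apply: (hr (x, y)).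
by rewrite /ball /= /subspace_ball ifT ?inE//.
Qed.

Lemma uniform_cvgP (I : Type) (F : set_system I) (FF : Filter F) (X : choiceType) (A : set X)
    (u_ : I -> X -> R) (u : X -> R) :
  {uniform A, u_ @ F --> u} <->
  forall eps : R, 0 < eps -> \forall n \near F, forall x, A x -> `|u x - u_ n x| < eps.
Proof.
split=> [cu e e0|cu P].
  have : nbhs (u : {uniform` A -> R}) [set h | forall x, A x -> `|u x - h x| < e].
    by apply/uniform_nbhs; exists [set xy | ball xy.1 e xy.2]; split; [exact: (entourage_ball R (PosNum e0))|].
  by move=> /cu.
move=> /uniform_nbhs[E [entE sP]].
move: entE; rewrite -entourage_ballE => -[e /= e0 eE].
apply: filterS (cu _ e0) => n hn; apply: sP => x Ax; apply: eE; exact: hn.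
Qed.

Lemma within_continuousP (z : R -> R) : {within `[0, +oo[, continuous z} ->
  forall x, 0 <= x -> forall e, 0 < e -> exists2 r, 0 < r &
    forall y, 0 <= y -> `|x - y| < r -> `|z x - z y| < e.
Proof.
move=> /subspace_continuousP zc x x0 e e0.
have /zc /cvgrPdist_lt /(_ e e0) : `[0, +oo[%classic x by rewrite /= in_itv/= x0.
move=> /nbhs_normP[r /= r0 hr]; exists r => // y y0 xy.
by apply: hr => //=; rewrite in_itv/= y0.
Qed.

Lemma heine (z : R -> R) (T : R) : {within `[0, +oo[, continuous z} ->
  forall e, 0 < e -> exists2 r, 0 < r & forall x y, 0 <= x <= T -> 0 <= y <= T ->
    `|x - y| < r -> `|z x - z y| < e.
Proof.
move=> zc e e0.
have /compact_near_coveringP/near_covering_withinP cT : compact `[0, T]%classic.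
  exact: segment_compact.
pose P (r x : R) := forall y, 0 <= y <= T -> `|x - y| < r -> `|z x - z y| < e.
have : \forall r \near 0^'+, `[0, T]%classic `<=` P r.
  apply: cT => x /=; rewrite in_itv/= => /andP[x0 xT].
  have e20 : 0 < e / 2 by rewrite divr_gt0.
  have [r r0 hr] := within_continuousP zc x0 e20.
  exists ([set x' | `|x - x'| < r / 2], [set r' | r' < r / 2]) => /=.
    split; first by apply/nbhs_normP; exists (r / 2) => //=; rewrite divr_gt0.
    by apply: nbhs_right_lt; rewrite divr_gt0.
  move=> [x' r'] /= [xx' rr'] /[!in_itv]/= /andP[x'0 x'T] y /andP[y0 yT] x'y.
  have h1 : `|z x - z x'| < e / 2 by apply: hr => //; lra.
  have h2 : `|z x - z y| < e / 2.
    apply: hr => //; rewrite (_ : x - y = (x - x') + (x' - y)); last by ring.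
    by rewrite (le_lt_trans (ler_normD _ _))//; lra.
  rewrite (_ : z x' - z y = - (z x - z x') + (z x - z y)); last by ring.
  by rewrite (le_lt_trans (ler_normD _ _))// normrN; lra.
move=> h; have [r [r0 hr]] : exists r, 0 < r /\ `[0, T]%classic `<=` P r.
  near (0 : R)^'+ => r; exists r; split; first by near: r; exact: nbhs_right_gt.
  by near: r.
by exists r => // x y xT yT xy; apply: hr.
Unshelve. all: by end_near. Qed.

End epsilon_delta.

Section moduli.
Variables (R : realType) (d : nat).
Notation V := 'rV[R]_d.

Lemma ball_pairE (x y : V) (t s r : R) :
  ball ((x, t) : V * R) r (y, s) <-> `|x - y| < r /\ `|t - s| < r.
Proof. by rewrite -!ball_normE /= /ball_ /= /Num.norm /= gt_max; split => [/andP|/andP]. Qed.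

(** Below the distance given by uniform continuity the error is [eps]; beyond
    it, boundedness is absorbed by a large slope. *)
Lemma BUC_almost_lipschitz (v : V -> R) : BUC [set: V] v ->
  exists M K, [/\ bounded_by M v, forall eps, 0 <= K eps & almost_lipschitz K v].
Proof.
move=> bv; have [M hM] := BUC_bounded bv.
have vM : bounded_by M v by move=> x; exact: hM.
have M0 := bounded_by_ge0 vM.
suff /choice[K hK] : forall eps : R, exists K, 0 <= K /\ (0 < eps -> forall x y : V,
    v y <= v x + eps + K * norm1 (y - x)).
  exists M, K; split=> // [eps|eps e0]; first by case: (hK eps).
  by have [_] := hK eps; apply.
move=> eps; have [e0|e0] := ltP 0 eps; last first.
  by exists 0; split => // e0'; have := lt_le_trans e0' e0; rewrite ltxx.
have [r r0 hr] := BUC_unif bv e0.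
exists (2 * M / r); split; first by rewrite divr_ge0 ?mulr_ge0// ltW.
move=> _ x y; have n0 := norm1_ge0 (y - x).
have [xy|xy] := ltP (norm1 (y - x)) r.
  have : `|v x - v y| < eps.
    apply: hr => //; rewrite -ball_normE /= -opprB normrN.
    exact: le_lt_trans (norm_le_norm1 _) xy.
  have : 0 <= 2 * M / r * norm1 (y - x).
    by rewrite mulr_ge0// divr_ge0 ?mulr_ge0// ltW.
  by rewrite ltr_norml => ? /andP[? ?]; lra.
have : 2 * M <= 2 * M / r * norm1 (y - x).
  by rewrite mulrAC ler_pdivlMr// ler_wpM2l// mulr_ge0.
have := vM x; have := vM y; rewrite !ler_norml => /andP[? ?] /andP[? ?]; lra.
Qed.

Lemma BUC_slice (u : V * R -> R) (A : set R) t : A t -> BUC (@slab R d A) u ->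
  BUC [set: V] (fun x => u (x, t)).
Proof.
move=> At bu; have [M hM] := BUC_bounded bu.
apply: (@BUC_of _ _ _ _ M) => [x _|eps e0]; first exact: hM.
have [r r0 hr] := BUC_unif bu e0; exists r => // x y _ _ xy.
apply: hr => //; apply/ball_pairE; rewrite subrr normr0; split => //.
by move: xy; rewrite -ball_normE.
Qed.

End moduli.

(** * Solutions along piecewise monotone paths *)

Section evolution.
Variables (R : realType) (d : nat) (H : 'rV[R]_d -> R) (N : R) (eta : R -> R)
  (u0 : 'rV[R]_d -> R).
Notation V := 'rV[R]_d.

Definition grid (k : nat) : R := k%:R / N.

(** Times are multiplied by [N] so that the grid points become the integers. *)
Definition monotone_between_grid_points := forall k : nat,
  (forall s t, k%:R <= s * N -> s <= t -> t * N <= k.+1%:R -> eta s <= eta t) \/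
  (forall s t, k%:R <= s * N -> s <= t -> t * N <= k.+1%:R -> eta t <= eta s).

Fixpoint stage (k : nat) : V -> R :=
  if k is k'.+1 then hopf_lax H (eta (grid k) - eta (grid k')) (stage k') else u0.

(** The moves of the path are composed along the grid points up to the last one
    before the present time; the last move is partial. *)
Definition evolution (p : V * R) : R :=
  let k := Num.truncn (p.2 * N) in
  hopf_lax H (eta p.2 - eta (grid k)) (stage k) p.1.

Hypotheses (hH : hamiltonian H) (N0 : 0 < N) (mono : monotone_between_grid_points).
Variables (M : R) (K : R -> R).
Hypotheses (u0M : bounded_by M u0) (u0K : almost_lipschitz K u0).

Lemma gridK k : grid k * N = k%:R.
Proof. by rewrite /grid divfK// gt_eqF. Qed.

Lemma grid0 : grid 0 = 0.
Proof. by rewrite /grid mulr0n mul0r. Qed.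

Lemma eta_monotone k s t s' t' : k%:R <= s * N -> s <= t -> t * N <= k.+1%:R ->
  k%:R <= s' * N -> s' <= t' -> t' * N <= k.+1%:R ->
  0 <= (eta t - eta s) * (eta t' - eta s').
Proof.
move=> a b c a' b' c'; case: (mono k) => h.
  by rewrite mulr_ge0// subr_ge0 h.
by rewrite mulr_le0// subr_le0 h.
Qed.

Lemma stage_bounded k : bounded_by M (stage k).
Proof. by elim: k => //= k IH; exact: hopf_lax_bounded. Qed.

Lemma stage_almost_lipschitz k : almost_lipschitz K (stage k).
Proof.
by elim: k => //= k IH; exact: (hopf_lax_almost_lipschitz hH _ (stage_bounded k)).
Qed.

Lemma evolution_bounded t : bounded_by M (fun x => evolution (x, t)).
Proof. by move=> x; apply: (hopf_lax_bounded hH _ (stage_bounded _)). Qed.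

Lemma evolution_almost_lipschitz t : almost_lipschitz K (fun x => evolution (x, t)).
Proof.
move=> eps e0 x y.
exact: (hopf_lax_almost_lipschitz hH _ (stage_bounded _) (stage_almost_lipschitz _)).
Qed.

Lemma evolution_piece k t x : k%:R <= t * N <= k.+1%:R ->
  evolution (x, t) = hopf_lax H (eta t - eta (grid k)) (stage k) x.
Proof.
move=> /andP[kt tk]; rewrite /evolution /=.
have [tk'|tk'] := ltP (t * N) k.+1%:R.
  by rewrite (truncn_def (n := k)) ?kt.
have tE : t * N = k.+1%:R by apply/eqP; rewrite eq_le tk.
rewrite tE natrK (_ : t = grid k.+1); last by rewrite /grid -tE mulfK// gt_eqF.
by rewrite subrr (hopf_lax0 hH (stage_bounded _)).
Qed.

(** Between two consecutive grid points all moves go in the same direction, so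
    the semigroup law applies from any intermediate time. *)
Lemma evolution_step k s t : k%:R <= s * N -> s <= t -> t * N <= k.+1%:R ->
  (fun x => evolution (x, t)) =
  hopf_lax H (eta t - eta s) (fun x => evolution (x, s)).
Proof.
move=> ks st tk; have stN : s * N <= t * N by rewrite ler_pM2r.
have -> : (fun x => evolution (x, s)) =
    hopf_lax H (eta s - eta (grid k)) (stage k).
  by apply/funext => x; apply: evolution_piece; rewrite ks (le_trans stN tk).
have gks : grid k <= s by rewrite ler_pdivrMr.
have gk : k%:R <= grid k * N by rewrite gridK.
rewrite (hopf_lax_semigroup hH _ (stage_bounded k)); last first.
  by apply: (eta_monotone (k := k)) => //; exact: le_trans tk.
apply/funext => x; rewrite (evolution_piece (k := k)) ?tk ?(le_trans ks)//.
by congr (hopf_lax _ _ _ _); ring.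
Qed.

Lemma evolution0 x : evolution (x, 0) = u0 x.
Proof.
rewrite (evolution_piece (k := 0)); last by rewrite mul0r mulr0n lexx ler01.
by rewrite grid0 subrr (hopf_lax0 hH u0M).
Qed.

(** Every positive time lies in a half-open piece that extends to its left;
    this is the interval on which the viscosity inequalities are tested. *)
Lemma left_piece t : 0 < t -> exists2 k : nat, k%:R < t * N & t * N <= k.+1%:R.
Proof.
move=> t0; have tN : 0 < t * N by rewrite mulr_gt0.
have /andP[h1 h2] := truncn_itv (ltW tN); set k := Num.truncn _ in h1 h2.
have [kt|kt] := ltP k%:R (t * N); first by exists k => //; exact: ltW.
have ek : k%:R = t * N by apply/eqP; rewrite eq_le h1.
case: k => [|k] in h1 h2 kt ek *; first by move: tN; rewrite -ek ltxx.
by exists k; rewrite -ek// ltr_nat.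
Qed.

Lemma evolution_viscosity (phi : V * R -> R) (x : V) (t D : R) : 0 < t -> is_derive t (1 : R) eta D ->
  differentiable phi (x, t) ->
  (local_max (evolution \- phi) (x, t) ->
     time_deriv phi (x, t) <= H (space_grad phi (x, t)) * D) /\
  (local_min (evolution \- phi) (x, t) ->
     H (space_grad phi (x, t)) * D <= time_deriv phi (x, t)).
Proof.
move=> t0 dz dphi; have [k kt tk] := left_piece t0.
have h0 : 0 < t - grid k by rewrite subr_gt0 ltr_pdivrMr.
have sP s : t - (t - grid k) <= s <= t -> k%:R <= s * N /\ s <= t.
  by rewrite subKr => /andP[gs st]; rewrite -ler_pdivrMr.
apply: (@backward_viscosity R d H eta evolution phi x t D (t - grid k) M) => //.
- case: (mono k) => h; [left|right] => s /sP[ks st]; exact: h.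
- move=> s /sP[ks st].
  by have /(congr1 (fun f => f x)) := evolution_step ks st tk.
- by move=> s _; exact: evolution_bounded.
Qed.

Lemma evolution_le_cst s t c : 0 <= s -> s <= t ->
  (forall x, evolution (x, s) <= c) -> forall x, evolution (x, t) <= c.
Proof.
move=> s0 st sc.
have t0 := le_trans s0 st.
have sN : 0 <= s * N by rewrite mulr_ge0// ltW.
have tN : 0 <= t * N by rewrite mulr_ge0// ltW.
have /andP[ks sk] := truncn_itv sN; set k := Num.truncn _ in ks sk.
have /andP[lt tl] := truncn_itv tN; set l := Num.truncn _ in lt tl.
have step k' s' t' : k'%:R <= s' * N -> s' <= t' -> t' * N <= k'.+1%:R ->
    (forall x, evolution (x, s') <= c) -> forall x, evolution (x, t') <= c.
  move=> a b e h x; have /(congr1 (fun f => f x)) -> := evolution_step a b e.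
  exact: (hopf_lax_le_cst hH _ _ (evolution_bounded s')).
have [tk|tk] := leP (t * N) k.+1%:R; first exact: (step k s t ks st tk sc).
have kl : (k.+1 <= l)%N by rewrite truncn_ge_nat// ltW.
have gridc j : (k.+1 <= j)%N -> forall x, evolution (x, grid j) <= c.
  elim: j => // j IH; rewrite leq_eqVlt => /orP[/eqP[<-]|kj].
    apply: (step k s) => //; last by rewrite gridK.
    by rewrite ler_pdivlMr// ltW.
  apply: (step j (grid j)); rewrite ?gridK//; last exact: IH.
  by rewrite ler_pM2r ?invr_gt0// ler_nat.
apply: (step l (grid l)); rewrite ?gridK ?ler_pdivrMr//; last exact: gridc.
exact: ltW.
Qed.

Lemma stage_periodic k : Zd_periodic u0 -> Zd_periodic (stage k).
Proof. by move=> u0p; elim: k => //= k IH; exact: hopf_lax_periodic. Qed.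

Lemma evolution_periodic t : Zd_periodic u0 -> Zd_periodic (fun x => evolution (x, t)).
Proof. by move=> u0p x k; apply: hopf_lax_periodic; exact: stage_periodic. Qed.

Lemma evolution_dilated t : Zd_periodic u0 ->
  dilated_from H M (eta t - eta 0) (fun x => evolution (x, t)).
Proof.
move=> u0p.
have stageD k : dilated_from H M (eta (grid k) - eta 0) (stage k).
  elim: k => [|k IH] /=.
    by rewrite grid0 subrr; exact: dilated_from_refl.
  rewrite (_ : _ - eta 0 = eta (grid k) - eta 0 + (eta (grid k.+1) - eta (grid k))); last by ring.
  by apply: dilated_from_step => //; [exact: stage_bounded|exact: stage_periodic].
set k := Num.truncn (t * N).
have -> : (fun x => evolution (x, t)) = hopf_lax H (eta t - eta (grid k)) (stage k) by [].
rewrite (_ : _ - eta 0 = eta (grid k) - eta 0 + (eta t - eta (grid k))); last by ring.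
by apply: dilated_from_step => //; [exact: stage_bounded|exact: stage_periodic].
Qed.

Variable L : R.
Hypothesis lip : forall s t, `|eta s - eta t| <= L * `|s - t|.

(** A time interval shorter than the mesh meets at most two pieces, whence the
    factor [2]. *)
Lemma evolution_time_modulus eps C s t x : 0 < eps -> 0 <= K eps ->
  (forall e, in_cube (K eps) e -> H e <= C) -> 0 <= C ->
  0 <= s -> s <= t -> (t - s) * N <= 1 ->
  `|evolution (x, t) - evolution (x, s)| <= 2 * (eps + L * (t - s) * C).
Proof.
move=> e0 K0 HC C0 s0 st st1.
have step k' s' t' : k'%:R <= s' * N -> s' <= t' -> t' * N <= k'.+1%:R ->
    `|evolution (x, t') - evolution (x, s')| <= eps + L * (t' - s') * C.
  move=> a b e; have /(congr1 (fun f => f x)) -> := evolution_step a b e.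
  have h := hopf_lax_short_time hH (eta t' - eta s') x (evolution_bounded s')
    (evolution_almost_lipschitz s') e0 K0 HC.
  apply: (le_trans h); rewrite lerD2l ler_wpM2r//.
  by have := lip t' s'; rewrite [`|t' - s'|]ger0_norm// subr_ge0.
have sN : 0 <= s * N by rewrite mulr_ge0// ltW.
have /andP[ks sk] := truncn_itv sN; set k := Num.truncn _ in ks sk.
have LC t' s' : s' <= t' -> 0 <= L * (t' - s') * C.
  move=> st'; rewrite mulr_ge0//; have := le_trans (normr_ge0 _) (lip t' s').
  by rewrite [`|t' - s'|]ger0_norm// subr_ge0.
have [tk|tk] := leP (t * N) k.+1%:R.
  have := step k s t ks st tk; have := LC t s st; lra.
have gs : s <= grid k.+1 by rewrite ler_pdivlMr// ltW.
have gt : grid k.+1 <= t by rewrite ler_pdivrMr// ltW.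
have h1 := step k s (grid k.+1) ks gs.
have {}h1 := h1 ltac:(by rewrite gridK).
have h2 := step k.+1 (grid k.+1) t ltac:(by rewrite gridK) gt.
have {}h2 : `|evolution (x, t) - evolution (x, grid k.+1)| <= eps + L * (t - grid k.+1) * C.
  by apply: h2; rewrite -[k.+2%:R]natr1; move: sk st1; set a := k.+1%:R; lra.
have := LC t s st.
rewrite (_ : evolution (x, t) - _ = (evolution (x, t) - evolution (x, grid k.+1)) +
  (evolution (x, grid k.+1) - evolution (x, s))); last by ring.
move=> h3; apply: (le_trans (ler_normD _ _)); lra.
Qed.

Lemma evolution_BUC (A : set R) : (forall eps, 0 <= K eps) -> A `<=` `[0, +oo[%classic ->
  BUC (@slab R d A) evolution.
Proof.
move=> K0 A0; apply: (@BUC_of _ _ _ _ M) => [[x t] _|e e_gt0].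
  exact: evolution_bounded.
pose eps := e / 8; have eps0 : 0 < eps by rewrite divr_gt0.
have [_ _ _ Hge0] := hH; have Hc : continuous H by case: hH.
have [C C0 HC] := H_bounded_cube Hge0 Hc (K0 eps).
have L0 : 0 <= L.
  by have := le_trans (normr_ge0 _) (lip 1 0); rewrite subr0 normr1 mulr1.
pose c := L * C + 1; have c0 : 0 < c by rewrite ltr_wpDl// mulr_ge0.
have N1 : 0 < N^-1 by rewrite invr_gt0.
pose rx := eps / (K eps * d%:R + 1).
have kd : 0 < K eps * d%:R + 1 by rewrite ltr_wpDl// mulr_ge0.
have rx0 : 0 < rx by rewrite divr_gt0.
exists (Num.min rx (Num.min N^-1 (eps / c))).
  by rewrite !lt_min rx0 N1 divr_gt0.
move=> [x t] [y s] /= /A0 + /A0; rewrite /= !in_itv/= !andbT => t0 s0.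
move=> /ball_pairE[]; rewrite !lt_min => /and3P[xy _ _] /and3P[_ ts1 ts2].
have space : `|evolution (x, t) - evolution (y, t)| <= 2 * eps.
  have hA := evolution_almost_lipschitz t.
  have := hA eps eps0 x y; have := hA eps eps0 y x.
  rewrite -(opprB x y) norm1N.
  have : K eps * norm1 (x - y) <= eps.
    apply: le_trans (_ : K eps * (`|x - y| * d%:R) <= _).
      by apply: ler_wpM2l => //; exact: norm1_le_norm.
    move: xy; rewrite /rx ltr_pdivlMr//; have := normr_ge0 (x - y); lra.
  rewrite ler_norml; lra.
have time : `|evolution (y, t) - evolution (y, s)| <= 4 * eps.
  wlog st : s t t0 s0 ts1 ts2 {space} / s <= t.
    move=> W; have [st|ts] := leP s t; first exact: W.
    by rewrite distrC; apply: W => //; rewrite ?(distrC s)// ltW.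
  have nts : `|t - s| = t - s by rewrite ger0_norm ?subr_ge0.
  rewrite nts in ts1 ts2.
  have tsN : (t - s) * N <= 1 by rewrite -ler_pdivlMr// div1r ltW.
  have := evolution_time_modulus y eps0 (K0 eps) HC C0 s0 st tsN.
  have : L * (t - s) * C <= eps.
    move: ts2; rewrite /c ltr_pdivlMr//.
    have : 0 <= t - s by rewrite subr_ge0.
    lra.
  lra.
rewrite (_ : _ - _ = (evolution (x, t) - evolution (y, t)) +
  (evolution (y, t) - evolution (y, s))); last by ring.
by apply: (le_lt_trans (ler_normD _ _)); rewrite /eps in space time *; lra.
Qed.

Lemma evolution_solution (g : R -> R) : (forall eps, 0 <= K eps) ->
  (forall t : R, 0 < t -> is_derive t (1 : R) eta (g t)) ->
  viscosity_solution H eta u0 evolution.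
Proof.
move=> K0 dg; split.
- by move=> T T0; apply: evolution_BUC => // t /=; rewrite !in_itv/= andbT => /andP[].
- exact: evolution0.
- move=> phi hphi [x t] /= t0 lm.
  have [dphi _] : differentiable phi (x, t) /\ _ := hphi (x, t) ltac:(by rewrite /slab /= in_itv/= t0).
  rewrite derive1E (@derive_val _ _ _ _ _ _ _ (dg t t0)).
  exact: (evolution_viscosity t0 (dg t t0) dphi).1.
- move=> phi hphi [x t] /= t0 lm.
  have [dphi _] : differentiable phi (x, t) /\ _ := hphi (x, t) ltac:(by rewrite /slab /= in_itv/= t0).
  rewrite derive1E (@derive_val _ _ _ _ _ _ _ (dg t t0)).
  exact: (evolution_viscosity t0 (dg t t0) dphi).2.
Qed.

End evolution.

(** * Functions with a Lipschitz derivative *)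

Section quadratic_remainder.
Variable R : realType.
Implicit Types (f g : R -> R).

(** [g] is a Lipschitz derivative of [f], in a form that adds up termwise. *)
Definition quadratic_remainder f g := exists2 C, 0 <= C &
  forall t h, `|f (t + h) - f t - h * g t| <= C * h ^+ 2.

Lemma quadratic_remainder_derive f g t : quadratic_remainder f g ->
  is_derive t (1 : R) f (g t).
Proof.
move=> [C C0 hC].
have cv : h^-1 *: ((f \o shift t) (h *: (1 : R)) - f t) @[h --> (0 : R)^'] --> (g t : R).
  apply/cvgrPdist_le => e e0; pose r := e / (C + 1).
  have r0 : 0 < r by rewrite divr_gt0// ltr_wpDl.
  near=> h; have hn0 : h != 0 by near: h; exact: nbhs_dnbhs_neq.
  have hr : `|h| < r.
    near: h; apply/nbhs_dnbhs/nbhs_normP; exists r => //= h /=.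
    by rewrite sub0r normrN.
  rewrite /= [h *: 1]mulr1 distrC [h + t]addrC.
  rewrite -[h^-1 *: _]/(h^-1 * (f (t + h) - f t)).
  have -> : h^-1 * (f (t + h) - f t) - g t = h^-1 * (f (t + h) - f t - h * g t).
    by field.
  have h0 : 0 < `|h| by rewrite normr_gt0.
  rewrite normrM normfV mulrC ler_pdivrMr//.
  apply: (le_trans (hC t h)); rewrite -real_normK ?num_real// expr2 mulrA ler_pM2r//.
  move: hr; rewrite /r ltr_pdivlMr ?ltr_wpDl//; have := normr_ge0 h; lra.
by apply: DeriveDef; [exact: (cvgP _ cv)|exact: (cvg_lim _ cv)].
Unshelve. all: by end_near. Qed.

Lemma quadratic_remainder_lipschitz f g : quadratic_remainder f g ->
  exists2 L, 0 <= L & forall s t, `|g s - g t| <= L * `|s - t|.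
Proof.
move=> [C C0 hC]; exists (2 * C) => [|s t]; first by rewrite mulr_ge0.
have [->|st] := eqVneq s t; first by rewrite !subrr normr0 mulr0.
have h0 : 0 < `|s - t| by rewrite normr_gt0 subr_eq0.
rewrite -(ler_pM2l h0) -normrM.
have h1 := hC t (s - t); have h2 := hC s (t - s).
rewrite [t + _]addrC subrK in h1; rewrite [s + _]addrC subrK in h2.
rewrite -(opprB s t) sqrrN in h2.
have -> : (s - t) * (g s - g t) = (f t - f s - - (s - t) * g s) + (f s - f t - (s - t) * g t).
  by ring.
apply: (le_trans (ler_normD _ _)).
have -> : `|s - t| * (2 * C * `|s - t|) = 2 * (C * (s - t) ^+ 2).
  by rewrite -(real_normK (num_real (s - t))); ring.
by move: h1 h2; set u := C * _; lra.
Qed.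

Lemma quadratic_remainder_continuous f g : quadratic_remainder f g -> continuous g.
Proof.
move=> /quadratic_remainder_lipschitz[L L0 hL] t; apply/cvgrPdist_lt => e e0.
have r0 : 0 < e / (L + 1) by rewrite divr_gt0// ltr_wpDl.
apply/nbhs_normP; exists (e / (L + 1)) => //= s /=.
rewrite ltr_pdivlMr ?ltr_wpDl// => ts; apply: (le_lt_trans (hL t s)).
have := normr_ge0 (t - s); lra.
Qed.

Lemma quadratic_remainder_cst c : quadratic_remainder (fun=> c) (fun=> 0).
Proof. by exists 0 => // t h; rewrite subrr mulr0 subr0 normr0 mul0r. Qed.

Lemma quadratic_remainderD f g f' g' : quadratic_remainder f g ->
  quadratic_remainder f' g' ->
  quadratic_remainder (fun t => f t + f' t) (fun t => g t + g' t).
Proof.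
move=> [C C0 hC] [C' C'0 hC']; exists (C + C') => [|t h]; first exact: addr_ge0.
rewrite (_ : _ - _ = (f (t + h) - f t - h * g t) + (f' (t + h) - f' t - h * g' t)); last by ring.
by apply: (le_trans (ler_normD _ _)); rewrite mulrDl lerD.
Qed.

Lemma quadratic_remainderZ c f g : quadratic_remainder f g ->
  quadratic_remainder (fun t => c * f t) (fun t => c * g t).
Proof.
move=> [C C0 hC]; exists (`|c| * C) => [|t h]; first exact: mulr_ge0.
rewrite (_ : _ - _ = c * (f (t + h) - f t - h * g t)); last by ring.
by rewrite normrM -mulrA ler_wpM2l.
Qed.

Lemma quadratic_remainder_affine a b f g : quadratic_remainder f g ->
  quadratic_remainder (fun t => f (a * t + b)) (fun t => a * g (a * t + b)).
Proof.
move=> [C C0 hC]; exists (C * a ^+ 2) => [|t h]; first by rewrite mulr_ge0 ?sqr_ge0.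
have := hC (a * t + b) (a * h); rewrite exprMn.
rewrite (_ : a * t + b + a * h = a * (t + h) + b); last by ring.
by rewrite !mulrA (mulrC h a).
Qed.

Lemma quadratic_remainder_sum n (f g : 'I_n -> R -> R) :
  (forall i, quadratic_remainder (f i) (g i)) ->
  quadratic_remainder (fun t => \sum_i f i t) (fun t => \sum_i g i t).
Proof.
elim: n f g => [|n IH] f g fg.
  under eq_fun do rewrite big_ord0; under [X in quadratic_remainder _ X]eq_fun do rewrite big_ord0.
  exact: quadratic_remainder_cst.
under eq_fun do rewrite big_ord_recl.
under [X in quadratic_remainder _ X]eq_fun do rewrite big_ord_recl.
apply: quadratic_remainderD; first exact: fg.
by apply: IH => i; exact: fg.
Qed.

Definition sqr_pos (t : R) : R := Num.max t 0 ^+ 2.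
Definition dsqr_pos (t : R) : R := 2 * Num.max t 0.

Lemma sqr_pos_remainder : quadratic_remainder sqr_pos dsqr_pos.
Proof.
exists 1 => // t h; rewrite mul1r /sqr_pos /dsqr_pos.
case: (leP (t + h) 0) => th; case: (leP t 0) => t0;
  rewrite ?(max_idPr th) ?(max_idPr t0) ?(max_idPl (ltW th)) ?(max_idPl (ltW t0));
  rewrite ler_norml; apply/andP; split; nra.
Qed.

(** A [C^1] transition from [0] to [1] over the unit interval: its derivative
    is the piecewise affine hat of height [2]. *)
Definition smoothstep (t : R) : R :=
  2 * sqr_pos t - 4 * sqr_pos (t - 2^-1) + 2 * sqr_pos (t - 1).
Definition dsmoothstep (t : R) : R :=
  2 * dsqr_pos t - 4 * dsqr_pos (t - 2^-1) + 2 * dsqr_pos (t - 1).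

Lemma smoothstep_remainder : quadratic_remainder smoothstep dsmoothstep.
Proof.
have sh b : quadratic_remainder (fun t => sqr_pos (t - b)) (fun t => dsqr_pos (t - b)).
  have := quadratic_remainder_affine 1 (- b) sqr_pos_remainder.
  by under eq_fun do rewrite mul1r; under [X in quadratic_remainder _ X]eq_fun do rewrite !mul1r.
apply: quadratic_remainderD; last exact/quadratic_remainderZ/sh.
apply: quadratic_remainderD; first exact/quadratic_remainderZ/sqr_pos_remainder.
rewrite (_ : (fun t : R => - _) = fun t => (- 4) * sqr_pos (t - 2^-1)); last first.
  by apply/funext => t; rewrite mulNr.
rewrite (_ : (fun t : R => - _) = fun t => (- 4) * dsqr_pos (t - 2^-1)); last first.
  by apply/funext => t; rewrite mulNr.
exact/quadratic_remainderZ/sh.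
Qed.

Lemma dsmoothstep_bounds t : 0 <= dsmoothstep t <= 2.
Proof.
rewrite /dsmoothstep /dsqr_pos.
case: (leP t 0) => a; case: (leP (t - 2^-1) 0) => b; case: (leP (t - 1) 0) => c; lra.
Qed.

Lemma smoothstep_le0 t : t <= 0 -> smoothstep t = 0.
Proof.
by move=> t0; rewrite /smoothstep /sqr_pos !max_r; [ring|lra..].
Qed.

Lemma smoothstep_ge1 t : 1 <= t -> smoothstep t = 1.
Proof.
by move=> t0; rewrite /smoothstep /sqr_pos !max_l; [field|lra..].
Qed.

Lemma remainder_mvt f g s t : quadratic_remainder f g -> s <= t ->
  exists c, f t - f s = g c * (t - s).
Proof.
move=> fg; rewrite le_eqVlt => /orP[/eqP ->|st].
  by exists t; rewrite !subrr mulr0.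
have [|c _ ->] := @MVT R f g s t st (fun x _ => quadratic_remainder_derive x fg).
  apply: continuous_subspaceT => x; apply: differentiable_continuous.
  apply/derivable1_diffP.
  by have [] := quadratic_remainder_derive x fg.
by exists c.
Qed.

Lemma smoothstep_increment s t : s <= t -> 0 <= smoothstep t - smoothstep s <= 2 * (t - s).
Proof.
move=> st; have [c ->] := remainder_mvt smoothstep_remainder st.
have /andP[? ?] := dsmoothstep_bounds c.
by rewrite mulr_ge0 ?subr_ge0//= ler_wpM2r// subr_ge0.
Qed.

End quadratic_remainder.

(** * Smoothing a continuous path *)

Section smooth_path.
Variables (R : realType) (z : R -> R) (n : nat).
Let N : R := n.+1%:R.
Let N0 : 0 < N. Proof. by rewrite ltr0n. Qed.

Definition grid_increment (k : nat) : R := z (grid n.+1%:R k.+1) - z (grid n.+1%:R k).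

(** Interpolation of [z] by a [C^1] path that is monotone between consecutive
    points of the grid of mesh [1 / (n + 1)] and stops at time [n + 1]. *)
Definition smooth_path (t : R) : R :=
  \sum_(k < n.+1 * n.+1) grid_increment k * smoothstep (t * n.+1%:R - k%:R).

Definition dsmooth_path (t : R) : R :=
  \sum_(k < n.+1 * n.+1) grid_increment k * (n.+1%:R * dsmoothstep (t * n.+1%:R - k%:R)).

Lemma smooth_path_remainder : quadratic_remainder smooth_path dsmooth_path.
Proof.
apply: quadratic_remainder_sum => k; apply: quadratic_remainderZ.
have h := quadratic_remainder_affine N (- k%:R) (@smoothstep_remainder R).
have E t : t * n.+1%:R - k%:R = N * t + - k%:R by rewrite mulrC.
by under eq_fun do rewrite E; under [X in quadratic_remainder _ X]eq_fun do rewrite E.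
Qed.

Lemma smooth_path_piece j t : j%:R <= t * N <= j.+1%:R ->
  smooth_path t = smooth_path (grid N j) +
    (if (j < n.+1 * n.+1)%N then grid_increment j else 0) * smoothstep (t * N - j%:R).
Proof.
move=> /andP[jt tj].
have gN : grid N j * N = j%:R by rewrite /grid divfK// gt_eqF.
have other (k : nat) : k != j -> smoothstep (t * N - k%:R) = smoothstep (grid N j * N - k%:R).
  rewrite gN neq_ltn => /orP[kj|jk].
    have kj' : k%:R + 1 <= j%:R :> R by rewrite natr1 ler_nat.
    by rewrite !smoothstep_ge1//; lra.
  have jk' : j.+1%:R <= k%:R :> R by rewrite ler_nat.
  by rewrite !smoothstep_le0//; move: tj jk'; rewrite -(natr1 j); lra.
rewrite /smooth_path -/N; case: ifPn => jn; last first.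
  rewrite mul0r addr0; apply: eq_bigr => k _; rewrite other//.
  by apply/eqP => kj; move: jn; rewrite -kj ltn_ord.
rewrite (bigD1 (Ordinal jn))//= [in RHS](bigD1 (Ordinal jn))//= gN subrr.
rewrite [smoothstep 0]smoothstep_le0// mulr0 add0r addrC; congr (_ + _).
by apply: eq_bigr => k kj; rewrite other ?gN//.
Qed.

Lemma smooth_path0 : smooth_path 0 = 0.
Proof.
by apply: big1 => k _; rewrite mul0r smoothstep_le0 ?mulr0// sub0r oppr_le0.
Qed.

Lemma smooth_path_grid j : (j <= n.+1 * n.+1)%N ->
  smooth_path (grid N j) = z (grid N j) - z 0.
Proof.
elim: j => [|j IH] jn.
  by rewrite /grid mulr0n mul0r smooth_path0 subrr.
have gN : grid N j.+1 * N = j.+1%:R by rewrite /grid divfK// gt_eqF.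
have jg : j%:R <= grid N j.+1 * N <= j.+1%:R by rewrite gN lexx ler_nat leqnSn.
rewrite (smooth_path_piece jg) gN jn IH ?(ltnW jn)//.
rewrite (smoothstep_ge1 (t := _ - _)); last by rewrite -(natr1 j); lra.
by rewrite /grid_increment -/N; ring.
Qed.

Lemma smooth_path_monotone : monotone_between_grid_points N smooth_path.
Proof.
move=> k; set c := if (k < n.+1 * n.+1)%N then grid_increment k else 0.
have inc s t : k%:R <= s * N -> s <= t -> t * N <= k.+1%:R ->
    smooth_path t - smooth_path s =
      c * (smoothstep (t * N - k%:R) - smoothstep (s * N - k%:R)) /\
    0 <= smoothstep (t * N - k%:R) - smoothstep (s * N - k%:R).
  move=> ks st tk; have stN : s * N <= t * N by rewrite ler_pM2r.
  have jt : k%:R <= t * N <= k.+1%:R by rewrite tk (le_trans ks).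
  have js : k%:R <= s * N <= k.+1%:R by rewrite ks (le_trans stN).
  rewrite (smooth_path_piece jt) (smooth_path_piece js).
  split; first by rewrite -/c; ring.
  by have /andP[] := @smoothstep_increment R (s * N - k%:R) (t * N - k%:R) ltac:(lra).
have [c0|c0] := leP 0 c; [left|right] => s t a b e; have [h1 h2] := inc s t a b e.
  by rewrite -subr_ge0 h1 mulr_ge0.
by rewrite -subr_le0 h1 mulr_le0_ge0// ltW.
Qed.

Lemma smooth_path_lipschitz : exists L,
  forall s t, `|smooth_path s - smooth_path t| <= L * `|s - t|.
Proof.
exists (\sum_(k < n.+1 * n.+1) `|grid_increment k| * (2 * N)) => s t.
wlog st : s t / t <= s.
  move=> W; have [ts|/ltW st] := leP t s; first exact: W.
  by rewrite distrC (distrC s); exact: W.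
rewrite /smooth_path -sumrB mulr_suml; apply: (le_trans (ler_norm_sum _ _ _)).
apply: ler_sum => k _; rewrite -mulrBr normrM -mulrA ler_wpM2l//.
have stN : t * N <= s * N by rewrite ler_pM2r.
have /andP[h1 h2] := @smoothstep_increment R (t * N - k%:R) (s * N - k%:R) ltac:(lra).
rewrite ger0_norm// [`|s - t|]ger0_norm ?subr_ge0//.
by apply: (le_trans h2); rewrite le_eqVlt; apply/orP; left; apply/eqP; rewrite /N; ring.
Qed.

Lemma smooth_path_C1 : C1_path smooth_path.
Proof.
split.
  split; first exact: smooth_path0.
  apply: continuous_subspaceT => x; apply: differentiable_continuous.
  apply/derivable1_diffP.
  by have [] := quadratic_remainder_derive x smooth_path_remainder.
exists dsmooth_path; split.
  apply: continuous_subspaceT => x.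
  exact: (quadratic_remainder_continuous smooth_path_remainder).
by move=> t _; exact: quadratic_remainder_derive smooth_path_remainder.
Qed.

End smooth_path.

Lemma smooth_path_cvg (R : realType) (z : R -> R) (T : R) : C0_path z ->
  {uniform `[0, T], (fun n => smooth_path z n) @ \oo --> z}.
Proof.
move=> [z0 zc]; apply/uniform_cvgP => e e0.
have e20 : 0 < e / 2 by rewrite divr_gt0.
have [r r0 hr] := heine (T + 1) zc e20.
near=> n => t /=; rewrite in_itv/= => /andP[t0 tT].
pose N : R := n.+1%:R.
have N0 : 0 < N by rewrite ltr0n.
have hN : Num.max (T + 1) (Num.max 1 (r^-1 + 1)) <= N.
  apply: (@le_trans _ _ n%:R); last by rewrite ler_nat.
  by near: n; exact: nbhs_infty_ger.
have [TN N1 rN] : [/\ T + 1 <= N, 1 <= N & r^-1 + 1 <= N].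
  by split; apply: le_trans hN; rewrite !le_max lexx ?orbT.
have iN : N^-1 < r by rewrite -[r]invrK ltf_pV2 ?posrE ?invr_gt0//; lra.
have iN1 : N^-1 <= 1 by rewrite invf_le1.
have tN : 0 <= t * N by rewrite mulr_ge0// ltW.
have /andP[jt tj] := truncn_itv tN; set j := Num.truncn _ in jt tj.
have jN : (j < n.+1 * n.+1)%N.
  rewrite -(ltr_nat R) natrM; apply: (le_lt_trans jt).
  by rewrite ltr_pM2r//; move: TN; rewrite /N; lra.
have iNN : N^-1 * N = 1 by rewrite mulVf// gt_eqF.
have gj : grid N j <= t by rewrite ler_pdivrMr.
have gj0 : 0 <= grid N j by rewrite divr_ge0// ltW.
have gSj : grid N j.+1 = grid N j + N^-1 by rewrite /grid -natr1 mulrDl mul1r.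
have tg : t < grid N j.+1 by rewrite ltr_pdivlMr.
have jtj : j%:R <= t * N <= j.+1%:R by rewrite jt ltW.
rewrite (smooth_path_piece z jtj) jN smooth_path_grid ?(ltnW jN)//.
rewrite z0 subr0 /grid_increment -/N.
clearbody N.
set s := smoothstep _.
have /andP[s0 s1] : 0 <= s <= 1.
  rewrite -/N in tj.
  have /andP[+ _] := @smoothstep_increment R 0 (t * N - j%:R) ltac:(rewrite subr_ge0; exact: jt).
  rewrite (smoothstep_le0 (t := 0))// subr0 => ->.
  have le1 : t * N - j%:R <= 1 by move: tj; rewrite -natr1; lra.
  have /andP[+ _] := @smoothstep_increment R (t * N - j%:R) 1 le1.
  by rewrite (smoothstep_ge1 (t := 1))// subr_ge0.
rewrite gSj in tg.
have h1 : `|z t - z (grid N j)| < e / 2.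
  apply: hr; [apply/andP; split; lra|apply/andP; split; lra|].
  have tgr : t - grid N j < r by rewrite ltrBlDl (lt_trans tg)// ltrD2l.
  by rewrite ger0_norm// subr_ge0.
have h2 : `|z (grid N j + N^-1) - z (grid N j)| < e / 2.
  have iN0 : 0 < N^-1 by rewrite invr_gt0.
  apply: hr; [apply/andP; split; lra|apply/andP; split; lra|].
  by rewrite [grid N j + _]addrC addrK gtr0_norm.
rewrite -gSj in h2.
rewrite opprD addrA; apply: (le_lt_trans (ler_normB _ _)); rewrite normrM (ger0_norm s0).
have : `|z (grid N j.+1) - z (grid N j)| * s <= `|z (grid N j.+1) - z (grid N j)|.
  by rewrite ler_piMr.
lra.
Unshelve. all: by end_near. Qed.

(** * Pathwise solutions along unbounded paths *)

Section symmetry.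
Variables (R : realType) (d : nat).
Notation V := 'rV[R]_d.
Variables (H : V -> R) (N : R) (eta : R -> R) (u0 : V -> R).
Hypotheses (hH : hamiltonian H) (N0 : 0 < N).
Variable M : R.
Hypothesis u0M : bounded_by M u0.

Lemma stage_mirror k :
  stage (mirror H) N (fun t => - eta t) (fun x => - u0 x) k =
  (fun x => - stage H N eta u0 k x).
Proof.
elim: k => //= k ->; apply/funext => x.
rewrite -(hopf_laxN _ x hH (stage_bounded N eta hH u0M k)).
by congr (hopf_lax _ _ _ _); ring.
Qed.

Lemma evolution_mirror p :
  evolution (mirror H) N (fun t => - eta t) (fun x => - u0 x) p =
  - evolution H N eta u0 p.
Proof.
rewrite /evolution stage_mirror.
rewrite -(hopf_laxN _ _ hH (stage_bounded N eta hH u0M _)).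
by congr (hopf_lax _ _ _ _); ring.
Qed.

Lemma monotone_mirror : monotone_between_grid_points N eta ->
  monotone_between_grid_points N (fun t => - eta t).
Proof.
move=> h k; case: (h k) => hk; [right|left] => s t a b c; rewrite lerN2; exact: hk.
Qed.

Hypothesis mono : monotone_between_grid_points N eta.

Lemma evolution_ge_cst s t c : 0 <= s -> s <= t ->
  (forall x, c <= evolution H N eta u0 (x, s)) ->
  forall x, c <= evolution H N eta u0 (x, t).
Proof.
move=> s0 st sc x; rewrite -lerN2 -evolution_mirror.
apply: (evolution_le_cst (mirror_hamiltonian hH) N0 (monotone_mirror mono)
  (bounded_byN u0M) s0 st) => y.
by rewrite evolution_mirror lerN2.
Qed.

(** If the path ends above its start, [evolution_dilated] applies; otherwise it
    applies to the opposite path, solution and mirrored Hamiltonian. *)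
Lemma evolution_oscillation (eps m L t : R) : Zd_periodic u0 -> 0 < eps ->
  (forall p, ~ in_cube eps p -> forall i, m * `|p 0 i| <= H p) ->
  0 <= m -> 0 < L -> d%:R <= m * L -> L <= `|eta t - eta 0| ->
  forall x y, evolution H N eta u0 (y, t) <= evolution H N eta u0 (x, t) + eps * d%:R.
Proof.
move=> u0p e0 hm m0 L0 dL; have [le0|lt0] := leP 0 (eta t - eta 0).
  rewrite ger0_norm// => Lt x y.
  apply: (dilated_oscillation hH (evolution_dilated N eta hH u0M t u0p) e0 hm) => //.
    exact: lt_le_trans Lt.
  by apply: (le_trans dL); rewrite ler_wpM2l.
move=> Lt x y.
have u0p' : Zd_periodic (fun x => - u0 x) by move=> z k; rewrite u0p.
have hm' p : ~ in_cube eps p -> forall i, m * `|p 0 i| <= mirror H p.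
  move=> pc i; have := hm (- p) _ i; rewrite mxE normrN; apply => pc'; apply: pc => j.
  by have := pc' j; rewrite mxE normrN.
have D := evolution_dilated N (fun t => - eta t) (mirror_hamiltonian hH) (bounded_byN u0M) t u0p'.
have := dilated_oscillation (mirror_hamiltonian hH) D e0 hm' _ m0 _ y x.
rewrite !evolution_mirror => h.
have : - eta t - - eta 0 = `|eta t - eta 0| by rewrite ltr0_norm//; ring.
move=> E; rewrite E in h.
have h1 := h (lt_le_trans L0 Lt).
have h2 : d%:R <= m * `|eta t - eta 0| by apply: (le_trans dL); rewrite ler_wpM2l.
have := h1 h2; lra.
Qed.

End symmetry.

Section long_time.
Variables (R : realType) (d : nat).
Notation V := 'rV[R]_d.
Variables (H : V -> R) (z : R -> R) (u0 : V -> R).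
Hypotheses (hH : hamiltonian H) (zC : C0_path z) (u0B : BUC [set: V] u0).

Definition approximation (n : nat) : V * R -> R :=
  evolution H n.+1%:R (smooth_path z n) u0.

Lemma approximation_solution n :
  viscosity_solution H (smooth_path z n) u0 (approximation n).
Proof.
have [M [K [u0M K0 u0K]]] := BUC_almost_lipschitz u0B.
have N0 : 0 < n.+1%:R :> R by rewrite ltr0n.
have [L hL] := smooth_path_lipschitz z n.
apply: (evolution_solution hH N0 (@smooth_path_monotone R z n) u0M u0K hL K0 (g := dsmooth_path z n)).
by move=> t _; apply: quadratic_remainder_derive; exact: smooth_path_remainder.
Qed.

Definition limit_of_approximations (u : V * R -> R) :=
  forall T : R, 0 < T -> {uniform slab `[0, T], approximation @ \oo --> u}.

Lemma pathwise_limit u : pathwise_solution H z u0 u -> limit_of_approximations u.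
Proof.
move=> pu; apply: (pu (fun n => smooth_path z n) (fun=> u0)) => //.
- by move=> n; exact: smooth_path_C1.
- by move=> T _; exact: smooth_path_cvg.
- apply/uniform_cvgP => e e0; near=> n => x _; by rewrite subrr normr0.
- exact: approximation_solution.
Unshelve. all: by end_near. Qed.

Lemma limit_slice u : limit_of_approximations u -> forall t, 0 <= t -> forall e, 0 < e ->
  \forall n \near \oo, forall x, `|u (x, t) - approximation n (x, t)| < e.
Proof.
move=> hu t t0 e e0; have /hu/uniform_cvgP/(_ e e0) : 0 < t + 1 by lra.
apply: filterS => n hn x; apply: hn; rewrite /slab /= in_itv/= t0/=; lra.
Qed.

(** All pathwise solutions with a given datum agree, since they are the limit
    of the same sequence of approximations. *)
Lemma limit_unique u v : limit_of_approximations u -> limit_of_approximations v ->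
  forall x t, 0 <= t -> u (x, t) = v (x, t).
Proof.
move=> hu hv x t t0; apply/eqP; rewrite -subr_eq0 -normr_eq0; apply/eqP/le_anti.
rewrite normr_ge0 andbT; apply/ler_addgt0Pr => e e0; rewrite add0r.
have e20 : 0 < e / 2 by rewrite divr_gt0.
near \oo => n.
have h1 : `|u (x, t) - approximation n (x, t)| < e / 2.
  by move: x; near: n; exact: limit_slice.
have h2 : `|v (x, t) - approximation n (x, t)| < e / 2.
  by move: x h1; near: n; apply: filterS (limit_slice hv t0 e20) => n h x _.
rewrite (_ : u (x, t) - v (x, t) = (u (x, t) - approximation n (x, t)) -
  (v (x, t) - approximation n (x, t))); last by ring.
by apply: (le_trans (ler_normB _ _)); lra.
Unshelve. all: by end_near. Qed.

Variable u : V * R -> R.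
Hypothesis ulim : limit_of_approximations u.

Lemma smooth_path_near T e : 0 < e -> \forall n \near \oo, forall t, 0 <= t <= T ->
  `|z t - smooth_path z n t| < e.
Proof.
move=> e0; have /uniform_cvgP/(_ e e0) := smooth_path_cvg (T := T) zC.
by apply: filterS => n hn t tT; apply: hn; rewrite /= in_itv/=.
Qed.

Lemma limit_index s t e : 0 <= s -> 0 <= t -> 0 < e -> exists n,
  [/\ forall x, `|u (x, s) - approximation n (x, s)| < e,
      forall x, `|u (x, t) - approximation n (x, t)| < e &
      forall tau, 0 <= tau <= t -> `|z tau - smooth_path z n tau| < e].
Proof.
move=> s0 t0 e0; near \oo => n; exists n; split; near: n; first exact: limit_slice.
  exact: limit_slice.
exact: smooth_path_near.
Unshelve. all: by end_near. Qed.

Lemma limit_le_cst s t c : 0 <= s -> s <= t -> (forall x, u (x, s) <= c) ->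
  forall x, u (x, t) <= c.
Proof.
move=> s0 st uc x; apply/ler_addgt0Pr => e e0.
have e20 : 0 < e / 2 by rewrite divr_gt0.
have [M [K [u0M K0 u0K]]] := BUC_almost_lipschitz u0B.
have [n [h1 h2 _]] := limit_index s0 (le_trans s0 st) e20.
have N0 : 0 < n.+1%:R :> R by rewrite ltr0n.
have : approximation n (x, t) <= c + e / 2.
  apply: (evolution_le_cst hH N0 (@smooth_path_monotone R z n) u0M s0 st) => y.
  have := h1 y; have := uc y; rewrite ltr_norml => ? /andP[+ _].
  by rewrite -/(approximation n (y, s)); lra.
by have := h2 x; rewrite ltr_norml => /andP[_ ?]; lra.
Qed.

Lemma limit_ge_cst s t c : 0 <= s -> s <= t -> (forall x, c <= u (x, s)) ->
  forall x, c <= u (x, t).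
Proof.
move=> s0 st uc x; apply/ler_addgt0Pr => e e0.
have e20 : 0 < e / 2 by rewrite divr_gt0.
have [M [K [u0M K0 u0K]]] := BUC_almost_lipschitz u0B.
have [n [h1 h2 _]] := limit_index s0 (le_trans s0 st) e20.
have N0 : 0 < n.+1%:R :> R by rewrite ltr0n.
have : c - e / 2 <= approximation n (x, t).
  apply: (evolution_ge_cst hH N0 u0M (@smooth_path_monotone R z n) s0 st) => y.
  have := h1 y; have := uc y; rewrite ltr_norml => ? /andP[_ +].
  by rewrite -/(approximation n (y, s)); lra.
by have := h2 x; rewrite ltr_norml => /andP[? _]; lra.
Qed.

Lemma limit_oscillation (eps m L t : R) : Zd_periodic u0 -> 0 < eps ->
  (forall p, ~ in_cube eps p -> forall i, m * `|p 0 i| <= H p) ->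
  0 <= m -> 0 < L -> d%:R <= m * L -> 0 <= t -> L < `|z t| ->
  forall x y, u (y, t) <= u (x, t) + eps * d%:R.
Proof.
move=> u0p e0 hm m0 L0 dL t0 Lt x y; apply/ler_addgt0Pr => e e_gt0.
have e20 : 0 < e / 2 by rewrite divr_gt0.
have Lt0 : 0 < `|z t| - L by rewrite subr_gt0.
have [M [K [u0M K0 u0K]]] := BUC_almost_lipschitz u0B.
have eL : 0 < Num.min (e / 2) (`|z t| - L) by rewrite lt_min e20.
have [n [_ h1 h2]] := limit_index t0 t0 eL.
have {}h1 x' : `|u (x', t) - approximation n (x', t)| < e / 2.
  by apply: lt_le_trans (h1 x') _; rewrite ge_min lexx.
have {}h2 : `|z t - smooth_path z n t| < `|z t| - L.
  by apply: lt_le_trans (h2 t _) _; rewrite ?t0 ?ge_min lexx ?orbT.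
have N0 : 0 < n.+1%:R :> R by rewrite ltr0n.
have Ln : L <= `|smooth_path z n t - smooth_path z n 0|.
  rewrite smooth_path0 subr0.
  have := ler_distD (smooth_path z n t) (z t) 0; rewrite !subr0; lra.
have := evolution_oscillation n.+1%:R hH u0M u0p e0 hm m0 L0 dL Ln x y.
rewrite -!/(approximation n _).
have := h1 x; have := h1 y; rewrite !ltr_norml => /andP[? ?] /andP[? ?] h; lra.
Qed.

End long_time.

Section convergence.
Variables (R : realType) (d : nat).
Notation V := 'rV[R]_d.

Lemma converges_to_constantP (u : V * R -> R) c : converges_to_constant u c <->
  forall e, 0 < e -> exists T, forall t, T < t -> forall x, `|c - u (x, t)| < e.
Proof.
split=> [/uniform_cvgP h e e0|h].
  have [T [_ hT]] := h e e0; exists T => t Tt x.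
  exact: hT.
apply/uniform_cvgP => e e0; have [T hT] := h e e0; exists T; split; first exact: num_real.
by move=> t Tt x _; exact: hT.
Qed.

Definition unbounded_path (z : R -> R) := forall L : R, exists2 t, 0 <= t & L < `|z t|.

(** Along an unbounded path the oscillation of a periodic solution tends to
    zero, and the solution stays between the bounds it has at any time. *)
Lemma unbounded_convergence (H : V -> R) (z : R -> R) (u0 : V -> R) (u : V * R -> R) :
  hamiltonian H -> (forall p, p != 0 -> 0 < H p) -> C0_path z -> unbounded_path z ->
  BUC [set: V] u0 -> Zd_periodic u0 -> limit_of_approximations H z u0 u ->
  exists c, converges_to_constant u c.
Proof.
move=> hH Hpos zC zunb u0B u0p ulim.
have [Hc cH H0 Hge0] := hH.
have osc e : 0 < e -> exists2 t, 0 <= t & forall x y, u (y, t) <= u (x, t) + e.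
  move=> e0; pose eps := e / (d%:R + 1).
  have d1 : 0 < d%:R + 1 :> R by rewrite ltr_wpDl.
  have eps0 : 0 < eps by rewrite divr_gt0.
  have [m m0 hm] := linear_growth cH Hc H0 Hpos eps0.
  pose L := (d%:R + 1) / m; have L0 : 0 < L by rewrite divr_gt0.
  have dL : d%:R <= m * L by rewrite /L mulrCA divff ?gt_eqF// mulr1 lerDl.
  have [t t0 Lt] := zunb L; exists t => // x y.
  have := limit_oscillation hH zC u0B ulim u0p eps0 hm (ltW m0) L0 dL t0 Lt x y.
  have : eps * d%:R <= e.
    by rewrite /eps mulrAC ler_pdivrMr// ler_pM2l// lerDl.
  lra.
pose A := [set a | exists2 t, 0 <= t & forall x, a <= u (x, t)].
have key t0 e : 0 <= t0 -> 0 < e -> (forall x y, u (y, t0) <= u (x, t0) + e) ->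
    forall t x, t0 <= t -> u (0, t0) - e <= u (x, t) <= u (0, t0) + e.
  move=> t00 e0 h t x t0t; apply/andP; split.
    by apply: (limit_ge_cst hH zC u0B ulim t00 t0t) => y; have := h y 0; lra.
  by apply: (limit_le_cst hH zC u0B ulim t00 t0t) => y; exact: h.
have Aub t0 e : 0 <= t0 -> 0 < e -> (forall x y, u (y, t0) <= u (x, t0) + e) ->
    A (u (0, t0) - e) /\ ubound A (u (0, t0) + e).
  move=> t00 e0 h; split.
    exists t0 => // x; have := h x 0; lra.
  move=> a [t tt0 ha] /=.
  have [|/ltW] := leP t t0 => tt.
    apply: le_trans (_ : u (0, t0) <= _); last lra.
    exact: (limit_ge_cst hH zC u0B ulim tt0 tt ha).
  by apply: (le_trans (ha 0)); have /andP[] := key t0 e t00 e0 h t 0 tt.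
exists (sup A); apply/converges_to_constantP => e e0.
have e30 : 0 < e / 3 by rewrite divr_gt0.
have [t0 t00 h] := osc _ e30; exists t0 => t tt x.
have [A1 A2] := Aub _ _ t00 e30 h.
have s1 : u (0, t0) - e / 3 <= sup A by apply: ub_le_sup => //; eexists; exact: A2.
have s2 : sup A <= u (0, t0) + e / 3 by apply: ge_sup => //; eexists; exact: A1.
have /andP[? ?] := key _ _ t00 e30 h t x (ltW tt).
by rewrite ltr_norml; lra.
Qed.

Lemma periodic_pathwise_limit (H : V -> R) z u : hamiltonian H -> C0_path z ->
  periodic_pathwise_solution H z (fun x => u (x, 0)) u ->
  [/\ BUC [set: V] (fun x => u (x, 0)), Zd_periodic (fun x => u (x, 0)) &
      limit_of_approximations H z (fun x => u (x, 0)) u].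
Proof.
move=> hH zC [uB uper _ upw].
have u0B : BUC [set: V] (fun x => u (x, 0)).
  by apply: BUC_slice uB; rewrite /= in_itv/= lexx.
split=> //; first exact: uper.
exact: pathwise_limit.
Qed.

(** The limit is a function of the path and of the datum because it is read off
    the limit of the approximations, which determines every pathwise solution
    with that datum. *)
Lemma limit_along_unbounded_path (H : V -> R) (z : R -> R) :
  hamiltonian H -> (forall p, p != 0 -> 0 < H p) -> C0_path z -> unbounded_path z ->
  exists u_inf : (V -> R) -> R, forall u : V * R -> R,
    periodic_pathwise_solution H z (fun x => u (x, 0)) u ->
    converges_to_constant u (u_inf (fun x => u (x, 0))).
Proof.
move=> hH Hpos zC zunb.
pose P (u0 : V -> R) := [set c | exists u : V * R -> R,
  limit_of_approximations H z u0 u /\ converges_to_constant u c].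
exists (fun u0 => xget 0 (P u0)) => u /(periodic_pathwise_limit hH zC)[u0B u0p ulim].
have [c uc] := unbounded_convergence hH Hpos zC zunb u0B u0p ulim.
case: xgetP => [c' _ [v [vlim vc]]|/(_ c)]; last by case; exists u.
apply/converges_to_constantP => e e0.
have /converges_to_constantP /(_ e e0)[T hT] := vc.
exists (Num.max T 0) => t; rewrite gt_max => /andP[Tt t0] x.
by rewrite (limit_unique ulim vlim x (ltW t0)); exact: hT.
Qed.

End convergence.

(** * Gaussian estimates *)

Section gaussian.
Variable R : realType.
Local Notation mu := (@lebesgue_measure R).

Lemma normal_peakE (s : R) : 0 < s -> normal_peak s = s^-1 * normal_peak 1.
Proof.
move=> s0; rewrite /normal_peak expr1n mul1r -mulrnAr sqrtrM ?sqr_ge0//.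
by rewrite sqrtr_sqr gtr0_norm// invfM.
Qed.

Lemma normal_peak1_gt0 : 0 < normal_peak 1 :> R.
Proof. by apply: normal_peak_gt0; rewrite oner_neq0. Qed.

Lemma normal_peak1_le1 : normal_peak 1 <= 1 :> R.
Proof.
rewrite /normal_peak expr1n mul1r invf_le1; last first.
  by rewrite sqrtr_gt0 mulrn_wgt0// pi_gt0.
rewrite -[leLHS]sqrtr1 ler_sqrt; last by rewrite mulrn_wge0// pi_ge0.
by rewrite mulr2n; have := @pi_ge2 R; lra.
Qed.

Lemma measurable_normal_pdfE (s : R) (A : set R) :
  measurable_fun A (EFin \o normal_pdf 0 s).
Proof. by apply: measurable_funTS; apply/measurable_EFinP; exact: measurable_normal_pdf. Qed.

(** The density is at most the inverse of the standard deviation. *)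
Lemma normal_prob_segment_le (s M : R) : 0 < s -> 0 <= M ->
  (normal_prob 0 s `[(- M)%R, M]%classic <= (2 * M / s)%:E)%E.
Proof.
move=> s0 M0; rewrite /normal_prob.
apply: (@le_trans _ _ (\int[mu]_(x in `[(- M)%R, M]) (cst (s^-1)%:E) x)%E).
  apply: ge0_le_integral => //=.
  - by move=> x _; rewrite lee_fin normal_pdf_ge0.
  - exact: measurable_normal_pdfE.
  - move=> x _; rewrite lee_fin.
    apply: (le_trans (normal_pdf_ub 0 x (lt0r_neq0 s0))).
    by rewrite normal_peakE// ler_piMr ?invr_ge0 ?normal_peak1_le1// ltW.
rewrite integral_cst//= lebesgue_measure_itv/= lte_fin.
case: ifPn => _; last by rewrite mule0 lee_fin divr_ge0 ?mulr_ge0// ltW.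
by rewrite -EFinD -EFinM lee_fin; lra.
Qed.

Lemma measurable_norm_gt (a : R) : measurable [set x : R | a < `|x|].
Proof.
rewrite (_ : [set x | _] = ~` `[- a, a]%classic); first exact: measurableC.
by apply/seteqP; split=> x /=; rewrite in_itv/= -ler_norml ltNge => /negP.
Qed.

(** Outside the segment the density is dominated by a small multiple of the
    density with twice the standard deviation, whose total mass is [1]. *)
Lemma normal_prob_tail_le (s a : R) : 0 < s -> 0 <= a ->
  (normal_prob 0 s [set x | (a < `|x|)%R] <= (2 * expR (- (a ^+ 2 / (4 * s ^+ 2))))%:E)%E.
Proof.
move=> s0 a0; set C := 2 * _.
have C0 : 0 <= C by rewrite mulr_ge0// expR_ge0.
have mA := measurable_norm_gt a.
have s20 : 0 < 2 * s by rewrite mulr_gt0.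
rewrite /normal_prob.
apply: (@le_trans _ _ (\int[mu]_(x in [set x | (a < `|x|)%R]) (C%:E * (normal_pdf 0 (2 * s) x)%:E))%E).
  apply: ge0_le_integral => //=.
  - by move=> x _; rewrite lee_fin normal_pdf_ge0.
  - exact: measurable_normal_pdfE.
  - by apply: measurable_funeM; exact: measurable_normal_pdfE.
  - move=> x ax; rewrite -EFinM lee_fin !normal_pdfE ?gt_eqF//.
    rewrite (normal_peakE s20) (normal_peakE s0) /normal_fun !subr0.
    have p0 := normal_peak1_gt0.
    rewrite [leRHS](_ : _ = s^-1 * normal_peak 1 *
      (expR (- (a ^+ 2 / (4 * s ^+ 2))) * expR (- x ^+ 2 / ((2 * s) ^+ 2 *+ 2)))); last first.
      by rewrite /C; field; rewrite gt_eqF.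
    rewrite ler_pM2l; last by rewrite mulr_gt0// invr_gt0.
    rewrite -expRD ler_expR.
    have xa : a ^+ 2 <= x ^+ 2.
      by rewrite -(real_normK (num_real x)) ler_sqr ?nnegrE// ltW.
    rewrite -subr_ge0 (_ : _ - _ = (3 * x ^+ 2 - 2 * a ^+ 2) / (8 * s ^+ 2)); last first.
      by field; rewrite gt_eqF.
    rewrite divr_ge0//; last by rewrite mulr_ge0// sqr_ge0.
    by have := sqr_ge0 x; lra.
have -> : (\int[mu]_(x in [set x | (a < `|x|)%R]) (C%:E * (normal_pdf 0 (2 * s) x)%:E) =
    C%:E * normal_prob 0 (2 * s) [set x | (a < `|x|)%R])%E.
  apply: ge0_integralZl => //.
  - exact: measurable_normal_pdfE.
  - by move=> x _; rewrite lee_fin normal_pdf_ge0.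
rewrite -[leRHS]mule1; apply: lee_wpmul2l => //.
exact: probability_le1.
Qed.

Definition signed_interval (b : bool) (r : R) : set R :=
  [set x | r <= (-1) ^+ b * x <= 2 * r].

Lemma measurable_signed_interval b r : measurable (signed_interval b r).
Proof.
case: b; rewrite /signed_interval.
  rewrite (_ : [set x | _] = `[- (2 * r), - r]%classic)//.
  by apply/seteqP; split=> x /=; rewrite in_itv/= expr1 mulN1r => /andP[? ?]; apply/andP; split; lra.
rewrite (_ : [set x | _] = `[r, 2 * r]%classic)//.
by apply/seteqP; split=> x /=; rewrite in_itv/= expr0 mul1r.
Qed.

Lemma lebesgue_signed_interval b r : 0 <= r -> mu (signed_interval b r) = r%:E.
Proof.
move=> r0; case: b; rewrite /signed_interval.
  rewrite (_ : [set x | _] = `[- (2 * r), - r]%classic); last first.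
    by apply/seteqP; split=> x /=; rewrite in_itv/= expr1 mulN1r => /andP[? ?]; apply/andP; split; lra.
  rewrite lebesgue_measure_itv/= lte_fin; case: ifPn => h.
    by rewrite -EFinD; congr EFin; ring.
  by congr EFin; move: h; rewrite -leNgt; lra.
rewrite (_ : [set x | _] = `[r, 2 * r]%classic); last first.
  by apply/seteqP; split=> x /=; rewrite in_itv/= expr0 mul1r.
rewrite lebesgue_measure_itv/= lte_fin; case: ifPn => h.
  by rewrite -EFinD; congr EFin; ring.
by congr EFin; move: h; rewrite -leNgt; lra.
Qed.

(** Bounds below, for every standard deviation, the mass between one and two
    standard deviations on a given side, where the density is at least its
    value at two. *)
Definition unit_step_bound : R := expR (- 2) * normal_peak 1.

Lemma unit_step_bound_gt0 : 0 < unit_step_bound.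
Proof. by rewrite mulr_gt0 ?expR_gt0 ?normal_peak1_gt0. Qed.

Lemma normal_prob_signed_interval_ge b (s : R) : 0 < s ->
  (unit_step_bound%:E <= normal_prob 0 s (signed_interval b s))%E.
Proof.
move=> s0; rewrite /normal_prob.
apply: (@le_trans _ _ (\int[mu]_(x in signed_interval b s) (cst (unit_step_bound / s)%:E) x)%E).
  rewrite integral_cst; last exact: measurable_signed_interval.
  by rewrite /= lebesgue_signed_interval ?(ltW s0)// -EFinM divfK// gt_eqF.
apply: ge0_le_integral => //=.
- exact: measurable_signed_interval.
- by move=> x _; rewrite lee_fin divr_ge0// ltW// unit_step_bound_gt0.
- exact: measurable_normal_pdfE.
move=> x /andP[h1 h2]; rewrite lee_fin normal_pdfE ?gt_eqF// normal_peakE// /normal_fun subr0.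
rewrite /unit_step_bound -mulrA mulrC; apply: ler_pM.
- by rewrite mulr_ge0 ?invr_ge0// ltW// normal_peak1_gt0.
- exact: expR_ge0.
- by rewrite mulrC.
rewrite ler_expR mulNr lerN2 ler_pdivrMr; last by rewrite mulrn_wgt0// exprn_gt0.
have -> : x ^+ 2 = ((-1) ^+ b * x) ^+ 2 by rewrite exprMn sqrr_sign mul1r.
rewrite mulr2n; set y := _ * x in h1 h2 *; nra.
Qed.

End gaussian.

(** * Brownian paths *)

Section dyadic.
Variable R : realType.

(** Every dyadic point of level [j.+1] is a point of level [j] or one step away
    from it; the telescoped bound is the partial sum of the geometric series of
    ratio [3/4]. *)
Lemma dyadic_increments_bound (f : R -> R) (a h c : R) : 0 <= c ->
  (forall j i, (i < 2 ^ j)%N ->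
     `|f (a + i.+1%:R * (h / 2 ^+ j)) - f (a + i%:R * (h / 2 ^+ j))| <= c * (3 / 4) ^+ j) ->
  forall j i, (i <= 2 ^ j)%N ->
    `|f (a + i%:R * (h / 2 ^+ j)) - f a| <= 4 * c - 3 * c * (3 / 4) ^+ j.
Proof.
move=> c0 hf; elim=> [|j IH] i.
  rewrite expn0 leq_eqVlt => /orP[/eqP ->|]; last first.
    by rewrite ltnS leqn0 => /eqP ->; rewrite mul0r addr0 subrr normr0 expr0; lra.
  by have := hf 0%N 0%N (leqnn _); rewrite mul0r addr0 !expr0 => h1; lra.
move=> ij.
have pj : 0 <= c * (3 / 4) ^+ j by rewrite mulr_ge0// exprn_ge0.
have even i' : (i' <= 2 ^ j)%N ->
    `|f (a + (i'.*2)%:R * (h / 2 ^+ j.+1)) - f a| <= 4 * c - 3 * c * (3 / 4) ^+ j.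
  move=> /IH; rewrite (_ : (i'.*2)%:R * (h / 2 ^+ j.+1) = i'%:R * (h / 2 ^+ j))//.
  by rewrite -muln2 natrM exprS; field; rewrite expf_neq0.
rewrite -[i]odd_double_half in ij *; set i' := i./2 in ij *.
case: (odd i) ij => /=; rewrite ?add1n ?add0n => ij; last first.
  have i'j : (i' <= 2 ^ j)%N by move: ij; rewrite expnS mul2n leq_double.
  by apply: (le_trans (even i' i'j)); rewrite [(3 / 4) ^+ j.+1]exprS; lra.
have i'j : (i' <= 2 ^ j)%N.
  by move: ij; rewrite expnS mul2n ltn_double; exact: ltnW.
have h1 := hf j.+1 i'.*2 ij; have h2 := even i' i'j.
rewrite (_ : f _ - f a = (f (a + (i'.*2).+1%:R * (h / 2 ^+ j.+1)) - f (a + (i'.*2)%:R * (h / 2 ^+ j.+1)))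
  + (f (a + (i'.*2)%:R * (h / 2 ^+ j.+1)) - f a)); last by ring.
apply: (le_trans (ler_normD _ _)); rewrite [(3 / 4) ^+ j.+1]exprS in h1 *; lra.
Qed.

(** Chaining: the dyadic increments sum geometrically, and continuity passes
    from the dyadic points to all times. *)
Lemma dyadic_oscillation (f : R -> R) (a h c : R) : {within `[0, +oo[, continuous f} ->
  0 <= a -> 0 < h -> 0 <= c ->
  (forall j i, (i < 2 ^ j)%N ->
     `|f (a + i.+1%:R * (h / 2 ^+ j)) - f (a + i%:R * (h / 2 ^+ j))| <= c * (3 / 4) ^+ j) ->
  forall t, a <= t <= a + h -> `|f t - f a| <= 4 * c.
Proof.
move=> fc a0 h0 c0 hf t /andP[at_ ta]; apply/ler_addgt0Pr => e e0.
have t0 : 0 <= t by lra.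
have [r r0 hr] := within_continuousP fc t0 e0.
have [j hj] : exists j, h / 2 ^+ j < r.
  exists (Num.truncn (h / r)).+1.
  have p2 : 0 < 2 ^+ (Num.truncn (h / r)).+1 :> R by rewrite exprn_gt0.
  rewrite ltr_pdivrMr// mulrC -ltr_pdivrMr//; apply: (lt_le_trans (truncnS_gt _)).
  by rewrite -natrX ler_nat ltnW// ltn_expl.
have p2 : 0 < 2 ^+ j :> R by rewrite exprn_gt0.
pose m := h / 2 ^+ j; have m0 : 0 < m by rewrite divr_gt0.
have tm0 : 0 <= (t - a) / m by rewrite divr_ge0 ?subr_ge0// ltW.
have /andP[i1 i2] := truncn_itv tm0; set i := Num.truncn _ in i1 i2.
have i1' : i%:R * m <= t - a by rewrite -ler_pdivlMr.
have i2' : t - a < i%:R * m + m.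
  by rewrite -{2}[m]mul1r -mulrDl natr1 -ltr_pdivrMr.
have im : (i <= 2 ^ j)%N.
  rewrite -(ler_nat R) natrX -(ler_pM2r m0); apply: (le_trans i1').
  by rewrite /m mulrCA divff ?gt_eqF// mulr1; lra.
have h1 := dyadic_increments_bound c0 hf im; rewrite -/m in h1.
have im0 : 0 <= i%:R * m by rewrite mulr_ge0// ltW.
have h2 : `|f t - f (a + i%:R * m)| < e.
  apply: hr; first exact: addr_ge0.
  have tp : t - (a + i%:R * m) < r by rewrite -/m in hj; lra.
  by rewrite ger0_norm//; lra.
rewrite (_ : f t - f a = (f t - f (a + i%:R * m)) + (f (a + i%:R * m) - f a)); last by ring.
apply: (le_trans (ler_normD _ _)).
have : 0 <= c * (3 / 4) ^+ j by rewrite mulr_ge0// exprn_ge0.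
lra.
Qed.

Lemma expR2_ge4 : 4 <= expR 2 :> R.
Proof.
have e1 : 2 <= expR 1 :> R by have := expR_ge1Dx (1 : R); lra.
by rewrite (_ : 2 = 1 + 1)// expRD; nra.
Qed.

(** The left side is Gaussian in [n] and the right side only exponential; [n]
    is a large multiple of [- ln q]. *)
Lemma steps_beat_tails (q : R) : 0 < q -> exists2 n, (0 < n)%N &
  16 <= n%:R ^+ 2 / 1024 :> R /\ 4 * n%:R * expR (- (n%:R ^+ 2 / 1024)) < q ^+ n.
Proof.
move=> q0; pose A := (Num.truncn (- ln q)).+1; pose n := (1024 * (A + 4))%N.
have n0 : (0 < n)%N by rewrite muln_gt0 addnS.
have nE : n%:R ^+ 2 / 1024 = (A%:R + 4) * n%:R :> R.
  by rewrite /n natrM natrD; field.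
have nR : 1 <= n%:R :> R by rewrite ler1n.
exists n => //; rewrite nE; split.
  have : 0 <= A%:R :> R by [].
  have : 16 <= n%:R :> R by rewrite ler_nat /n mulnDr (leq_trans _ (leq_addl _ _)).
  by nra.
have qA : expR (- A%:R) <= q.
  by rewrite -[leRHS]lnK ?posrE// ler_expR lerNl ltW// truncnS_gt.
have e2 := expR2_ge4.
have en : n%:R <= expR n%:R :> R by have := expR_ge1Dx (n%:R : R); lra.
apply: (@lt_le_trans _ _ (expR (- A%:R * n%:R))); last first.
  rewrite expRM_natr; apply: lerXn2r => //; rewrite nnegrE; [exact: expR_ge0|exact: ltW].
apply: (@le_lt_trans _ _ (expR 2 * expR n%:R * expR (- ((A%:R + 4) * n%:R)))).
  by rewrite ler_wpM2r ?expR_ge0// ler_pM.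
rewrite -!expRD ltr_expR.
have : 16 <= n%:R :> R by rewrite ler_nat /n mulnDr (leq_trans _ (leq_addl _ _)).
lra.
Qed.

End dyadic.

Section brownian.
Variables (R : realType) (dT : measure_display) (T : measurableType dT)
  (P : probability T R) (B : R -> {RV P >-> R}).
Hypothesis BM : brownian_motion P B.

Lemma brownian_path w : C0_path (fun t => B t w).
Proof. by case: BM. Qed.

Lemma measurable_increment s t (A : set R) : measurable A ->
  measurable (increment B s t @^-1` A).
Proof.
move=> mA; rewrite -[_ @^-1` _]setTI.
have : measurable_fun [set: T] (B t \- B s) by exact: measurable_funB.
by apply.
Qed.

Lemma increment_law s t (A : set R) : 0 <= s -> s < t -> measurable A ->
  P (increment B s t @^-1` A) = normal_prob 0 (Num.sqrt (t - s)) A.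
Proof. by case: BM => _ h _ s0 st mA; exact: h. Qed.

(** The standard deviation at time [k] grows without bound, so the probability
    to be in a fixed segment at every integer time is [0]. *)
Lemma brownian_unbounded : {ae P, forall w, unbounded_path (fun t => B t w)}.
Proof.
pose F (M : nat) := [set w | forall k : nat, `|B k%:R w| <= M%:R].
apply: (@negligibleS _ _ _ _ (\bigcup_M F M)).
  move=> w /= hw; apply: contrapT => nF; apply: hw => L.
  have LM : L < (Num.truncn L).+1%:R := truncnS_gt L.
  apply: contrapT => hL; apply: nF; exists (Num.truncn L).+1 => //= k.
  rewrite leNgt; apply/negP => hk; apply: hL; exists k%:R => //.
  exact: lt_trans LM hk.
apply: negligible_bigcup => M.
pose A : set R := `[- M%:R, M%:R]%classic.
pose S k := increment B 0 k%:R @^-1` A.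
have mS k : measurable (S k) by apply: measurable_increment; exact: measurable_itv.
have FS k : F M `<=` S k.
  move=> w /(_ k) hw; rewrite /S /A /= in_itv/= -ler_norml /increment.
  by have [-> _] := brownian_path w; rewrite subr0.
exists (\bigcap_k S k); split; first exact: bigcapT_measurable.
- apply/eqP; rewrite eq_le measure_ge0 andbT; apply/lee_addgt0Pr => e e0; rewrite add0e.
  pose k := (Num.truncn ((2 * M%:R / e) ^+ 2)).+1.
  have k0 : 0 < k%:R :> R by rewrite ltr0n.
  apply: (@le_trans _ _ (P (S k))).
    apply: le_measure; rewrite ?inE//; first exact: bigcapT_measurable.
    by move=> w; apply.
  rewrite /S increment_law//; last exact: measurable_itv.
  rewrite subr0; have sk : 0 < Num.sqrt k%:R :> R by rewrite sqrtr_gt0.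
  apply: (le_trans (normal_prob_segment_le sk (ler0n _ _))); rewrite lee_fin.
  rewrite ler_pdivrMr// -ler_pdivrMl// mulrC.
  rewrite -[leLHS]ger0_norm; last by rewrite divr_ge0 ?mulr_ge0// ltW.
  rewrite -sqrtr_sqr. rewrite ler_sqrt; last exact: ltW.
  by rewrite ltW// truncnS_gt.
- by move=> w hw k _; exact: FS.
Qed.

Lemma measure_bigsetU_le (A : nat -> set T) n (v : R) :
  (forall i, measurable (A i)) -> (forall i, (P (A i) <= v%:E)%E) ->
  (P (\big[setU/set0]_(i < n) A i) <= (n%:R * v)%:E)%E.
Proof.
move=> mA Av; apply: le_trans (Boole_inequality P (fun i _ => mA i)) _.
apply: (@le_trans _ _ (\sum_(i < n) v%:E)%E); first by apply: lee_sum => i _; exact: Av.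
by rewrite sumEFin lee_fin sumr_const card_ord mulr_natl.
Qed.

Lemma prod_ge_expn (f : nat -> \bar R) (q : R) n : 0 <= q ->
  (forall i, (i < n)%N -> (q%:E <= f i)%E) -> ((q ^+ n)%:E <= \prod_(i < n) f i)%E.
Proof.
move=> q0; elim: n => [|n IH] hf; first by rewrite big_ord0 expr0.
rewrite big_ord_recr exprSr EFinM; apply: lee_pmul; rewrite ?lee_fin ?exprn_ge0//.
  by apply: IH => i /ltnW; exact: hf.
exact: hf.
Qed.

Section corridor.
Variables (b : bool) (n : nat).
Hypotheses (n0 : (0 < n)%N) (n16 : 16 <= n%:R ^+ 2 / 1024 :> R).
(* over a time [h] the standard deviation is [sd], and [n] climbs of at least
   [sd] reach [1 / 2] *)
Let h : R := (2 * n%:R) ^- 2.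
Let sd : R := (2 * n%:R)^-1.

Let nR : 0 < n%:R :> R. Proof. by rewrite ltr0n. Qed.
Let h0 : 0 < h. Proof. by rewrite invr_gt0 exprn_gt0// mulr_gt0. Qed.
Let sd0 : 0 < sd. Proof. by rewrite invr_gt0 mulr_gt0. Qed.

(* by chaining, the path moves by at most [4 / 32] within a step outside of
   these events *)
Let bad_dyadic (k j i : nat) : set T :=
  increment B (k%:R * h + i%:R * (h / 2 ^+ j)) (k%:R * h + i.+1%:R * (h / 2 ^+ j))
    @^-1` [set x | 1 / 32 * (3 / 4) ^+ j < `|x|].

Let bad_level (j : nat) : set T :=
  \big[setU/set0]_(k < n) \big[setU/set0]_(i < 2 ^ j) bad_dyadic k j i.

Let bad : set T := \bigcup_j bad_level j.

Let good : set T :=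
  \bigcap_(k in `I_n) (increment B (k%:R * h) (k.+1%:R * h) @^-1` signed_interval b sd).

Let mbad_dyadic k j i : measurable (bad_dyadic k j i).
Proof. by apply: measurable_increment; exact: measurable_norm_gt. Qed.

Let mbad_level j : measurable (bad_level j).
Proof. by apply: bigsetU_measurable => k _; apply: bigsetU_measurable => i _. Qed.

Let mbad : measurable bad.
Proof. exact: bigcupT_measurable. Qed.

Let mgood : measurable good.
Proof.
apply: fin_bigcap_measurable => // k _.
by apply: measurable_increment; exact: measurable_signed_interval.
Qed.

Let P_bad_dyadic k j i :
  (P (bad_dyadic k j i) <= (2 * expR (- (n%:R ^+ 2 / 1024)) / 4 ^+ j)%:E)%E.
Proof.
have hh := h0; have nn := nR.
have p2 : 0 < 2 ^+ j :> R by rewrite exprn_gt0.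
pose m := h / 2 ^+ j; have m0 : 0 < m by rewrite divr_gt0.
rewrite /bad_dyadic -/m increment_law//; first last.
- exact: measurable_norm_gt.
- by rewrite ltrD2l ltr_pM2r// ltr_nat.
- by rewrite addr_ge0// mulr_ge0// ltW.
rewrite (_ : _ - _ = m); last by rewrite -natr1; ring.
have s0 : 0 < Num.sqrt m by rewrite sqrtr_gt0.
have a0 : 0 <= 1 / 32 * (3 / 4) ^+ j :> R by rewrite mulr_ge0// exprn_ge0.
apply: (le_trans (normal_prob_tail_le s0 a0)); rewrite lee_fin.
rewrite -[leRHS]mulrA ler_pM2l// sqr_sqrtr; last exact: ltW.
have n1024 := n16.
set K := n%:R ^+ 2 / 1024 in n1024 *.
have -> : (1 / 32 * (3 / 4) ^+ j) ^+ 2 / (4 * m) = K * (9 / 8) ^+ j.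
  have e98 : (3 / 4) ^+ j * (3 / 4) ^+ j * 2 ^+ j = (9 / 8) ^+ j :> R.
    by rewrite -!exprMn; congr (_ ^+ j); field.
  rewrite -e98 /m /h /K; field.
  by rewrite !gt_eqF.
have bern : 1 + j%:R / 8 <= (9 / 8) ^+ j :> R.
  elim: (j) => [|l IH]; first by rewrite expr0 mul0r addr0.
  by rewrite exprS -natr1; have : 0 <= l%:R :> R by []; lra.
have e14 : expR (- (K / 8)) <= 4^-1.
  rewrite expRN lef_pV2 ?posrE ?expR_gt0//.
  apply: (@le_trans _ _ (expR 2)); last by rewrite ler_expR; lra.
  exact: expR2_ge4.
apply: (@le_trans _ _ (expR (- K) * expR (- (K / 8)) ^+ j)).
  rewrite -expRM_natr -expRD ler_expR.
  have : K * (1 + j%:R / 8) <= K * (9 / 8) ^+ j by rewrite ler_pM2l//; lra.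
  lra.
rewrite ler_pM2l ?expR_gt0// -exprVn; by apply: lerXn2r; rewrite ?nnegrE ?expR_ge0.
Qed.

Let P_bad : (P bad <= (4 * n%:R * expR (- (n%:R ^+ 2 / 1024)))%:E)%E.
Proof.
apply: (le_trans (generalized_Boole_inequality P mbad_level mbad)).
set v := 4 * _ * _.
have v0 : 0 <= v by apply: mulr_ge0; [exact: mulr_ge0|exact: expR_ge0].
apply: (@le_trans _ _ (\sum_(j <oo) (v / (2 ^ j.+1)%:R)%:E)%E); last exact: epsilon_trick0.
apply: lee_nneseries => // j _.
have h1 k := @measure_bigsetU_le (bad_dyadic k j) (2 ^ j) _ (mbad_dyadic k j) (P_bad_dyadic k j).
apply: (le_trans (measure_bigsetU_le n _ h1)).
  by move=> k; apply: bigsetU_measurable => i _.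
rewrite lee_fin le_eqVlt; apply/orP; left; apply/eqP.
have -> : 4 ^+ j = 2 ^+ j * 2 ^+ j :> R by rewrite -exprMn; congr (_ ^+ j); ring.
by rewrite /v !natrX [2 ^+ j.+1]exprS; set E := expR _; field; rewrite expf_neq0.
Qed.

Let P_good : ((unit_step_bound R ^+ n)%:E <= P good)%E.
Proof.
have hh := h0.
case: BM => _ _ /(_ n (fun k => k%:R * h) (fun=> signed_interval b sd)) ind.
rewrite /good ind; first last.
- by move=> _; exact: measurable_signed_interval.
- by move=> i j ij; rewrite ler_pM2r// ler_nat.
- by rewrite mul0r.
apply: (@prod_ge_expn (fun k => P (increment B (k%:R * h) (k.+1%:R * h) @^-1` signed_interval b sd))).
  exact/ltW/unit_step_bound_gt0.
move=> k kn; rewrite increment_law//; first last.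
- exact: measurable_signed_interval.
- by rewrite ltr_pM2r// ltr_nat.
- by rewrite mulr_ge0// ltW.
rewrite (_ : _ - _ = h); last by rewrite -natr1; ring.
rewrite (_ : Num.sqrt h = sd); first exact: normal_prob_signed_interval_ge.
by rewrite /h /sd -exprVn sqrtr_sqr ger0_norm// ltW.
Qed.

Let good_path w : good w -> ~ bad w ->
  (forall t, 0 <= t <= n%:R * h -> - (1 / 8) <= (-1) ^+ b * B t w) /\
  1 / 2 <= (-1) ^+ b * B (n%:R * h) w.
Proof.
move=> gw bw; have hh := h0; have nn := nR; have ss := sd0.
have [B0 Bc] := brownian_path w.
have climb k : (k <= n)%N -> k%:R * sd <= (-1) ^+ b * B (k%:R * h) w.
  elim: k => [|k IH] kn; first by rewrite !mul0r B0 mulr0.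
  have /andP[h1 _] := gw k kn; rewrite /increment mulrBr in h1.
  have ih := IH (ltnW kn); rewrite -[in leLHS]natr1 mulrDl mul1r; lra.
split; last first.
  by apply: le_trans (climb n (leqnn n)); rewrite /sd le_eqVlt; apply/orP; left; apply/eqP; field; rewrite gt_eqF.
move=> t /andP[t0 tn].
have th0 : 0 <= t / h by rewrite divr_ge0// ltW.
have [k kn /andP[kt tk]] : exists2 k, (k < n)%N & k%:R * h <= t <= k%:R * h + h.
  have /andP[k1 k2] := truncn_itv th0; set k := Num.truncn _ in k1 k2.
  have k1' : k%:R * h <= t by rewrite -ler_pdivlMr.
  have k2' : t < k.+1%:R * h by rewrite -ltr_pdivrMr.
  rewrite -natr1 mulrDl mul1r in k2'.
  have [kn|nk] := ltnP k n; first by exists k => //; rewrite k1' ltW.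
  have nE : t = n%:R * h.
    apply/eqP; rewrite eq_le tn/=; apply: le_trans k1'.
    by rewrite ler_pM2r// ler_nat.
  exists n.-1; first by rewrite prednK.
  have -> : n.-1%:R = n%:R - 1 :> R by rewrite -subn1 natrB.
  by rewrite nE; apply/andP; split; lra.
have kh0 : 0 <= k%:R * h by rewrite mulr_ge0// ltW.
have osc : `|B t w - B (k%:R * h) w| <= 4 * (1 / 32).
  apply: (dyadic_oscillation (h := h) Bc kh0 hh) => //; last by rewrite kt.
  move=> j i ij; rewrite leNgt; apply/negP => hb; apply: bw; exists j => //.
  rewrite /bad_level (bigD1 (Ordinal kn))//=; left.
  by rewrite (bigD1 (Ordinal ij))//=; left.
have cl := climb k (ltnW kn).
have ks : 0 <= k%:R * sd by rewrite mulr_ge0// ltW.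
move: osc; rewrite ler_norml => /andP[? ?].
have : (-1) ^+ b = 1 :> R \/ (-1) ^+ b = - 1 :> R by case: (b); [right|left].
by case=> e; rewrite e in cl *; lra.
Qed.

Hypothesis beat : 4 * n%:R * expR (- (n%:R ^+ 2 / 1024)) < unit_step_bound R ^+ n.

(** Outside of [bad] the path moves little within each of the [n] steps, and on
    [good] each step climbs; the two probabilities are compared in [beat]. *)
Lemma corridor_event : exists E : set T, [/\ measurable E, (0 < P E)%E &
  forall w, E w ->
    (forall t, 0 <= t <= n%:R * h -> - (1 / 8) <= (-1) ^+ b * B t w) /\
    1 / 2 <= (-1) ^+ b * B (n%:R * h) w].
Proof.
exists (good `\` bad); split; first exact: measurableD.
  rewrite lt_neqAle measure_ge0 andbT; apply/eqP => P0.
  have : (P good <= P (good `\` bad) + P bad)%E.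
    apply: le_trans (measureU2 P (measurableD mgood mbad) mbad).
    apply: le_measure; rewrite ?inE//; first by apply: measurableU => //; exact: measurableD.
    by move=> w gw; have [bw|bw] := pselect (bad w); [right|left].
  rewrite -P0 add0e => gb.
  have := le_trans P_good (le_trans gb P_bad).
  by rewrite lee_fin leNgt beat.
by move=> w [gw bw]; exact: good_path.
Qed.

End corridor.

(** The path is forced to climb by [n] small steps, at a price exponential in
    [n], while the probability of a large excursion inside some step is
    Gaussian in [n]. *)
Lemma corridor (b : bool) : exists (tau : R) (E : set T),
  [/\ 0 < tau, measurable E, (0 < P E)%E & forall w, E w ->
    (forall t, 0 <= t <= tau -> - (1 / 8) <= (-1) ^+ b * B t w) /\
    1 / 2 <= (-1) ^+ b * B tau w].
Proof.
have [n n0 [n16 beat]] := steps_beat_tails (unit_step_bound_gt0 R).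
have [E [mE PE hE]] := corridor_event b n0 n16 beat.
exists (n%:R * (2 * n%:R) ^- 2), E; split => //.
by rewrite mulr_gt0 ?ltr0n// invr_gt0 exprn_gt0// mulr_gt0// ltr0n.
Qed.

End brownian.

(** * The absolute value as Hamiltonian and the distance to the integers *)

Section tent.
Variable R : realType.
Implicit Types s t y a : R.

(** The distance to the nearest integer. *)
Definition tent s : R := `|s - (Num.floor (s + 2^-1))%:~R|.

Lemma tent_le_half s : tent s <= 2^-1.
Proof.
rewrite /tent; have := floor_le_tmp (s + 2^-1); have := floorD1_gt (s + 2^-1).
by rewrite intrD ler_norml; lra.
Qed.

Lemma tent_ge0 s : 0 <= tent s. Proof. exact: normr_ge0. Qed.

Lemma intr_norm_ge1 (m : int) : m != 0 -> 1 <= `|m%:~R : R|.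
Proof. by move=> m0; rewrite -intr_norm ler1z -gtz0_ge1 normr_gt0. Qed.

Lemma tent_le_dist s (k : int) : tent s <= `|s - k%:~R|.
Proof.
have th := tent_le_half s.
have [->//|kf] := eqVneq k (Num.floor (s + 2^-1)).
have h1 : 1 <= `|k%:~R - (Num.floor (s + 2^-1))%:~R| :> R.
  by rewrite -intrB intr_norm_ge1// subr_eq0.
have h2 := ler_distD s k%:~R (Num.floor (s + 2^-1))%:~R.
move: h2; rewrite distrC -/(tent s) => h2; rewrite distrC.
by rewrite distrC in h1; lra.
Qed.

(** The integer in the definition is a nearest one, and near an integer there
    is no better choice. *)
Lemma tentE y (k : int) : `|y - k%:~R| <= 2^-1 -> tent y = `|y - k%:~R|.
Proof.
move=> yk; apply/eqP; rewrite eq_le tent_le_dist /=.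
set f := Num.floor (y + 2^-1).
have [<-//|kf] := eqVneq f k.
have h1 : 1 <= `|k%:~R - f%:~R| :> R.
  by rewrite -intrB intr_norm_ge1// subr_eq0 eq_sym.
have h2 := ler_distD y k%:~R f%:~R.
by move: h2; rewrite (distrC k%:~R y) -/(tent y) -/f => h2; lra.
Qed.

Lemma tent_shift s (k : int) : tent (s + k%:~R) = tent s.
Proof.
rewrite (@tentE _ (Num.floor (s + 2^-1) + k)) intrD opprD addrACA subrr addr0 //.
exact: tent_le_half.
Qed.

Lemma tent_lipschitz s t : tent t <= tent s + `|t - s|.
Proof.
apply: (le_trans (tent_le_dist t (Num.floor (s + 2^-1)))).
by rewrite [leRHS]addrC /tent (ler_distD s).
Qed.

(** Around a nearest integer [tent] is affine with slope [1] or [-1], so every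
    level is attained at exactly the distance given by the difference of the
    levels. *)
Lemma tent_ray s v : 0 <= v <= 2^-1 -> exists2 y, tent y = v & `|y - s| = `|v - tent s|.
Proof.
move=> /andP[v0 v2]; set k := Num.floor (s + 2^-1).
pose sg : R := if k%:~R <= s then 1 else -1.
have sE : s = k%:~R + sg * tent s.
  rewrite /sg /tent -/k; case: leP => ks.
    by rewrite ger0_norm ?subr_ge0//; ring.
  by rewrite ltr0_norm ?subr_lt0//; ring.
have sg1 : `|sg| = 1 by rewrite /sg; case: ifP; rewrite ?normrN1 ?normr1.
exists (k%:~R + sg * v).
  have yk : k%:~R + sg * v - k%:~R = sg * v by ring.
  by rewrite (@tentE _ k) yk normrM sg1 mul1r ger0_norm.
have -> : k%:~R + sg * v - s = sg * (v - tent s) by lra.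
by rewrite normrM sg1 mul1r.
Qed.

End tent.

Section reflected_flow.
Variable R : realType.
Implicit Types (A B : nat -> R) (s a m : R).

(** A translation by [a], stopped at the ends of [[0, 1/2]]. *)
Definition reflected_step a s : R := Num.max 0 (Num.min (s + a) 2^-1).

(** The flow of the path [A], reflected at the ends of the interval [[0, 1/2]].
    The first increments of the path act last because the solution operators
    act on functions of [tent] by composition on the right. *)
Fixpoint reflected_flow A k s : R :=
  if k is k'.+1 then reflected_flow A k' (reflected_step (A k - A k') s) else s.

Lemma reflected_step_mono a s s' : s <= s' -> reflected_step a s <= reflected_step a s'.
Proof.
move=> ss; rewrite /reflected_step; apply: le_max2 => //; apply: le_min2 => //.
by rewrite lerD2r.
Qed.

Lemma reflected_step_range a s : 0 <= reflected_step a s <= 2^-1.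
Proof.
rewrite /reflected_step le_max lexx /= ge_max ge_min lexx orbT andbT; lra.
Qed.

Lemma reflected_flow_mono A k s s' : s <= s' -> reflected_flow A k s <= reflected_flow A k s'.
Proof.
by elim: k s s' => //= k IH s s' ss; apply: IH; exact: reflected_step_mono.
Qed.

Lemma reflected_flow_range A k s : 0 <= s <= 2^-1 -> 0 <= reflected_flow A k s <= 2^-1.
Proof. by elim: k s => //= k IH s sr; apply: IH; exact: reflected_step_range. Qed.

Lemma reflected_step_cases a s :
  [\/ reflected_step a s = 0 /\ s + a <= 0,
      reflected_step a s = s + a /\ 0 <= s + a <= 2^-1 |
      reflected_step a s = 2^-1 /\ 2^-1 <= s + a].
Proof.
rewrite /reflected_step; have [h1|h1] := leP (s + a) 2^-1; last first.
  by apply: Or33; rewrite ltW// max_r//; lra.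
have [h2|h2] := leP 0 (s + a); first by apply: Or32.
by apply: Or31; rewrite ltW.
Qed.

Lemma reflected_step_cmp a b s s' e e' m : e' <= m -> s - s' + e <= m ->
  a - b = e - e' -> reflected_step a s - reflected_step b s' + e' <= m.
Proof.
move=> em sm ab; by case: (reflected_step_cases a s) => -[-> h1];
  case: (reflected_step_cases b s') => -[-> h2]; lra.
Qed.

(** A reflection never raises the discrepancy of two flows above the largest
    discrepancy of their paths. The bound is one-sided, so that upper and lower
    estimates are used separately. *)
Lemma reflected_flow_cmp A B k s s' m :
  (forall j, (j <= k)%N -> A j - B j <= m) -> s - s' + (A k - B k) <= m ->
  reflected_flow A k s - reflected_flow B k s' + (A 0%N - B 0%N) <= m.
Proof.
elim: k s s' => [//|k IH] s s' AB ss /=.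
apply: IH => [j jk|]; first by apply: AB; exact: ltnW.
apply: (reflected_step_cmp (e := A k.+1 - B k.+1)) => //; first by apply: AB.
by ring.
Qed.

(** The bound below of the position plus [A j] by [1/2 - e] is kept at each
    step: a stop at the upper end leaves [1/2 + A j], and a stop at the lower
    end only raises the position. *)
Lemma reflected_flow_ge A k s e : 0 <= e -> (forall j, (j <= k)%N -> - e <= A j) ->
  2^-1 - e <= s + A k -> 2^-1 - e <= reflected_flow A k s + A 0%N.
Proof.
move=> e0; elim: k s => [//|k IH] s hA hs /=.
apply: IH => [j jk|]; first by apply: hA; exact: ltnW.
have hk := hA k (leqnSn k).
by case: (reflected_step_cases (A k.+1 - A k) s) => -[-> h1]; lra.
Qed.

Lemma reflected_flow_le A k s e : 0 <= e -> (forall j, (j <= k)%N -> A j <= e) ->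
  s + A k <= e -> reflected_flow A k s + A 0%N <= e.
Proof.
move=> e0; elim: k s => [//|k IH] s hA hs /=.
apply: IH => [j jk|]; first by apply: hA; exact: ltnW.
have hk := hA k (leqnSn k).
by case: (reflected_step_cases (A k.+1 - A k) s) => -[-> h1]; lra.
Qed.

End reflected_flow.

Section norm_hamiltonian.
Variable R : realType.
Notation V := 'rV[R]_1.
Implicit Types (p q x y : V) (g : R -> R).

Definition norm_ham p : R := `|p|.

Lemma norm_rV1 p : `|p| = `|p 0 0|.
Proof.
apply/eqP; rewrite eq_le coord_le_norm andbT.
by apply: norm_le_cube => // i; rewrite (ord1 i).
Qed.

Lemma norm_hamiltonian : hamiltonian norm_ham.
Proof.
split=> [p|t p q /andP[t0 t1]||p].
- exact: norm_continuous.
- rewrite /norm_ham; apply: (le_trans (ler_normD _ _)).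
  by rewrite !normrZ (ger0_norm t0) ger0_norm// subr_ge0.
- exact: normr0.
- exact: normr_ge0.
Qed.

(** The Legendre transform of a norm is the indicator of the dual unit ball. *)
Lemma norm_ham_epi (q : V) (l : R) : legendre_epi norm_ham (q, l) <-> `|q 0 0| <= 1 /\ 0 <= l.
Proof.
have dotE p : dot p q = p 0 0 * q 0 0 by rewrite /dot big_ord1.
split=> [E|[q1 l0] p /=]; last first.
  rewrite dotE /norm_ham norm_rV1.
  have : p 0 0 * q 0 0 <= `|p 0 0| * `|q 0 0| by rewrite -normrM ler_norm.
  have : `|p 0 0| * `|q 0 0| <= `|p 0 0| by rewrite ler_piMr.
  lra.
have l0 : 0 <= l by have := E 0; rewrite dotE /norm_ham normr0 mxE mul0r subr0.
split=> //; rewrite leNgt; apply/negP => q1.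
have := E (((l + 1) / (`|q 0 0| - 1) * Num.sg (q 0 0)) *: const_mx 1).
rewrite dotE /norm_ham norm_rV1 !mxE mulr1 -mulrA -normrEsg normrM normr_sg.
have -> : q 0 0 != 0 by rewrite -normr_gt0; lra.
have c0 : 0 < `|q 0 0| - 1 by lra.
rewrite mulr1 ger0_norm; last by rewrite divr_ge0//; lra.
have -> : (l + 1) / (`|q 0 0| - 1) * `|q 0 0| - (l + 1) / (`|q 0 0| - 1) = l + 1.
  by field; rewrite gt_eqF.
by rewrite /=; lra.
Qed.

Definition tent1 (x : V) : R := tent (x 0 0).

Lemma norm_ham_even : mirror norm_ham = norm_ham.
Proof. by apply/funext => p; rewrite /mirror /norm_ham normrN. Qed.

Lemma tent_near x a v : 0 <= v <= 2^-1 -> `|v - tent1 x| <= a ->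
  exists2 q : V, `|q 0 0| <= 1 & tent1 (x + a *: q) = v.
Proof.
move=> vr va; have [y ty yx] := tent_ray (x 0 0) vr.
have [a0|a0] := leP a 0.
  exists 0; first by rewrite mxE normr0.
  rewrite scaler0 addr0; apply/esym/eqP; rewrite -subr_eq0 -normr_eq0.
  by apply/eqP/le_anti; rewrite (le_trans va a0) normr_ge0.
exists (const_mx ((y - x 0 0) / a)).
  by rewrite mxE normrM normfV (gtr0_norm a0) ler_pdivrMr// mul1r yx.
by rewrite /tent1 !mxE mulrC divfK ?gt_eqF// addrC subrK.
Qed.

Lemma tent1_lipschitz x q (a : R) : 0 <= a -> `|q 0 0| <= 1 ->
  `|tent1 (x + a *: q) - tent1 x| <= a.
Proof.
move=> a0 q1; have aq : `|a * q 0 0| <= a by rewrite normrM ger0_norm// ler_piMr.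
have h1 := tent_lipschitz (x 0 0) ((x + a *: q) 0 0).
have h2 := tent_lipschitz ((x + a *: q) 0 0) (x 0 0).
have e : `|(x + a *: q) 0 0 - x 0 0| = `|a * q 0 0|.
  by rewrite !mxE [x 0 0 + _]addrC addrK.
rewrite distrC e in h2; rewrite e in h1.
by rewrite ler_norml /tent1; apply/andP; split; lra.
Qed.

(** Displacements of length at most [a] are free and longer ones forbidden;
    [tent] takes on the ball of radius [a] exactly the values in [[0, 1/2]] at
    distance at most [a], and a nondecreasing [g] has its extrema at the
    extreme values. *)
Lemma hopf_lax_tent g a : {homo g : s t / s <= t} ->
  hopf_lax norm_ham a (fun x => g (tent1 x)) = fun x => g (reflected_step a (tent1 x)).
Proof.
move=> gm; have [_ _ H0 Hge0] := norm_hamiltonian.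
have tr x : 0 <= tent1 x <= 2^-1 by rewrite tent_ge0 tent_le_half.
pose M := Num.max `|g 0| `|g 2^-1|.
have gM : bounded_by M (fun x => g (tent1 x)).
  move=> x; have /andP[/gm h1 /gm h2] := tr x.
  have := ler_norm (g 2^-1); have := ler_norm (- g 0); rewrite normrN => h3 h4.
  have m1 : `|g 0| <= M by rewrite le_max lexx.
  have m2 : `|g 2^-1| <= M by rewrite le_max lexx orbT.
  by rewrite ler_norml; apply/andP; split; lra.
apply/funext => x; have /andP[t0 t1] := tr x.
rewrite /hopf_lax; case: ifPn => [a0|].
  have rE : reflected_step a (tent1 x) = Num.min (tent1 x + a) 2^-1.
    rewrite /reflected_step max_r// le_min; by apply/andP; split; lra.
  apply/eqP; rewrite eq_le rE; apply/andP; split.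
    apply: (supconv_le Hge0) => -[q l] /norm_ham_epi[q1 l0] /=.
    have := mulr_ge0 a0 l0; have : g (tent1 (x + a *: q)) <= g (Num.min (tent1 x + a) 2^-1).
      apply: gm; rewrite le_min; have := tent1_lipschitz x a0 q1.
      have /andP[_ ->] := tr (x + a *: q); rewrite andbT ler_norml; lra.
    lra.
  have vr : 0 <= Num.min (tent1 x + a) 2^-1 <= 2^-1.
    by rewrite le_min ge_min lexx orbT andbT; apply/andP; split; lra.
  have va : `|Num.min (tent1 x + a) 2^-1 - tent1 x| <= a.
    by rewrite ler_norml; case: (leP (tent1 x + a) 2^-1) => h; apply/andP; split; lra.
  have [q q1 <-] := tent_near vr va.
  have E : legendre_epi norm_ham (q, 0) by apply/norm_ham_epi.
  by have := supconv_ge H0 Hge0 x a0 gM E; rewrite /= mulr0 subr0.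
rewrite -ltNge => a0; have na0 : 0 <= - a by lra.
have rE : reflected_step a (tent1 x) = Num.max 0 (tent1 x + a).
  by rewrite /reflected_step min_l//; lra.
rewrite norm_ham_even; apply/eqP; rewrite eq_le rE; apply/andP; split.
  have vr : 0 <= Num.max 0 (tent1 x + a) <= 2^-1.
    by rewrite le_max lexx/= ge_max; apply/andP; split; lra.
  have va : `|Num.max 0 (tent1 x + a) - tent1 x| <= - a.
    by rewrite ler_norml; case: (leP 0 (tent1 x + a)) => h; apply/andP; split; lra.
  have [q q1 <-] := tent_near vr va.
  have E : legendre_epi norm_ham (q, 0) by apply/norm_ham_epi.
  rewrite lerNl; have := supconv_ge H0 Hge0 x na0 (bounded_byN gM) E.
  by rewrite /= mulr0 subr0.
rewrite lerNr; apply: (supconv_le Hge0) => -[q l] /norm_ham_epi[q1 l0] /=.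
have := mulr_ge0 na0 l0; have : g (Num.max 0 (tent1 x + a)) <= g (tent1 (x + (- a) *: q)).
  apply: gm; rewrite ge_max; have := tent1_lipschitz x na0 q1.
  have /andP[-> _] := tr (x + (- a) *: q); rewrite /= ler_norml; lra.
lra.
Qed.

Lemma stage_tent (N : R) (eta : R -> R) k :
  stage norm_ham N eta tent1 k =
  fun x => reflected_flow (fun j => eta (grid N j)) k (tent1 x).
Proof.
elim: k => [//|k IH] /=.
by rewrite IH hopf_lax_tent// => s t; exact: reflected_flow_mono.
Qed.

Lemma evolution_tent (N : R) (eta : R -> R) x t :
  evolution norm_ham N eta tent1 (x, t) =
  reflected_flow (fun j => eta (grid N j)) (Num.truncn (t * N))
    (reflected_step (eta t - eta (grid N (Num.truncn (t * N)))) (tent1 x)).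
Proof.
by rewrite /evolution stage_tent hopf_lax_tent// => s s'; exact: reflected_flow_mono.
Qed.

Lemma tent1_periodic : Zd_periodic tent1.
Proof. by move=> x k; rewrite /tent1 !mxE tent_shift. Qed.

Lemma tent1_BUC : BUC [set: V] tent1.
Proof.
apply: (@BUC_of _ _ _ _ 2^-1) => [x _|e e0].
  by rewrite ger0_norm ?tent_ge0 ?tent_le_half.
exists e => // x y _ _; rewrite -ball_normE /= norm_rV1 !mxE => xy.
have := tent_lipschitz (x 0 0) (y 0 0); have := tent_lipschitz (y 0 0) (x 0 0).
by rewrite (distrC (y 0 0)) ltr_norml /tent1; lra.
Qed.

End norm_hamiltonian.

(** * Comparison with smooth barriers *)

Section test_functions.
Variables (R : realType).
Notation V := 'rV[R]_1.
Implicit Types (phi : V * R -> R) (f g : R -> R) (p v : V * R).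

(** The derivative is carried along with [phi], so that the inequalities asked
    of a barrier can be checked on explicit formulas. *)
Definition C1_with phi (D : V * R -> V * R -> R) := forall p,
  differentiable phi p /\
  forall v, 'D_v phi p = D p v /\ {for p, continuous (fun q => D q v)}.

Definition functional (a b : R) p : R := a * p.1 0 0 + b * p.2.

Lemma functionalD a b p v : functional a b (p + v) = functional a b p + functional a b v.
Proof. by rewrite /functional /= mxE; ring. Qed.

Lemma functionalZ a b h p : functional a b (h *: p) = h * functional a b p.
Proof. by rewrite /functional /= mxE -[h *: p.2]/(h * p.2); ring. Qed.

Lemma functional_le a b p : `|functional a b p| <= (`|a| + `|b|) * `|p|.
Proof.
have p1 : `|p.1 0 0| <= `|p|.
  by apply: le_trans (coord_le_norm _ _) _; rewrite -[`|p|]/(Num.max _ _) le_max lexx.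
have p2 : `|p.2| <= `|p| by rewrite -[`|p|]/(Num.max _ _) le_max lexx orbT.
rewrite mulrDl; apply: (le_trans (ler_normD _ _)).
by rewrite !normrM lerD// ler_wpM2l.
Qed.

Lemma functional_continuous a b : continuous (functional a b).
Proof.
move=> p; apply/cvgrPdist_lt => e e0; pose c := `|a| + `|b| + 1.
have c0 : 0 < c by rewrite ltr_wpDl// addr_ge0.
suff : nbhs (p : V * R) [set q | `|functional a b p - functional a b q| < e] by [].
apply/nbhs_ballP; exists (e / c) => /=; first by rewrite divr_gt0.
move=> q; rewrite -ball_normE /=; rewrite ltr_pdivlMr// => pq.
have -> : functional a b p - functional a b q = functional a b (p - q).
  by rewrite functionalD -[- q]scaleN1r functionalZ mulN1r.
apply: (le_lt_trans (functional_le a b _)); apply: le_lt_trans pq.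
by rewrite mulrC ler_wpM2l// lerDl.
Qed.

Lemma functional_differentiable a b p : differentiable (functional a b) p.
Proof.
have @L : {linear (V * R)%type -> R}.
  exists (functional a b); do 2![eexists]; do ?[constructor].
  - by rewrite /functional mxE !mulr0 addr0.
  - by move=> x y; rewrite functionalD.
  - by move=> h x; rewrite functionalZ.
rewrite (_ : functional a b = L)//; apply: linear_differentiable.
exact: functional_continuous.
Qed.

(** All barriers below are sums of functions of one linear combination of space
    and time. *)
Lemma ridge_C1 a b c f g : quadratic_remainder f g ->
  C1_with (fun p => f (functional a b p + c))
    (fun p v => functional a b v * g (functional a b p + c)).
Proof.
move=> fg p; split.
  apply: (@differentiable_comp _ _ _ _ (fun p => functional a b p + c) f).
    apply: (@differentiableD _ _ _ (functional a b) (cst c)) => //.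
    exact: functional_differentiable.
  apply/derivable1_diffP.
  by have [] := quadratic_remainder_derive (functional a b p + c) fg.
move=> v; split.
  have h := quadratic_remainder_derive 0
    (quadratic_remainder_affine (functional a b v) (functional a b p + c) fg).
  have := @derive_val _ _ _ _ _ _ _ h; rewrite mulr0 add0r => <-.
  rewrite /derive; set F1 := fun h => h^-1 *: _; set F2 := fun h => h^-1 *: _.
  suff -> : F1 = F2 by [].
  apply/funext => t; rewrite /F1 /F2 /=.
  have -> : functional a b (t *: v + p) + c =
      functional a b v * (t *: 1 + 0) + (functional a b p + c).
    by rewrite functionalD functionalZ [t *: 1]mulr1; ring.
  by rewrite mulr0 add0r.
apply: cvgM; first exact: cvg_cst.
have gc := quadratic_remainder_continuous fg.
have lc : {for p, continuous (fun q => functional a b q + c)}.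
  exact: (cvgD (@functional_continuous a b p) (cvg_cst c)).
exact: (continuous_comp lc (gc _)).
Qed.

Lemma C1_withD phi D phi' D' : C1_with phi D -> C1_with phi' D' ->
  C1_with (fun p => phi p + phi' p) (fun p v => D p v + D' p v).
Proof.
move=> h h' p; have [d1 e1] := h p; have [d2 e2] := h' p; split.
  exact: differentiableD.
move=> v; have [<- c1] := e1 v; have [<- c2] := e2 v; split.
  by rewrite -deriveD//; apply: diff_derivable.
exact: cvgD.
Qed.

Lemma C1_with_on (A : set (V * R)) phi D : C1_with phi D -> C1_on A phi.
Proof.
move=> h p _; split; first by case: (h p).
move=> v; rewrite (_ : 'D_v phi = fun q => D q v); first by case: (h p) => _ /(_ v)[].
by apply/funext => q; case: (h q) => _ /(_ v)[].
Qed.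

Lemma quadratic_remainder_id : quadratic_remainder (fun t : R => t) (fun=> 1).
Proof.
exists 0 => // t h; rewrite mul0r (_ : _ - _ = 0) ?normr0//; ring.
Qed.

End test_functions.

Section barrier.
Variable R : realType.
Notation V := 'rV[R]_1.
Implicit Types (u phi : V * R -> R) (z : R -> R) (x y : V) (s t : R).

Let e1 : V := delta_mx 0 0.

Lemma functional_space (a b : R) : functional a b (e1, 0) = a.
Proof. by rewrite /functional /e1 /= mxE eqxx mulr1 mulr0 addr0. Qed.

Lemma functional_time (a b : R) : functional a b (0 : V, 1) = b.
Proof. by rewrite /functional /= mxE mulr0 mulr1 add0r. Qed.

Lemma norm_space_grad phi D p : C1_with phi D ->
  norm_ham (space_grad phi p) = `|D p (e1, 0)|.
Proof.
move=> h; rewrite /norm_ham norm_rV1 mxE; congr `|_|.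
by case: (h p) => _ /(_ (e1, 0))[].
Qed.

Lemma time_derivE phi D p : C1_with phi D -> time_deriv phi p = D p (0, 1).
Proof. by move=> h; case: (h p) => _ /(_ (0, 1))[]. Qed.

Lemma dsqr_pos_ge0 (w : R) : 0 <= dsqr_pos w.
Proof. by rewrite mulr_ge0// le_max lexx orbT. Qed.

(** A subsolution cannot cross a smooth coercive supersolution: add a small
    linear growth in time for strictness and a penalization after time [t] that
    keeps the maximum away from the end of the interval. *)
Lemma barrier_comparison u z phi D s t t1 c M m0 rho :
  viscosity_subsolution (@norm_ham R) z u -> 0 <= s -> s < t -> t < t1 ->
  (forall tau, s < tau -> tau < t1 -> (z^`())%classic tau <= c) ->
  BUC (@slab R 1 `[0, t1]) u ->
  (forall y tau, s <= tau <= t1 -> u (y, tau) <= M) ->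
  C1_with phi D ->
  (forall p, c * `|D p (e1, 0)| <= D p (0, 1)) ->
  (forall y, u (y, s) <= phi (y, s)) ->
  (forall y tau, s <= tau <= t1 -> m0 <= phi (y, tau)) ->
  (forall y tau, s <= tau <= t1 -> rho < `|y 0 0| -> M < phi (y, tau)) ->
  forall x, u (x, t) <= phi (x, t).
Proof.
move=> usub s0 st tt1 zc uB uM phiC1 phisup init phim0 coer x.
rewrite leNgt; apply/negP => gap.
pose gam := u (x, t) - phi (x, t).
have gam0 : 0 < gam by rewrite subr_gt0.
have T0 : 0 < t1 - s by lra.
(* the linear term makes the barrier a strict supersolution without closing the
   gap at time [t]; the quadratic term acts only after [t] and exceeds the
   largest possible gap at [t1] *)
pose e := gam / (2 * (t1 - s)).
have e0 : 0 < e by rewrite divr_gt0// mulr_gt0.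
have et : e * (t - s) < gam.
  rewrite /e mulrAC ltr_pdivrMr ?mulr_gt0// ltr_pM2l//; lra.
have d0 : 0 < t1 - t by lra.
pose K := (`|M - m0| + 1) / (t1 - t) ^+ 2.
have K0 : 0 < K by rewrite divr_gt0 ?exprn_gt0// ltr_wpDl.
pose psi p := phi p + (e * (functional 0 1 p + - s) + K * sqr_pos (functional 0 1 p + - t)).
have psiE y tau : psi (y, tau) = phi (y, tau) + e * (tau - s) + K * sqr_pos (tau - t).
  by rewrite /psi /functional /= !mul0r !mul1r !add0r addrA.
have psiC1 := C1_withD phiC1 (C1_withD
  (ridge_C1 0 1 (- s) (quadratic_remainderZ e (quadratic_remainder_id R)))
  (ridge_C1 0 1 (- t) (quadratic_remainderZ K (sqr_pos_remainder R)))).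
pose r' := rho + 1 + `|x 0 0|.
have [rho0|rho0] := ltP rho 0.
  have := coer x t; rewrite (ltW st) (ltW tt1) => /(_ isT).
  have : rho < `|x 0 0| by exact: lt_le_trans rho0 _.
  move=> h /(_ h); have := uM x t; rewrite (ltW st) (ltW tt1) => /(_ isT).
  by move: gap; lra.
pose A : set (V * R) := [set v : V | forall i, `[- r', r']%classic (v ord0 i)] `*` `[s, t1]%classic.
have cA : compact A.
  apply: compact_setX; last exact: segment_compact.
  by apply: (@rV_compact R 1 (fun=> `[- r', r']%classic)) => i; exact: segment_compact.
have xA : A (x, t).
  split=> /=; last by rewrite in_itv/= !ltW.
  move=> i; rewrite (ord1 i) in_itv/= -ler_norml /r'; lra.
have cont : {within A, continuous (u \- psi)}.
  apply/subspace_continuousP => p Ap; apply: cvgB.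
    apply/cvgrPdist_lt => eps eps0; have [r r0 hr] := BUC_unif uB eps0.
    rewrite near_withinE; apply/nbhs_ballP; exists r => //= q pq Aq.
    apply: hr => //; rewrite /slab /=; [case: Ap|case: Aq] => _ /=;
      by rewrite !in_itv/= => /andP[h1 h2]; rewrite h2 (le_trans s0 h1).
  apply: cvg_within_filter.
  by have [/differentiable_continuous] := psiC1 p; exact.
have [[y tau] /[!inE] -[/= yA tauA] ymax] := compact_EVT_max (ex_intro _ _ xA) cA cont.
rewrite in_itv/= in tauA; have /andP[stau taut1] := tauA.
have pos : 0 < u (y, tau) - psi (y, tau).
  apply: lt_le_trans (ymax (x, t) _); last by rewrite inE.
  rewrite /= psiE subrr /sqr_pos maxxx expr0n /= mulr0 addr0; rewrite /gam in et; lra.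
have etau : 0 <= e * (tau - s) by rewrite mulr_ge0 ?subr_ge0// ltW.
have Ktau : 0 <= K * sqr_pos (tau - t) by rewrite mulr_ge0 ?sqr_ge0// ltW.
rewrite psiE in pos.
have ytau := uM y tau tauA.
have stau' : s < tau.
  rewrite lt_neqAle stau andbT; apply/eqP => E.
  by have := init y; move: pos etau Ktau; rewrite -E; lra.
have taut1' : tau < t1.
  rewrite lt_neqAle taut1 andbT; apply/eqP => E.
  have KE : K * sqr_pos (tau - t) = `|M - m0| + 1.
    rewrite E /sqr_pos max_l; last exact: ltW.
    by rewrite /K divfK// expf_neq0// gt_eqF.
  by have := phim0 y tau tauA; have := ler_norm (M - m0); lra.
have yrho : `|y 0 0| <= rho.
  by rewrite leNgt; apply/negP => /(coer y tau tauA); lra.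
have lm : local_max (u \- psi) (y, tau).
  apply/nbhs_ballP; exists (Num.min 1 (Num.min (tau - s) (t1 - tau))) => /=.
    by rewrite !lt_min ltr01 !subr_gt0 stau' taut1'.
  move=> [y' tau'] /ball_pairE; rewrite !lt_min => -[/and3P[h1 _ _] /and3P[_ h2 h3]].
  apply: (ymax (y', tau')); rewrite inE; split=> /=; last first.
    by rewrite in_itv/=; move: h2 h3; rewrite !ltr_norml => /andP[? ?] /andP[? ?]; apply/andP; split; lra.
  move=> i; rewrite (ord1 i) in_itv/= -ler_norml /r'.
  have := coord_le_norm (y - y') 0; rewrite !mxE => h4.
  have := ler_distD (y 0 0) (y' 0 0) 0; rewrite !subr0 distrC => h5.
  have := normr_ge0 (x 0 0); lra.
have psi_on : C1_on (slab `]0, +oo[) psi.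
  exact: (@C1_with_on R (slab `]0, +oo[) psi _ psiC1).
have := usub psi psi_on (y, tau) (le_lt_trans s0 stau') lm.
rewrite (norm_space_grad _ psiC1) (time_derivE _ psiC1) /=.
rewrite !functional_space !functional_time !mul0r !addr0 !mul1r mulr1.
set dp := D _ (e1, 0); set dt := D _ (0, 1) => h.
have h1 : `|dp| * (z^`())%classic tau <= `|dp| * c by rewrite ler_wpM2l// zc.
have h2 : c * `|dp| <= dt := phisup (y, tau).
have h3 : 0 <= K * dsqr_pos (functional 0 1 (y, tau) - t).
  by rewrite mulr_ge0 ?dsqr_pos_ge0// ltW.
lra.
Qed.

Section fixed_solution.
Variables (u : V * R -> R) (z : R -> R) (s t t1 c : R).
Hypotheses (usub : viscosity_subsolution (@norm_ham R) z u) (s0 : 0 <= s)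
  (st : s < t) (tt1 : t < t1)
  (zc : forall tau, s < tau -> tau < t1 -> (z^`())%classic tau <= c)
  (uB : BUC (@slab R 1 `[0, t1]) u).

Let uM : exists2 M, 0 <= M & forall y tau, s <= tau <= t1 -> `|u (y, tau)| <= M.
Proof.
have [M hM] := BUC_bounded uB.
have hs y tau : s <= tau <= t1 -> `|u (y, tau)| <= M.
  move=> /andP[a b]; apply: hM; rewrite /slab /= in_itv/= b andbT; exact: le_trans a.
exists M => //; apply: le_trans (hs 0 s _) => //.
by rewrite lexx (ltW (lt_trans st tt1)).
Qed.

Let us_unif e : 0 < e -> exists2 r, 0 < r & forall x y, `|x 0 0 - y 0 0| < r ->
  `|u (x, s) - u (y, s)| < e.
Proof.
move=> e0; have [r r0 hr] := BUC_unif uB e0; exists r => // x y xy.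
have s1 : `[0, t1]%classic s by rewrite /= in_itv/= s0 (ltW (lt_trans st tt1)).
apply: hr => //; apply/ball_pairE; rewrite subrr normr0; split=> //.
by rewrite norm_rV1 !mxE.
Qed.

(** Finite speed of propagation when the path goes up: the barrier is constant
    on the cone of dependence of [(x, t)] and rises quadratically outside,
    steeply enough to dominate the modulus of continuity of the initial value. *)
Lemma comparison_up x m : 0 <= c ->
  (forall y, `|y 0 0 - x 0 0| <= c * (t - s) -> u (y, s) <= m) -> u (x, t) <= m.
Proof.
move=> c0 hm; have st' := st; have tt1' := tt1; apply/ler_addgt0Pr => e e0.
have [M M0 hM] := uM; have [r r0 hr] := us_unif e0.
pose rho0 := c * (t - s); have rho00 : 0 <= rho0 by rewrite mulr_ge0//; lra.
pose K := (`|m| + M + 1) / r ^+ 2.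
have K0 : 0 < K by rewrite divr_gt0 ?exprn_gt0// ltr_wpDl// addr_ge0.
have Kr : K * r ^+ 2 = `|m| + M + 1 by rewrite /K divfK// expf_neq0// gt_eqF.
have KP w : r <= w -> `|m| + M + 1 <= K * sqr_pos w.
  move=> rw; rewrite -Kr ler_pM2l// /sqr_pos max_l; last lra.
  by rewrite ler_sqr ?nnegrE//; lra.
have P0 w : 0 <= K * sqr_pos w by rewrite mulr_ge0 ?sqr_ge0// ltW.
pose b1 := - x 0 0 - c * s - rho0; pose b2 := x 0 0 - c * s - rho0.
pose phi p := (m + e) + (K * sqr_pos (functional 1 c p + b1) + K * sqr_pos (functional (-1) c p + b2)).
have phiE y tau : phi (y, tau) = m + e + (K * sqr_pos (y 0 0 - x 0 0 + c * (tau - s) - rho0)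
    + K * sqr_pos (x 0 0 - y 0 0 + c * (tau - s) - rho0)).
  rewrite /phi /functional /b1 /b2 /=; congr (_ + (K * sqr_pos _ + K * sqr_pos _)); ring.
have phiC1 := C1_withD (ridge_C1 0 0 0 (quadratic_remainder_cst (m + e))) (C1_withD
  (ridge_C1 1 c b1 (quadratic_remainderZ K (sqr_pos_remainder R)))
  (ridge_C1 (-1) c b2 (quadratic_remainderZ K (sqr_pos_remainder R)))).
have nm := ler_norm (- m); rewrite normrN in nm.
have big y tau : s <= tau -> rho0 + r <= `|y 0 0 - x 0 0| -> M < phi (y, tau).
  move=> stau hy; rewrite phiE.
  have ct : 0 <= c * (tau - s) by rewrite mulr_ge0// subr_ge0.
  have a1 := P0 (y 0 0 - x 0 0 + c * (tau - s) - rho0).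
  have a2 := P0 (x 0 0 - y 0 0 + c * (tau - s) - rho0).
  have [yx|xy] := leP 0 (y 0 0 - x 0 0).
    rewrite ger0_norm// in hy.
    have := @KP (y 0 0 - x 0 0 + c * (tau - s) - rho0); lra.
  rewrite ltr0_norm// in hy.
  have := @KP (x 0 0 - y 0 0 + c * (tau - s) - rho0); lra.
have at_x : phi (x, t) = m + e.
  by rewrite phiE subrr add0r /rho0 subrr /sqr_pos maxxx expr0n /= mulr0 !addr0.
rewrite -at_x.
apply: (barrier_comparison (phi := phi) (c := c) (M := M) (m0 := m + e) (rho := `|x 0 0| + rho0 + r) usub s0 st tt1 zc uB _ phiC1).
- by move=> y tau htau; apply: le_trans (ler_norm _) (hM y tau htau).
- move=> p; rewrite !functional_space !functional_time !mul0r !add0r !mul1r !mulN1r.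
  have dP w : 0 <= K * dsqr_pos w by rewrite mulr_ge0 ?dsqr_pos_ge0// ltW.
  set d1 := K * _; set d2 := K * _.
  have d10 : 0 <= d1 by exact: dP.
  have d20 : 0 <= d2 by exact: dP.
  rewrite -mulrDr ler_wpM2l//; rewrite ler_norml; apply/andP; split; lra.
- move=> y; have [hy|hy] := leP `|y 0 0 - x 0 0| rho0.
    have := hm y hy; rewrite phiE.
    have a1 := P0 (y 0 0 - x 0 0 + c * (s - s) - rho0).
    have a2 := P0 (x 0 0 - y 0 0 + c * (s - s) - rho0); lra.
  have [hy2|hy2] := ltP `|y 0 0 - x 0 0| (rho0 + r); last first.
    apply/ltW/(le_lt_trans _ (big y s (lexx _) hy2)).
    by apply: le_trans (ler_norm _) (hM _ _ _); rewrite lexx (ltW (lt_trans st tt1)).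
  (* the nearest point of the interval of dependence *)
  pose v := (if 0 <= y 0 0 - x 0 0 then rho0 else - rho0) + x 0 0.
  pose y' : V := const_mx v.
  have y'x : `|y' 0 0 - x 0 0| <= rho0.
    by rewrite mxE /v addrK; case: ifP; rewrite ?normrN ger0_norm.
  have y'y : `|y 0 0 - y' 0 0| < r.
    rewrite mxE /v; case: ifPn => [h|]; last rewrite -ltNge => h.
      by rewrite ger0_norm// in hy hy2; rewrite ger0_norm; lra.
    by rewrite ltr0_norm// in hy hy2; rewrite ltr0_norm; lra.
  have := hm y' y'x; have := hr y y' y'y; rewrite phiE ltr_norml => /andP[_ h2] h3.
  have a1 := P0 (y 0 0 - x 0 0 + c * (s - s) - rho0).
  have a2 := P0 (x 0 0 - y 0 0 + c * (s - s) - rho0); lra.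
- move=> y tau _; rewrite phiE.
  have a1 := P0 (y 0 0 - x 0 0 + c * (tau - s) - rho0).
  have a2 := P0 (x 0 0 - y 0 0 + c * (tau - s) - rho0); lra.
- move=> y tau /andP[stau _] hy; apply: big => //.
  have := ler_distD (x 0 0) (y 0 0) 0; rewrite !subr0; lra.
Qed.

(** When the path goes down the solution at [(x, t)] lies below all the initial
    values in the interval of dependence: the barriers are parabolas that move
    with an admissible velocity. *)
Lemma comparison_down x y0 : c <= 0 -> `|y0 0 0 - x 0 0| <= - c * (t - s) ->
  u (x, t) <= u (y0, s).
Proof.
move=> c0 hy0; have st' := st; have tt1' := tt1; apply/ler_addgt0Pr => e e0.
have [M M0 hM] := uM; have [r r0 hr] := us_unif e0.
have ts0 : 0 < t - s by lra.
pose v := (x 0 0 - y0 0 0) / (t - s).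
have vc : `|v| <= - c.
  by rewrite normrM normfV (gtr0_norm ts0) ler_pdivrMr// distrC.
pose K := (2 * M + 1) / r ^+ 2.
have K0 : 0 < K by rewrite divr_gt0 ?exprn_gt0//; lra.
have Kr : K * r ^+ 2 = 2 * M + 1 by rewrite /K divfK// expf_neq0// gt_eqF.
have sq : quadratic_remainder (fun w : R => w ^+ 2) (fun w => 2 * w).
  exists 1 => // w h; rewrite mul1r (_ : _ - _ = h ^+ 2); last by ring.
  by rewrite ger0_norm ?sqr_ge0.
pose b := v * s - y0 0 0.
pose m := u (y0, s).
pose phi p := (m + e) + K * (functional 1 (- v) p + b) ^+ 2.
have phiE y tau : phi (y, tau) = m + e + K * (y 0 0 - (y0 0 0 + v * (tau - s))) ^+ 2.
  by rewrite /phi /functional /b /=; congr (_ + K * _ ^+ 2); ring.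
have phiC1 := C1_withD (ridge_C1 0 0 0 (quadratic_remainder_cst (m + e)))
  (ridge_C1 1 (- v) b (quadratic_remainderZ K sq)).
have P0 w : 0 <= K * w ^+ 2 by rewrite mulr_ge0 ?sqr_ge0// ltW.
have ss1 : s <= s <= t1 by rewrite lexx (ltW (lt_trans st tt1)).
have mM := hM y0 s ss1; rewrite -/m ler_norml in mM.
have big y tau : r <= `|y 0 0 - (y0 0 0 + v * (tau - s))| -> M < phi (y, tau).
  move=> hy; rewrite phiE; have : K * r ^+ 2 <= K * (y 0 0 - (y0 0 0 + v * (tau - s))) ^+ 2.
    rewrite ler_pM2l// -[leRHS](real_normK (num_real _)) ler_sqr ?nnegrE//; exact: ltW.
  by rewrite Kr; case/andP: mM; lra.
have at_x : phi (x, t) = m + e.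
  rewrite phiE /v divfK ?gt_eqF// (_ : _ - _ = 0) ?expr0n ?mulr0 ?addr0//; ring.
rewrite -/m -at_x.
apply: (barrier_comparison (phi := phi) (c := c) (M := M) (m0 := m + e)
  (rho := `|y0 0 0| + `|v| * (t1 - s) + r) usub s0 st tt1 zc uB _ phiC1).
- by move=> y tau htau; apply: le_trans (ler_norm _) (hM y tau htau).
- move=> p; rewrite !functional_space !functional_time !mul0r !add0r !mul1r.
  set w := K * _.
  have h1 : v * w <= `|v| * `|w| by rewrite -normrM ler_norm.
  have h2 : `|v| * `|w| <= - c * `|w| by rewrite ler_wpM2r.
  lra.
- move=> y; have [hy|hy] := ltP `|y 0 0 - y0 0 0| r; last first.
    have hy' : r <= `|y 0 0 - (y0 0 0 + v * (s - s))| by rewrite subrr mulr0 addr0.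
    apply/ltW/(le_lt_trans _ (big y s hy')).
    exact: le_trans (ler_norm _) (hM _ _ ss1).
  have := hr y y0 hy; rewrite -/m ltr_norml phiE => /andP[_ h2].
  have := P0 (y 0 0 - (y0 0 0 + v * (s - s))); lra.
- by move=> y tau _; rewrite phiE; have := P0 (y 0 0 - (y0 0 0 + v * (tau - s))); lra.
- move=> y tau /andP[stau taut1] hy; apply: big.
  have h1 : `|v * (tau - s)| <= `|v| * (t1 - s).
    by rewrite normrM ler_wpM2l// ger0_norm ?subr_ge0//; lra.
  have := ler_normD (y 0 0 - (y0 0 0 + v * (tau - s))) (y0 0 0 + v * (tau - s)).
  have := ler_normD (y0 0 0) (v * (tau - s)); rewrite subrK; lra.
Qed.

End fixed_solution.

End barrier.

(** * Stability under uniform perturbations of the path *)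

Section stability.
Variable R : realType.
Notation V := 'rV[R]_1.
Implicit Types (u v : V * R -> R) (z eta : R -> R) (x y : V) (s t T : R).

Lemma tent1_range x : 0 <= tent1 x <= 2^-1.
Proof. by rewrite tent_ge0 tent_le_half. Qed.

Lemma reflected_step_ge_tent x y a : 0 <= a -> `|y 0 0 - x 0 0| <= a ->
  tent1 y <= reflected_step a (tent1 x).
Proof.
move=> a0 yx; have := tent_lipschitz (x 0 0) (y 0 0); rewrite -/(tent1 x) -/(tent1 y).
have /andP[? ?] := tent1_range y.
by case: (reflected_step_cases a (tent1 x)) => -[-> h1]; lra.
Qed.

Lemma reflected_step_le_tent x y a : a <= 0 -> `|y 0 0 - x 0 0| <= - a ->
  reflected_step a (tent1 x) <= tent1 y.
Proof.
move=> a0 yx; have := tent_lipschitz (y 0 0) (x 0 0); rewrite -/(tent1 x) -/(tent1 y) distrC.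
have /andP[? ?] := tent1_range y; have /andP[? ?] := tent1_range x.
by case: (reflected_step_cases a (tent1 x)) => -[-> h1]; lra.
Qed.

Lemma reflected_step_attained x a : exists2 y, tent1 y = reflected_step a (tent1 x) &
  `|y 0 0 - x 0 0| <= `|a|.
Proof.
have [y0 ty yx] := tent_ray (x 0 0) (reflected_step_range a (tent1 x)).
exists (const_mx y0); first by rewrite /tent1 mxE.
rewrite mxE yx -/(tent1 x); have /andP[? ?] := tent1_range x.
have := ler_norm a; have := ler_norm (- a); rewrite normrN => h1 h2.
by case: (reflected_step_cases a (tent1 x)) => -[-> h3]; rewrite ler_norml; apply/andP; split; lra.
Qed.

(** When the bound [c] on the speed is nonnegative, the value at [(x, t)] is
    bounded by the supremum over an interval of dependence, and otherwise by
    each of the values there; on functions of [tent] both bounds are given by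
    [reflected_step]. *)
Lemma tent_step_upper u z s t t1 c g kappa : {homo g : r r' / r <= r'} ->
  viscosity_subsolution (@norm_ham R) z u -> 0 <= s -> s < t -> t < t1 ->
  (forall tau, s < tau -> tau < t1 -> (z^`())%classic tau <= c) ->
  BUC (@slab R 1 `[0, t1]) u ->
  (forall y, u (y, s) <= g (tent1 y) + kappa) ->
  forall x, u (x, t) <= g (reflected_step (c * (t - s)) (tent1 x)) + kappa.
Proof.
move=> gm usub s0 st tt1 zc uB us x.
have ts0 : 0 <= t - s by lra.
have [c0|c0] := leP 0 c.
  apply: (comparison_up usub s0 st tt1 zc uB c0) => y hy; apply: (le_trans (us y)).
  by rewrite lerD2r gm// reflected_step_ge_tent// mulr_ge0.
have [y <- yx] := reflected_step_attained x (c * (t - s)).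
apply: le_trans (us y); apply: (comparison_down usub s0 st tt1 zc uB); first exact: ltW.
have a0 : c * (t - s) <= 0 by rewrite mulr_le0_ge0// ltW.
by rewrite mulNr -(ler0_norm a0).
Qed.

Lemma supersolutionN u z : (forall t, 0 < t -> derivable z t 1) ->
  viscosity_supersolution (@norm_ham R) z u ->
  viscosity_subsolution (@norm_ham R) (fun t => - z t) (fun p => - u p).
Proof.
move=> dz usup phi phiC1 p p0 lm.
have pA : slab `]0, +oo[ p by rewrite /slab /= in_itv/= p0.
have dphi : differentiable phi p by case: (phiC1 p pA).
have nphiC1 : C1_on (slab `]0, +oo[) (fun q => - phi q).
  move=> q qA; have [dq cq] := phiC1 q qA; split; first exact: differentiableN.
  move=> w.
  have E : {near q, 'D_w (fun q => - phi q) =1 (fun q => - 'D_w phi q)}.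
    have [q0] : 0 < q.2 by move: qA; rewrite /slab /= in_itv/= andbT.
    apply/nbhs_ballP; exists q.2 => //= q' qq'.
    have q'A : slab `]0, +oo[ q'.
      rewrite /slab /= in_itv/= andbT; case: q q' qq' {qA dq cq} q0 => [y t] [y' t'] /= /ball_pairE[_].
      by rewrite ltr_norml => /andP[_ ?] _; lra.
    rewrite deriveN//; apply: diff_derivable.
    by case: (phiC1 q' q'A).
  have cN : {for q, continuous (fun q => - 'D_w phi q)} by apply: continuousN; exact: cq.
  have Eq := nbhs_singleton E.
  rewrite /prop_for /continuous_at Eq.
  apply: cvg_trans cN; apply: near_eq_cvg.
  by apply: filterS E => q' ->.
have := usup _ nphiC1 p p0.
rewrite space_gradN// time_derivN// /norm_ham normrN => h.
have h' : local_min (u \- (fun q => - phi q)) p.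
  by apply: filterS lm => q /=; lra.
have := h h'; rewrite derive1E [in X in _ -> X]derive1E deriveN; last exact: dz.
lra.
Qed.

Lemma BUCN (X : pseudoMetricType R) (A : set X) (f : X -> R) : BUC A f ->
  BUC A (fun p => - f p).
Proof.
move=> fB; have [M hM] := BUC_bounded fB.
apply: (@BUC_of _ _ _ _ M) => [p Ap|e e0]; first by rewrite normrN hM.
have [r r0 hr] := BUC_unif fB e0; exists r => // p q Ap Aq pq.
by rewrite -opprD normrN hr.
Qed.

Lemma tent_step_lower u z s t t1 c g kappa : {homo g : r r' / r <= r'} ->
  (forall t, 0 < t -> derivable z t 1) ->
  viscosity_supersolution (@norm_ham R) z u -> 0 <= s -> s < t -> t < t1 ->
  (forall tau, s < tau -> tau < t1 -> c <= (z^`())%classic tau) ->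
  BUC (@slab R 1 `[0, t1]) u ->
  (forall y, g (tent1 y) - kappa <= u (y, s)) ->
  forall x, g (reflected_step (c * (t - s)) (tent1 x)) - kappa <= u (x, t).
Proof.
move=> gm dz usup s0 st tt1 zc uB us x.
have ts0 : 0 <= t - s by lra.
have vsub := supersolutionN dz usup.
have vB := BUCN uB.
have zc' tau : s < tau -> tau < t1 -> ((fun t => - z t)^`())%classic tau <= - c.
  move=> st' tt'; rewrite derive1E deriveN; last by apply: dz; exact: le_lt_trans st'.
  by have := zc tau st' tt'; rewrite derive1E lerN2.
rewrite -lerN2; have [c0|c0] := leP c 0.
  have nc0 : 0 <= - c by lra.
  apply: (comparison_up vsub s0 st tt1 zc' vB nc0) => y hy; rewrite lerN2.
  apply: le_trans (us y); rewrite lerD2r gm// reflected_step_le_tent ?mulr_le0_ge0//.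
  by rewrite -mulNr.
have [y <- yx] := reflected_step_attained x (c * (t - s)).
apply: le_trans (_ : - u (y, s) <= _); last by rewrite lerN2.
apply: (comparison_down vsub s0 st tt1 zc' vB); first by rewrite oppr_le0 ltW.
have a0 : 0 <= c * (t - s) by rewrite mulr_ge0// ltW.
by rewrite opprK -(ger0_norm a0).
Qed.

(** Two time steps, because comparison up to the end of a step needs a bound on
    the speed slightly beyond it. *)
Definition speed_oscillation z T h om := forall tau tau',
  0 < tau < T + h -> 0 < tau' < T + h -> `|tau - tau'| < 2 * h ->
  (z^`())%classic tau <= (z^`())%classic tau' + om.

Lemma C1_derivable z t : C1_path z -> 0 < t -> derivable z t 1.
Proof. by move=> [_ [g [_ dg]]] t0; have [] := dg t t0. Qed.

Lemma C1_speed_oscillation z T om : C1_path z -> 0 < om ->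
  exists2 h0, 0 < h0 & forall h, 0 < h -> h < h0 -> speed_oscillation z T h om.
Proof.
move=> [_ [g [gc dg]]] om0; have [r r0 hr] := heine (T + 1) gc om0.
exists (Num.min 1 (r / 2)); first by rewrite lt_min ltr01 divr_gt0.
move=> h h0; rewrite lt_min => /andP[h1 hr2] tau tau' /andP[a a'] /andP[b b'] ab.
rewrite !derive1E (@derive_val _ _ _ _ _ _ _ (dg tau a)) (@derive_val _ _ _ _ _ _ _ (dg tau' b)).
have : `|g tau - g tau'| < om by apply: hr; [apply/andP; split; lra|apply/andP; split; lra|lra].
by rewrite ltr_norml; lra.
Qed.

Lemma C1_mvt z s t : C1_path z -> 0 <= s -> s < t ->
  exists2 xi, s < xi < t & z t - z s = (z^`())%classic xi * (t - s).
Proof.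
move=> zC1 s0 st; have [[_ zc] [g [_ dg]]] := zC1.
have [||xi] := @MVT R z g s t st.
- by move=> x; rewrite in_itv/= => /andP[sx _]; apply: dg; exact: le_lt_trans sx.
- apply: continuous_subspaceW zc => x /=; rewrite !in_itv/= andbT => /andP[sx _].
  exact: le_trans sx.
rewrite in_itv/= => sxi ->; exists xi => //.
have xi0 : 0 < xi by case/andP: sxi => sx _; exact: le_lt_trans sx.
by rewrite derive1E (@derive_val _ _ _ _ _ _ _ (dg xi xi0)).
Qed.

Section flow_bounds.
Variables (u : V * R -> R) (z : R -> R) (u0 : V -> R) (kappa T om h : R) (n : nat).
Hypotheses (zC1 : C1_path z) (uS : viscosity_solution (@norm_ham R) z u0 u)
  (h0 : 0 < h) (hT : n%:R * h = T) (osc : speed_oscillation z T h om).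

Let times k : (k < n)%N -> [/\ 0 <= k%:R * h, k%:R * h < k.+1%:R * h,
  k.+1%:R * h < k.+2%:R * h, k.+1%:R * h - k%:R * h = h & k.+2%:R * h <= T + h].
Proof.
move=> kn; have hh := h0; split.
- by rewrite mulr_ge0// ltW.
- by rewrite ltr_pM2r// ltr_nat.
- by rewrite ltr_pM2r// ltr_nat.
- by rewrite -natr1; ring.
- by rewrite -hT -[k.+2%:R]natr1 mulrDl mul1r lerD2r ler_pM2r// ler_nat.
Qed.

Let uB k : BUC (@slab R 1 `[0, k.+2%:R * h]) u.
Proof. by case: uS => + _ _ _; apply; rewrite mulr_gt0. Qed.

Let speed k xi tau : (k < n)%N -> k%:R * h < xi < k.+1%:R * h ->
  k%:R * h < tau -> tau < k.+2%:R * h ->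
  (z^`())%classic tau <= (z^`())%classic xi + om /\
  (z^`())%classic xi <= (z^`())%classic tau + om.
Proof.
move=> kn /andP[x1 x2] t1 t2; have [a b c d e] := times kn.
have e2 : k.+2%:R * h = k%:R * h + 2 * h by rewrite -[k.+2%:R]natr1 -[k.+1%:R]natr1; ring.
rewrite e2 in t2 e; have hh := h0.
have X : 0 < xi < T + h by apply/andP; split; lra.
have Y : 0 < tau < T + h by apply/andP; split; lra.
have Z : `|tau - xi| < 2 * h by rewrite ltr_norml; apply/andP; split; lra.
by split; apply: osc => //; rewrite distrC.
Qed.

(** Over each step the speed is replaced by the mean speed plus [om]; the
    driving path of the flow is therefore [z] with an additional drift [om]. *)
Lemma flow_upper : (forall x, u0 x <= tent1 x + kappa) -> forall k, (k <= n)%N -> forall x,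
  u (x, k%:R * h) <=
  reflected_flow (fun j => z (j%:R * h) + j%:R * h * om) k (tent1 x) + kappa.
Proof.
case: uS => _ u_init usub _ u0k; elim=> [_ x|k IH kn x].
  by rewrite mul0r u_init; exact: u0k.
have [a b c d e] := times kn.
have [xi xiP zxi] := C1_mvt zC1 a b; rewrite d in zxi.
have zc tau : k%:R * h < tau -> tau < k.+2%:R * h ->
    (z^`())%classic tau <= (z^`())%classic xi + om.
  by move=> t1 t2; case: (speed kn xiP t1 t2).
have := tent_step_upper (g := reflected_flow (fun j => z (j%:R * h) + j%:R * h * om) k)
  (@reflected_flow_mono _ _ _) usub a b c zc (uB k) (IH (ltnW kn)) x.
rewrite d; set c1 := (_ + om) * h => /=.
suff -> : z (k.+1%:R * h) + k.+1%:R * h * om - (z (k%:R * h) + k%:R * h * om) = c1 by [].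
rewrite /c1 mulrDl -zxi -[in k.+1%:R * h * om]natr1; ring.
Qed.

Lemma flow_lower : (forall x, tent1 x - kappa <= u0 x) -> forall k, (k <= n)%N -> forall x,
  reflected_flow (fun j => z (j%:R * h) - j%:R * h * om) k (tent1 x) - kappa <=
  u (x, k%:R * h).
Proof.
case: uS => _ u_init _ usup u0k; elim=> [_ x|k IH kn x].
  by rewrite mul0r u_init; exact: u0k.
have [a b c d e] := times kn.
have [xi xiP zxi] := C1_mvt zC1 a b; rewrite d in zxi.
have zc tau : k%:R * h < tau -> tau < k.+2%:R * h ->
    (z^`())%classic xi - om <= (z^`())%classic tau.
  by move=> t1 t2; case: (speed kn xiP t1 t2); lra.
have dz t : 0 < t -> derivable z t 1 by exact: C1_derivable.
have := tent_step_lower (g := reflected_flow (fun j => z (j%:R * h) - j%:R * h * om) k)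
  (@reflected_flow_mono _ _ _) dz usup a b c zc (uB k) (IH (ltnW kn)) x.
rewrite d; set c1 := (_ - om) * h => /=.
suff -> : z (k.+1%:R * h) - k.+1%:R * h * om - (z (k%:R * h) - k%:R * h * om) = c1 by [].
rewrite /c1 mulrBl -zxi -[in k.+1%:R * h * om]natr1; ring.
Qed.

End flow_bounds.

(** Both solutions are squeezed by reflected flows of discretized paths, which
    depend on the path in a Lipschitz way. *)
Lemma viscosity_stability u v z eta (u0 v0 : V -> R) (kappa kappa' delta T : R) :
  C1_path z -> C1_path eta ->
  viscosity_solution (@norm_ham R) z u0 u -> viscosity_solution (@norm_ham R) eta v0 v ->
  (forall x, u0 x <= tent1 x + kappa) -> (forall x, tent1 x - kappa' <= v0 x) ->
  0 <= T -> (forall tau, 0 <= tau <= T -> z tau - eta tau <= delta) ->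
  forall x, u (x, T) <= v (x, T) + delta + kappa + kappa'.
Proof.
move=> zC1 etaC1 uS vS u0k v0k T0 zeta x.
have [[z00 _] _] := zC1; have [[eta00 _] _] := etaC1.
move: T0; rewrite le_eqVlt => /orP[/eqP E|T0].
  have := zeta 0; rewrite -E lexx z00 eta00 subrr => /(_ isT).
  case: uS vS => _ -> _ _ [_ -> _ _].
  by have := u0k x; have := v0k x; lra.
apply/ler_addgt0Pr => e e0.
pose om := e / (2 * T); have om0 : 0 < om by rewrite divr_gt0// mulr_gt0.
have [h1 h10 osc1] := C1_speed_oscillation T zC1 om0.
have [h2 h20 osc2] := C1_speed_oscillation T etaC1 om0.
pose h3 := Num.min h1 h2; have h30 : 0 < h3 by rewrite lt_min h10.
pose n := (Num.truncn (T / h3)).+1; have n0 : 0 < n%:R :> R by rewrite ltr0n.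
pose h := T / n%:R; have h0 : 0 < h by rewrite divr_gt0.
have hT : n%:R * h = T by rewrite /h mulrCA divff ?mulr1// gt_eqF.
have hh3 : h < h3.
  by rewrite /h ltr_pdivrMr// mulrC -ltr_pdivrMr// truncnS_gt.
have [hh1 hh2] : h < h1 /\ h < h2 by move: hh3; rewrite lt_min => /andP[].
have U := flow_upper zC1 uS h0 hT (osc1 h h0 hh1) u0k (leqnn n) x.
have L := flow_lower etaC1 vS h0 hT (osc2 h h0 hh2) v0k (leqnn n) x.
rewrite hT in U L.
have jT j : (j <= n)%N -> 0 <= j%:R * h <= T.
  by move=> jn; rewrite mulr_ge0 ?(ltW h0)//= -hT ler_pM2r// ler_nat.
have Tom : 2 * (T * om) = e by rewrite /om; field; rewrite gt_eqF.
have AB j : (j <= n)%N ->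
    z (j%:R * h) + j%:R * h * om - (eta (j%:R * h) - j%:R * h * om) <= delta + e.
  move=> jn; have /andP[j0 jT'] := jT j jn; have := zeta _ (jT j jn).
  have : j%:R * h * om <= T * om by rewrite ler_pM2r.
  lra.
have := reflected_flow_cmp (s := tent1 x) (s' := tent1 x) AB.
rewrite subrr add0r => /(_ (AB n (leqnn n))).
rewrite !mul0r z00 eta00 !subrr !addr0; lra.
Qed.

End stability.

(** * The pathwise solution started from the distance to the integers *)

Section tent_solution.
Variables (R : realType) (z : R -> R).
Notation V := 'rV[R]_1.
Hypothesis zC : C0_path z.
Implicit Types (x y : V) (s t T : R).

Notation appr := (approximation (@norm_ham R) z (@tent1 R)).
Let hH := @norm_hamiltonian R.
Let u0B := @tent1_BUC R.

Definition tent_solution (p : V * R) : R := limn (fun n => appr n p).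

Lemma stability_to_approximation (eta : R -> R) (v0 : V -> R) (v : V * R -> R) m
    (kappa delta T : R) : C1_path eta -> viscosity_solution (@norm_ham R) eta v0 v ->
  (forall x, `|v0 x - tent1 x| <= kappa) -> 0 <= T ->
  (forall t, 0 <= t <= T -> `|eta t - smooth_path z m t| <= delta) ->
  forall x t, 0 <= t <= T -> `|v (x, t) - appr m (x, t)| <= delta + kappa.
Proof.
move=> etaC1 vS v0k T0 etaz x t /andP[t0 tT].
have aS := approximation_solution z hH u0B m.
have zC1 := smooth_path_C1 z m.
have hk x' : v0 x' <= tent1 x' + kappa /\ tent1 x' - kappa <= v0 x'.
  by have := v0k x'; rewrite ler_norml => /andP[? ?]; split; lra.
have hd tau : 0 <= tau <= t -> `|eta tau - smooth_path z m tau| <= delta.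
  by move=> /andP[a b]; apply: etaz; rewrite a (le_trans b).
have := viscosity_stability (kappa := kappa) (kappa' := 0) (delta := delta) etaC1 zC1 vS aS
  (fun x' => (hk x').1) (fun x' => _) t0 _ x.
have := viscosity_stability (kappa := 0) (kappa' := kappa) (delta := delta) zC1 etaC1 aS vS
  (fun x' => _) (fun x' => (hk x').2) t0 _ x.
rewrite addr0 => h1 h2; rewrite ler_norml; apply/andP; split.
  suff : appr m (x, t) <= v (x, t) + delta + kappa by lra.
  apply: h1 => [x'|tau /hd]; first by rewrite addr0.
  by rewrite ler_norml => /andP[? _]; lra.
suff : v (x, t) <= appr m (x, t) + delta + kappa by lra.
have := h2 _ _; rewrite addr0; apply => [x'|tau /hd]; first by rewrite subr0.
by rewrite ler_norml => /andP[_ ?]; lra.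
Qed.

Lemma approximation_cauchy T e : 0 <= T -> 0 < e -> exists n0, forall n, (n0 <= n)%N ->
  forall x t, 0 <= t <= T -> `|appr n (x, t) - appr n0 (x, t)| <= e.
Proof.
move=> T0 e0; have e20 : 0 < e / 2 by rewrite divr_gt0.
have [n0 _ hn] := smooth_path_near zC T e20.
exists n0 => n n0n x t tT.
have := @stability_to_approximation (smooth_path z n) (@tent1 R) (appr n) n0 0 e T
  (smooth_path_C1 z n) (approximation_solution z hH u0B n).
rewrite addr0; apply => // [x'|tau tauT]; first by rewrite subrr normr0.
have h1 := hn n n0n tau tauT; have h2 := hn n0 (leqnn n0) tau tauT.
rewrite (_ : _ - _ = (z tau - smooth_path z n0 tau) - (z tau - smooth_path z n tau)); last by ring.
by apply: (le_trans (ler_normB _ _)); lra.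
Qed.

Lemma approximation_cvg x t : 0 <= t -> cvgn (fun n => appr n (x, t)).
Proof.
move=> t0; apply/cauchy_cvgP/cauchy_exP => e e0.
have e20 : 0 < e / 2 by rewrite divr_gt0.
have [n0 hn] := approximation_cauchy t0 e20.
exists (appr n0 (x, t)); exists n0 => // n /= n0n; rewrite -ball_normE /= distrC.
by apply: le_lt_trans (hn n n0n x t _) _; rewrite ?t0 ?lexx//; lra.
Qed.

Lemma tent_solution_limit : limit_of_approximations (@norm_ham R) z (@tent1 R) tent_solution.
Proof.
move=> T T0; apply/uniform_cvgP => e e0.
have e40 : 0 < e / 4 by rewrite divr_gt0.
have [n0 hn] := approximation_cauchy (ltW T0) e40.
exists n0 => // n /= n0n [x t]; rewrite /slab /= in_itv/= => tT.
have t0 : 0 <= t by case/andP: tT.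
have /cvgrPdist_lt /(_ _ e40)[m0 _ hm] := @approximation_cvg x t t0.
pose m := maxn m0 n0.
have h1 := hm m (leq_maxl _ _); rewrite -/(tent_solution (x, t)) in h1.
have h2 := hn m (leq_maxr _ _) x t tT; have h3 := hn n n0n x t tT.
rewrite (_ : tent_solution (x, t) - appr n (x, t) = (tent_solution (x, t) - appr m (x, t)) +
  ((appr m (x, t) - appr n0 (x, t)) - (appr n (x, t) - appr n0 (x, t)))); last by ring.
apply: (le_lt_trans (ler_normD _ _)).
have := ler_normB (appr m (x, t) - appr n0 (x, t)) (appr n (x, t) - appr n0 (x, t)).
lra.
Qed.

Lemma tent_solution_pathwise : pathwise_solution (@norm_ham R) z (@tent1 R) tent_solution.
Proof.
move=> z_ u0_ u_ z_C1 z_z u0_B u0_u0 u_S T T0; apply/uniform_cvgP => e e0.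
have e80 : 0 < e / 8 by rewrite divr_gt0.
have [m [hm1 hm2]] : exists m, (forall t, 0 <= t <= T -> `|z t - smooth_path z m t| < e / 8) /\
    (forall x t, 0 <= t <= T -> `|tent_solution (x, t) - appr m (x, t)| < e / 8).
  near \oo => m; exists m; split; first by near: m; exact: smooth_path_near.
  near: m; have /uniform_cvgP/(_ _ e80) := tent_solution_limit T0.
  by apply: filterS => m hm x t tT; apply: hm; rewrite /slab /= in_itv/=.
have /uniform_cvgP/(_ _ e80) := z_z T T0.
have /uniform_cvgP/(_ _ e80) := u0_u0.
apply: filterS2 => n hu0 hz [x t]; rewrite /slab /= in_itv/= => tT.
have hk x' : `|u0_ n x' - tent1 x'| <= e / 8 by rewrite distrC ltW// hu0.
have hd tau : 0 <= tau <= T -> `|z_ n tau - smooth_path z m tau| <= e / 4.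
  move=> tauT; have h1 := hm1 tau tauT; have := hz tau; rewrite /= in_itv/= => /(_ tauT) h2.
  rewrite (_ : _ - _ = (z tau - smooth_path z m tau) - (z tau - z_ n tau)); last by ring.
  by apply: (le_trans (ler_normB _ _)); lra.
have h1 := stability_to_approximation (z_C1 n) (u_S n) hk (ltW T0) hd x tT.
have h2 := hm2 x t tT.
rewrite (_ : tent_solution (x, t) - u_ n (x, t) =
  (tent_solution (x, t) - appr m (x, t)) - (u_ n (x, t) - appr m (x, t))); last by ring.
by apply: (le_lt_trans (ler_normB _ _)); lra.
Unshelve. all: by end_near. Qed.

Lemma approximation_range n x t : 0 <= appr n (x, t) <= 2^-1.
Proof.
rewrite /approximation evolution_tent; apply: reflected_flow_range.
exact: reflected_step_range.
Qed.

Lemma tent_solution_range x t : 0 <= t -> 0 <= tent_solution (x, t) <= 2^-1.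
Proof.
move=> t0; have c := @approximation_cvg x t t0; apply/andP; split.
  by apply: limr_ge => //; apply: nearW => n; case/andP: (approximation_range n x t).
by apply: limr_le => //; apply: nearW => n; case/andP: (approximation_range n x t).
Qed.

Lemma tent_solution_init x : tent_solution (x, 0) = tent1 x.
Proof.
rewrite /tent_solution; apply: (@cvg_lim _ _ _ _ _ _ (tent1 x)) => //.
rewrite (_ : (fun n => appr n (x, 0)) = fun=> tent1 x); first exact: cvg_cst.
apply/funext => n; have [M [K [u0M _ _]]] := BUC_almost_lipschitz u0B.
have N0 : 0 < n.+1%:R :> R by rewrite ltr0n.
exact: (evolution0 (smooth_path z n) hH N0 u0M).
Qed.

Lemma tent_solution_periodic t : Zd_periodic (fun x => tent_solution (x, t)).
Proof.
move=> x k; rewrite /tent_solution.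
suff -> : (fun n => appr n (x + map_mx intr k, t)) = (fun n => appr n (x, t)) by [].
apply/funext => n.
exact: (evolution_periodic _ _ _ t (@tent1_periodic R)).
Qed.

(** For [H p = |p|] unit velocities are free, so a net move by [1] wipes out
    the dependence on the position altogether. A constant then stays constant. *)
Lemma tent_solution_extinction tau : 0 <= tau -> 1 < `|z tau| ->
  forall t x, tau <= t -> tent_solution (x, t) = tent_solution (0, tau).
Proof.
move=> tau0 ztau t x taut.
have flat x' y' : tent_solution (y', tau) <= tent_solution (x', tau).
  apply/ler_addgt0Pr => e e0.
  have := limit_oscillation (eps := e) (m := 1) (L := 1) hH zC u0B tent_solution_limit
    (@tent1_periodic R) e0 _ ler01 ltr01 _ tau0 ztau x' y'.
  rewrite !mulr1; apply; last by rewrite lexx.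
  by move=> p _ i; rewrite mul1r /norm_ham; exact: coord_le_norm.
apply/le_anti/andP; split.
  exact: (limit_le_cst hH zC u0B tent_solution_limit tau0 taut).
exact: (limit_ge_cst hH zC u0B tent_solution_limit tau0 taut).
Qed.

(** Until the extinction time the solution is close to an approximation, which
    is uniformly continuous; afterwards it is constant. *)
Lemma tent_solution_BUC : unbounded_path z -> BUC (@slab R 1 `[0, +oo[) tent_solution.
Proof.
move=> zunb; have [tau tau0 ztau] := zunb 1.
apply: (@BUC_of _ _ _ _ 2^-1) => [[x t]|e e0].
  rewrite /slab /= in_itv/= andbT => t0; have /andP[a b] := tent_solution_range x t0.
  by rewrite ger0_norm.
have e30 : 0 < e / 3 by rewrite divr_gt0.
have T0 : 0 < tau + 1 by lra.
have /uniform_cvgP/(_ _ e30)[n _ /(_ n (leqnn n)) hn] := tent_solution_limit T0.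
have [aB _ _ _] := approximation_solution z hH u0B n.
have [r r0 hr] := BUC_unif (aB _ T0) e30.
exists (Num.min r 1); first by rewrite lt_min r0 ltr01.
move=> [x t] [y s]; rewrite /slab /= !in_itv/= !andbT => t0 s0 /ball_pairE[].
rewrite !lt_min => /andP[xy _] /andP[ts ts1].
have [tT|Tt] := leP t (tau + 1); have [sT|Ts] := leP s (tau + 1).
- have pt : slab `[0, tau + 1] (x, t) by rewrite /slab /= in_itv/= t0.
  have ps : slab `[0, tau + 1] (y, s) by rewrite /slab /= in_itv/= s0.
  have h1 := hn _ pt; have h2 := hn _ ps.
  have h3 : `|appr n (x, t) - appr n (y, s)| < e / 3 by apply: hr => //; apply/ball_pairE.
  rewrite (_ : _ - _ = (tent_solution (x, t) - appr n (x, t)) +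
    ((appr n (x, t) - appr n (y, s)) - (tent_solution (y, s) - appr n (y, s)))); last by ring.
  apply: (le_lt_trans (ler_normD _ _)).
  have := ler_normB (appr n (x, t) - appr n (y, s)) (tent_solution (y, s) - appr n (y, s)).
  lra.
- move: ts1; rewrite ltr_norml => /andP[? ?].
  by rewrite !(tent_solution_extinction tau0 ztau) ?subrr ?normr0//; lra.
- move: ts1; rewrite ltr_norml => /andP[? ?].
  by rewrite !(tent_solution_extinction tau0 ztau) ?subrr ?normr0//; lra.
- by rewrite !(tent_solution_extinction tau0 ztau) ?subrr ?normr0//; lra.
Qed.

Lemma tent_solution_periodic_pathwise : unbounded_path z ->
  periodic_pathwise_solution (@norm_ham R) z (@tent1 R) tent_solution.
Proof.
move=> zunb; split.
- exact: tent_solution_BUC.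
- by move=> t _; exact: tent_solution_periodic.
- exact: tent_solution_init.
- exact: tent_solution_pathwise.
Qed.

Lemma approximation_flow n x tau : 0 <= tau -> exists k,
  (forall j, (j <= k)%N -> 0 <= @grid R n.+1%:R j <= tau) /\
  appr n (x, tau) = reflected_flow (fun j => smooth_path z n (grid n.+1%:R j)) k
    (reflected_step (smooth_path z n tau - smooth_path z n (grid n.+1%:R k)) (tent1 x)).
Proof.
move=> tau0; exists (Num.truncn (tau * n.+1%:R)); split; last exact: evolution_tent.
have N0 : 0 < n.+1%:R :> R by rewrite ltr0n.
have /andP[k1 _] := truncn_itv (mulr_ge0 tau0 (ltW N0)).
by move=> j jk; rewrite divr_ge0//= ler_pdivrMr// (le_trans _ k1)// ler_nat.
Qed.

Lemma approximation_ge n x tau e : 0 <= tau -> 0 <= e ->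
  (forall t, 0 <= t <= tau -> - e <= smooth_path z n t) ->
  2^-1 - e <= smooth_path z n tau -> 2^-1 - e <= appr n (x, tau).
Proof.
move=> tau0 e0 hz htau; have [k [gk ->]] := approximation_flow n x tau0.
set A := fun j : nat => _; set a := smooth_path z n tau - _.
have hA j (jk : (j <= k)%N) : - e <= A j := hz _ (gk j jk).
have := reflected_flow_ge (s := reflected_step a (tent1 x)) e0 hA.
have -> : A 0%N = 0 by rewrite /A grid0 smooth_path0.
rewrite addr0; apply.
have := hA k (leqnn k); have /andP[? ?] := tent1_range x.
by case: (reflected_step_cases a (tent1 x)) => -[-> h]; rewrite /a /A in h *; lra.
Qed.

Lemma approximation_le n x tau e : 0 <= tau -> 0 <= e ->
  (forall t, 0 <= t <= tau -> smooth_path z n t <= e) ->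
  smooth_path z n tau <= e - 2^-1 -> appr n (x, tau) <= e.
Proof.
move=> tau0 e0 hz htau; have [k [gk ->]] := approximation_flow n x tau0.
set A := fun j : nat => _; set a := smooth_path z n tau - _.
have hA j (jk : (j <= k)%N) : A j <= e := hz _ (gk j jk).
have := reflected_flow_le (s := reflected_step a (tent1 x)) e0 hA.
have -> : A 0%N = 0 by rewrite /A grid0 smooth_path0.
rewrite addr0; apply.
have := hA k (leqnn k); have /andP[? ?] := tent1_range x.
by case: (reflected_step_cases a (tent1 x)) => -[-> h]; rewrite /a /A in h *; lra.
Qed.

Lemma tent_solution_ge x tau : 0 <= tau -> (forall t, 0 <= t <= tau -> - (1 / 8) <= z t) ->
  1 / 2 <= z tau -> 3 / 8 <= tent_solution (x, tau).
Proof.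
move=> tau0 hz ztau; apply/ler_addgt0Pr => e e0.
have e20 : 0 < e / 2 by rewrite divr_gt0.
have [n [_ h2 h1]] := limit_index zC tent_solution_limit tau0 tau0 e20.
have : 2^-1 - (1 / 8 + e / 2) <= appr n (x, tau).
  apply: approximation_ge => //; first lra.
    by move=> t tt; have := h1 t tt; have := hz t tt; rewrite ltr_norml => ? /andP[? ?]; lra.
  by have := h1 tau; rewrite tau0 lexx => /(_ isT); rewrite ltr_norml => /andP[? ?]; lra.
by have := h2 x; rewrite ltr_norml => /andP[? ?]; lra.
Qed.

Lemma tent_solution_le x tau : 0 <= tau -> (forall t, 0 <= t <= tau -> z t <= 1 / 8) ->
  z tau <= - (1 / 2) -> tent_solution (x, tau) <= 1 / 8.
Proof.
move=> tau0 hz ztau; apply/ler_addgt0Pr => e e0.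
have e20 : 0 < e / 2 by rewrite divr_gt0.
have [n [_ h2 h1]] := limit_index zC tent_solution_limit tau0 tau0 e20.
have : appr n (x, tau) <= 1 / 8 + e / 2.
  apply: approximation_le => //; first lra.
    by move=> t tt; have := h1 t tt; have := hz t tt; rewrite ltr_norml => ? /andP[? ?]; lra.
  by have := h1 tau; rewrite tau0 lexx => /(_ isT); rewrite ltr_norml => /andP[? ?]; lra.
by have := h2 x; rewrite ltr_norml => /andP[? ?]; lra.
Qed.

End tent_solution.

(** * The limit as a random variable *)

Section random_limit.
Variables (R : realType) (dT : measure_display) (T : measurableType dT)
  (P : probability T R) (B : R -> {RV P >-> R}).
Hypothesis BM : brownian_motion P B.

Let path w t : R := B t w.

Lemma measurable_smooth_path n t :
  measurable_fun [set: T] (fun w => smooth_path (path w) n t).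
Proof.
apply: measurable_sum => k; apply: measurable_funM => //.
by apply: measurable_funB.
Qed.

Lemma measurable_reflected_step (a s : T -> R) : measurable_fun [set: T] a ->
  measurable_fun [set: T] s -> measurable_fun [set: T] (fun w => reflected_step (a w) (s w)).
Proof.
move=> ma ms; apply: measurable_maxr => //.
by apply: measurable_minr => //; exact: measurable_funD.
Qed.

Lemma measurable_reflected_flow (A : nat -> T -> R) k (s : T -> R) :
  (forall j, measurable_fun [set: T] (A j)) -> measurable_fun [set: T] s ->
  measurable_fun [set: T] (fun w => reflected_flow (fun j => A j w) k (s w)).
Proof.
move=> mA; elim: k s => [//|k IH] s ms /=.
by apply: IH; apply: measurable_reflected_step => //; exact: measurable_funB.
Qed.

Lemma measurable_approximation n x t : measurable_fun [set: T]
  (fun w => approximation (@norm_ham R) (path w) (@tent1 R) n (x, t)).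
Proof.
rewrite /approximation; under eq_fun do rewrite evolution_tent.
apply: (@measurable_reflected_flow (fun j w => smooth_path (path w) n (grid n.+1%:R j))).
  by move=> j; exact: measurable_smooth_path.
apply: measurable_reflected_step => //.
by apply: measurable_funB; exact: measurable_smooth_path.
Qed.

Lemma measurable_tent_solution x t : 0 <= t ->
  measurable_fun [set: T] (fun w => tent_solution (path w) (x, t)).
Proof.
move=> t0; apply: (measurable_fun_cvg (fun n => measurable_approximation n x t)) => w _.
exact: (approximation_cvg (brownian_path BM w) t0).
Qed.

(** A limit superior is total and measurable in [w] without restriction to the
    event on which the limit exists. *)
Definition long_time_limit w : R := limn_sup (fun k : nat => tent_solution (path w) (0, k%:R)).

Lemma measurable_long_time_limit : measurable_fun [set: T] long_time_limit.
Proof.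
have bd w k : 0 <= tent_solution (path w) (0, k%:R) <= 2^-1.
  exact: (tent_solution_range (brownian_path BM w)).
apply: measurable_fun_limn_sup => [w _|w _|k].
- by exists 2^-1 => _ [k _ <-]; case/andP: (bd w k).
- by exists 0 => _ [k _ <-]; case/andP: (bd w k).
- exact: measurable_tent_solution.
Qed.

Lemma long_time_limitE w : unbounded_path (path w) ->
  exists2 tau, 0 <= tau & forall t x, tau <= t ->
    tent_solution (path w) (x, t) = long_time_limit w.
Proof.
move=> zunb; have [tau tau0 ztau] := zunb 1.
have ext := tent_solution_extinction (brownian_path BM w) tau0 ztau.
exists tau => // t x taut; rewrite ext//; apply/esym.
have vc : (fun k : nat => tent_solution (path w) (0, k%:R)) @ \oo -->
    tent_solution (path w) (0, tau).
  apply: cvg_near_cst; near=> k; apply: ext.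
  by near: k; exact: nbhs_infty_ger.
rewrite /long_time_limit cvg_limn_supE; last by apply/cvg_ex; eexists; exact: vc.
exact: cvg_lim vc.
Unshelve. all: by end_near. Qed.

Lemma long_time_limit_converges w u : unbounded_path (path w) ->
  periodic_pathwise_solution (@norm_ham R) (path w) (@tent1 R) u ->
  converges_to_constant u (long_time_limit w).
Proof.
move=> zunb [_ _ _ pu]; have zC := brownian_path BM w.
have ulim := pathwise_limit (norm_hamiltonian R) zC (@tent1_BUC R) pu.
have [tau tau0 htau] := long_time_limitE zunb.
apply/converges_to_constantP => e e0; exists tau => t /ltW taut x.
have t0 := le_trans tau0 taut.
by rewrite (limit_unique ulim (tent_solution_limit zC) x t0) htau// subrr normr0.
Qed.

(** An event of positive probability meets the almost sure event on which the
    limit exists and equals [c]. The corridor events on the two sides force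
    [3/8 <= c] and [c <= 1/8]. *)
Lemma long_time_limit_nonconstant c : ~ {ae P, forall w, long_time_limit w = c}.
Proof.
move=> Uc; have zC := brownian_path BM.
have key (E : set T) : measurable E -> (0 < P E)%E ->
    exists w, [/\ E w, unbounded_path (path w) & long_time_limit w = c].
  move=> mE PE; apply: contrapT => nw.
  have : P.-negligible E.
    have h : {ae P, forall w, unbounded_path (path w) /\ long_time_limit w = c}.
      by apply: filterS2 (brownian_unbounded BM) Uc => w.
    by apply: (negligibleS _ h) => w Ew /= [h1 h2]; apply: nw; exists w.
  by move=> /(negligibleP P mE) P0; rewrite P0 ltxx in PE.
have lim_at w tau : unbounded_path (path w) -> 0 <= tau ->
    exists2 t, tau <= t & forall x, tent_solution (path w) (x, t) = long_time_limit w.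
  move=> zunb tau0; have [tau' _ h] := long_time_limitE zunb.
  exists (Num.max tau tau'); first by rewrite le_max lexx.
  by move=> x; apply: h; rewrite le_max lexx orbT.
have hH := norm_hamiltonian R.
have [tau [E [/ltW tau0 mE PE hE]]] := corridor BM false.
have [w [Ew wunb wc]] := key E mE PE.
have [hE1 hE2] := hE w Ew; have {hE2} hE2 : 1 / 2 <= path w tau by move: hE2; rewrite expr0 (mul1r (B tau w)).
have c38 : 3 / 8 <= c.
  have [t taut ht] := lim_at w tau wunb tau0; rewrite -wc -(ht 0).
  apply: (limit_ge_cst hH (zC w) (@tent1_BUC R) (tent_solution_limit (zC w)) tau0 taut) => x.
  apply: (tent_solution_ge (zC w) x tau0); last exact: hE2.
  by move=> t' /hE1; rewrite expr0 (mul1r (B t' w)).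
have [tau' [E' [/ltW tau'0 mE' PE' hE']]] := corridor BM true.
have [w' [Ew' wunb' wc']] := key E' mE' PE'.
have [hE'1 hE'2] := hE' w' Ew'; have {hE'2} hE'2 : path w' tau' <= - (1 / 2).
  by move: hE'2; rewrite expr1 mulN1r lerNr.
have c18 : c <= 1 / 8.
  have [t taut ht] := lim_at w' tau' wunb' tau'0; rewrite -wc' -(ht 0).
  apply: (limit_le_cst hH (zC w') (@tent1_BUC R) (tent_solution_limit (zC w')) tau'0 taut) => x.
  apply: (tent_solution_le (zC w') x tau'0); last exact: hE'2.
  by move=> t' /hE'1; rewrite expr1 mulN1r lerN2.
by have := le_trans c38 c18; rewrite ler_pM2r ?invr_gt0// (ler_nat R 3 1).
Qed.

End random_limit.

Lemma norm_ham_convex (R : realType) : convex_function [set: 'rV[R]_1] (@norm_ham R).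
Proof.
move=> t p q _ _; have [_ cH _ _] := norm_hamiltonian R.
rewrite convRE; apply: cH.
by apply/andP; split.
Qed.

Unset Implicit Arguments.

Theorem theorem1p9 (R : realType) :
  (forall (d : nat) (H : 'rV[R]_d -> R),
     (0 < d)%N -> continuous H -> convex_function [set: 'rV[R]_d] H ->
     positive_off_origin H ->
   forall (dT : measure_display) (T : measurableType dT)
     (P : probability T R) (B : R -> {RV P >-> R}),
     brownian_motion P B ->
     {ae P, forall w, exists u_inf : ('rV[R]_d -> R) -> R,
        forall u : 'rV[R]_d * R -> R,
          periodic_pathwise_solution H (fun t => B t w)
            (fun x => u (x, 0)) u ->
          converges_to_constant u (u_inf (fun x => u (x, 0)))})
  /\
  (exists (d : nat) (H : 'rV[R]_d -> R) (u0 : 'rV[R]_d -> R),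
     [/\ (0 < d)%N, continuous H, convex_function [set: 'rV[R]_d] H,
         positive_off_origin H & BUC [set: 'rV[R]_d] u0 /\ Zd_periodic u0] /\
   forall (dT : measure_display) (T : measurableType dT)
     (P : probability T R) (B : R -> {RV P >-> R}),
     brownian_motion P B ->
     exists U : {RV P >-> R},
       {ae P, forall w,
          (exists u : 'rV[R]_d * R -> R,
             periodic_pathwise_solution H (fun t => B t w) u0 u) /\
          (forall u : 'rV[R]_d * R -> R,
             periodic_pathwise_solution H (fun t => B t w) u0 u ->
             converges_to_constant u (U w))} /\
       ~ (exists c : R, {ae P, forall w, U w = c})).
Proof.
split.
  move=> d H _ Hc cH [H0 Hpos] dT T P B BM.
  have Hpos' p : p != 0 -> 0 < H p by move=> /Hpos; rewrite H0.
  have hH : hamiltonian H.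
    split=> //; first exact: convex_functionE.
    by move=> p; have [->|/Hpos'/ltW//] := eqVneq p 0; rewrite H0.
  apply: filterS (brownian_unbounded BM) => w wunb.
  exact: limit_along_unbounded_path hH Hpos' (brownian_path BM w) wunb.
have [Hc _ H0 _] := norm_hamiltonian R.
exists 1%N, (@norm_ham R), (@tent1 R); split.
  split=> //; first exact: norm_ham_convex.
    by split=> // p p0; rewrite H0 /norm_ham normr_gt0.
  by split; [exact: tent1_BUC|exact: tent1_periodic].
move=> dT T P B BM.
have mU := measurable_long_time_limit BM.
pose U : {RV P >-> R} := mfun_Sub (mem_set mU).
have UE w : U w = long_time_limit B w by rewrite /U mfun_valP.
exists U; split.
  apply: filterS (brownian_unbounded BM) => w wunb; split.
    by exists (tent_solution (fun t => B t w)); exact: tent_solution_periodic_pathwise (brownian_path BM w) wunb.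
  by move=> u uP; rewrite UE; exact: long_time_limit_converges.
move=> [c Uc]; apply: (long_time_limit_nonconstant BM (c := c)).
by apply: filterS Uc => w; rewrite UE.
Qed.
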